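(* Let $n\geq 2$ and let $\mathcal{C}\subset (\mathbb{C}^* )^n$ be an algebraic curve. Assume that no irreducible component of $\mathcal{C}$ is contained in an algebraic subtorus of dimension less than $2$. Then the area of the amoeba $\mathrm{Log}(\mathcal{C})\subset\mathbb{R}^n$ is finite.
   Context: $\mathrm{Log}:(\mathbb{C}^* )^n\to\mathbb{R}^n$ is the map $(z_1,\dots,z_n)\mapsto(\log|z_1|,\dots,\log|z_n|)$; the amoeba of $\mathcal{C}$ is $\mathrm{Log}(\mathcal{C})$. The area of the amoeba is its $2$-dimensional area with respect to the Euclidean metric of $\mathbb{R}^n$, i.e. the area for the induced Riemannian metric on the image of the locus of $\mathcal{C}$ where $\mathrm{Log}|_{\mathcal{C}}$ has real rank $2$, each point of the image being counted once (equivalently, the $2$-dimensional Hausdorff measure of $\mathrm{Log}(\mathcal{C})$; when $n=2$ this is Lebesgue measure). *)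

(* Defs.v *)
From HB Require Import structures.
From mathcomp Require Import all_boot all_order all_algebra.
From mathcomp Require Import -(notations) mpoly.
From mathcomp Require Import complex.
From mathcomp Require Import all_classical all_reals all_analysis.

Set Implicit Arguments.
Unset Strict Implicit.
Unset Printing Implicit Defensive.

Import Order.TTheory GRing.Theory Num.Theory.

Local Open Scope classical_set_scope.
Local Open Scope ring_scope.

(* mpoly's notations clash with those of mathcomp-analysis: below, [mpoly n K]
   is {mpoly K[n]} and [meval v p] is p.@[v]. *)

Section Torus.
Variable R : realType.

(* (C^* )^n, as a subset of C^n. *)
Definition torus (n : nat) : set ('I_n -> R[i]) :=
  [set z | forall i, z i != 0].

(* Regular functions on (C^* )^n: C[z_1^{+-1}, ..., z_n^{+-1}] is the
   localization of C[z_1, ..., z_n] at z_1 ... z_n.  Values off the torus are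
   irrelevant. *)
Definition laurent (n : nat) (f : ('I_n -> R[i]) -> R[i]) : Prop :=
  exists (p : mpoly n R[i]) (k : nat), forall z, torus z ->
    f z = meval z p / (\prod_(i < n) z i) ^+ k.

Definition zariski_closed (n : nat) (Z : set ('I_n -> R[i])) : Prop :=
  exists2 S : set (('I_n -> R[i]) -> R[i]), (forall f, S f -> laurent f) &
    Z = [set z | torus z /\ forall f, S f -> f z = 0].

Definition zariski_irreducible (n : nat) (Z : set ('I_n -> R[i])) : Prop :=
  Z !=set0 /\
  forall A B, zariski_closed A -> zariski_closed B ->
    Z `<=` A `|` B -> Z `<=` A \/ Z `<=` B.

Definition irreducible_component (n : nat) (X Z : set ('I_n -> R[i])) : Prop :=
  [/\ zariski_closed Z, zariski_irreducible Z, Z `<=` X &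
   forall Y, zariski_closed Y -> zariski_irreducible Y -> Y `<=` X ->
     Z `<=` Y -> Y = Z].

(* The restrictions of f_1, ..., f_d to Z are algebraically independent
   over C. *)
Definition alg_independent (n d : nat) (Z : set ('I_n -> R[i]))
    (f : 'I_d -> ('I_n -> R[i]) -> R[i]) : Prop :=
  forall P : mpoly d R[i],
    (forall z, Z z -> meval (fun j => f j z) P = 0) -> P = 0.

(* Dimension of a closed set as the transcendence degree over C of its ring of
   regular functions.  When Z is irreducible this is the transcendence degree
   of its function field; in general it is the maximum of the dimensions of the
   irreducible components.  The empty set has no dimension. *)
Definition zariski_dim (n : nat) (Z : set ('I_n -> R[i])) (d : nat) : Prop :=
  (exists f : 'I_d -> ('I_n -> R[i]) -> R[i],
     (forall j, laurent (f j)) /\ alg_independent Z f) /\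
  (forall (m : nat) (f : 'I_m -> ('I_n -> R[i]) -> R[i]),
     (forall j, laurent (f j)) -> alg_independent Z f -> (m <= d)%N).

(* Curve = algebraic set of pure dimension 1; it may be reducible. *)
Definition algebraic_curve (n : nat) (X : set ('I_n -> R[i])) : Prop :=
  [/\ zariski_closed X, zariski_dim X 1 &
   forall Z, irreducible_component X Z -> zariski_dim Z 1].

Definition regular_map (m n : nat) (X : set ('I_m -> R[i]))
    (Y : set ('I_n -> R[i])) (phi : ('I_m -> R[i]) -> ('I_n -> R[i])) : Prop :=
  (forall z, X z -> Y (phi z)) /\
  (forall i, exists2 f, laurent f & forall z, X z -> phi z i = f z).

(* Closed subgroup of (C^* )^n isomorphic, as an algebraic group, to
   (C^* )^d.  Translates of such subgroups are not subtori. *)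
Definition algebraic_subtorus (n d : nat) (T : set ('I_n -> R[i])) : Prop :=
  zariski_closed T /\
  exists (phi : ('I_d -> R[i]) -> ('I_n -> R[i]))
         (psi : ('I_n -> R[i]) -> ('I_d -> R[i])),
    [/\ regular_map (@torus d) T phi,
        regular_map T (@torus d) psi,
        forall s, torus s -> psi (phi s) = s,
        forall z, T z -> phi (psi z) = z &
        forall s t, torus s -> torus t ->
          phi (fun j => s j * t j) = (fun i => phi s i * phi t i)].

Definition Log (n : nat) (z : 'I_n -> R[i]) : 'I_n -> R :=
  fun i => ln (Normc.normc (z i)).

Definition amoeba (n : nat) (X : set ('I_n -> R[i])) : set ('I_n -> R) :=
  @Log n @` X.

End Torus.

Section Area.
Variable R : realType.
Local Open Scope ereal_scope.

Definition euclidean_dist (n : nat) (x y : 'I_n -> R) : R :=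
  Num.sqrt (\sum_(i < n) (x i - y i) ^+ 2)%R.

(* The 0 makes the diameter of the empty set 0 rather than -oo. *)
Definition diameter (n : nat) (A : set ('I_n -> R)) : \bar R :=
  maxe 0 (ereal_sup [set (euclidean_dist p.1 p.2)%:E | p in A `*` A]).

(* The factor pi / 4 (area of a disc of diameter 1) normalizes the Hausdorff
   measure so that it is Lebesgue measure when n = 2. *)
Definition hausdorff2_delta (n : nat) (delta : R) (A : set ('I_n -> R)) :
    \bar R :=
  ereal_inf [set \sum_(0 <= k <oo) ((pi / 4)%:E * diameter (U k) ^+ 2)
            | U in [set U : (set ('I_n -> R))^nat |
                     A `<=` \bigcup_k U k /\
                     forall k, diameter (U k) <= delta%:E]].

Definition area (n : nat) (A : set ('I_n -> R)) : \bar R :=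
  ereal_sup [set hausdorff2_delta delta A | delta in [set d : R | (0 < d)%R]].

End Area.

(* Main.v *)
(* On C any two coordinates are algebraically dependent, so C lies in finitely
   many multigraphs {P_i(t, z_i) = 0 for all i} over a coordinate t = z_{i0},
   up to a finite set.
   By compactness of the Riemann sphere it is enough to treat a punctured disc
   around a point of the t-line.  There put s = e^w, w = u + i theta.  A Newton
   polygon argument shows that an algebraic function x of s satisfies
   x e^{-alpha w} = c + O(e^{eps u}) with alpha real and (alpha, c) in a finite
   list.  Apply this to a branch y of C (slope alpha) and to q - alpha, where
   q = d log y / dw is again algebraic: a slope beta <= 0 of q - alpha is
   impossible, because y e^{-alpha w}, which stays close to c, would then move
   by a definite amount along a unit segment of a ray.  Hence q is bounded and
   Im q = O(e^{eps u}), so (u, theta) |-> log |y| is Lipschitz with constants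
   O(1) in u and O(e^{eps u}) in theta, and the half strip has an image of
   finite area. *)

Require Import Defs.
From mathcomp Require Import all_boot all_order all_algebra.
From mathcomp Require Import -(notations) mpoly.
From mathcomp Require Import complex.
From mathcomp Require Import all_classical all_reals all_analysis.
From mathcomp Require Import separable.
From mathcomp Require Import ring lra.

Set Implicit Arguments.
Unset Strict Implicit.
Unset Printing Implicit Defensive.

Import Order.TTheory GRing.Theory Num.Theory.
Import numFieldNormedType.Exports.

Local Open Scope classical_set_scope.
Local Open Scope ring_scope.

(** * Covers bounding the Hausdorff measure *)

Section Covers.
Variables (R : realType) (n : nat).
Implicit Types (A B : set ('I_n -> R)) (delta M : R).

(** Why q = d log y / dw is the quantity to control: d log |y| = Re q du - Im q d theta, and the
    half strip is infinitely long, so a merely bounded Re q has to be paired with an Im q that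
    decays. The exponent alpha is real, hence Im q = Im (q - alpha), and decay of q - alpha
    suffices. No branch is ever chosen or continued, and no Puiseux expansion is used. At each base
    point y ranges over all roots of the fibre, derivatives compare two arbitrary nearby points of
    the curve, and a path is followed by continuity of roots. Since q - alpha satisfies a polynomial
    equation of its own, the asymptotics proved for y apply to it verbatim. Compactness enters
    through bisection of intervals and rectangles. *)

Definition diamle A (d : R) :=
  forall x y, A x -> A y -> euclidean_dist x y <= d.

(** Real bounds [d k] replace the diameters and bounded partial sums replace the series, which keeps
    every estimate in R until [area_finite]. *)
Definition cov delta M A :=
  exists (U : nat -> set ('I_n -> R)) (d : nat -> R),
  [/\ A `<=` \bigcup_k U k, forall k, 0 <= d k <= delta,
      forall k, diamle (U k) (d k) & forall N, \sum_(k < N) d k ^+ 2 <= M].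

Definition finarea A := exists M, forall delta, 0 < delta -> cov delta M A.

Lemma cov_sub delta M M' A B : A `<=` B -> M' <= M -> cov delta M' B -> cov delta M A.
Proof.
move=> AB MM [U [d [BU d0 Ud dM]]]; exists U, d; split => //.
  exact: subset_trans BU.
by move=> N; exact: le_trans MM.
Qed.

Lemma cov_ge0 delta M A : cov delta M A -> 0 <= M.
Proof. by move=> [U [d [_ _ _ /(_ 0)]]]; rewrite big_ord0. Qed.

Lemma cov_diamle delta d A : 0 <= d <= delta -> diamle A d -> cov delta (d ^+ 2) A.
Proof.
move=> /andP[d0 dd] Ad.
exists (fun k => if k is 0 then A else set0), (fun k => if k is 0 then d else 0).
split; first by move=> x Ax; exists 0.
- by case=> [|k]; rewrite ?d0 ?dd // lexx (le_trans d0 dd).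
- by case=> // k x y [].
- case=> [|N]; first by rewrite big_ord0 sqr_ge0.
  by rewrite big_ord_recl /= big1 ?addr0 // => i _; rewrite expr0n.
Qed.

Lemma cov_bigcup delta M (A : nat -> set ('I_n -> R)) (m : nat -> R) :
  0 <= delta -> (forall k, cov delta (m k) (A k)) ->
  (forall N, \sum_(k < N) m k <= M) -> cov delta M (\bigcup_k A k).
Proof.
move=> delta0 covA mM.
have [Ud H] := choice (fun k => let: ex_intro U (ex_intro d P) := covA k in
  ex_intro (fun Ud : (nat -> set ('I_n -> R)) * (nat -> R) =>
    [/\ A k `<=` \bigcup_i Ud.1 i, forall i, 0 <= Ud.2 i <= delta,
      forall i, diamle (Ud.1 i) (Ud.2 i) & forall N, \sum_(i < N) Ud.2 i ^+ 2 <= m k]) (U, d) P).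
pose U k := (Ud k).1; pose d k := (Ud k).2.
pose V j := if @pickle_inv (nat * nat)%type j is Some (k, i) then U k i else set0.
pose c j := if @pickle_inv (nat * nat)%type j is Some (k, i) then d k i else 0.
exists V, c; split.
- move=> x [k _ Akx]; have [/(_ x Akx)[i _ Ux] _ _ _] := H k.
  by exists (pickle (k, i)) => //; rewrite /V pickleK_inv.
- move=> j; rewrite /c; case: pickle_inv => [[k i]|]; last by rewrite lexx.
  by have [_ h _ _] := H k; exact: h.
- move=> j; rewrite /c /V; case: pickle_inv => [[k i]|]; last by move=> x y [].
  by have [_ _ h _] := H k; exact: h.
move=> N.
pose b j := if @pickle_inv (nat * nat)%type j is Some (k, i) then (maxn k i).+1 else 0.
(* Every pair coded below N has both indices below B, so the partial sum is part of a B by B double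
   sum in which each pair counts at most once. *)
pose B := (\max_(j < N) b j)%N.
have -> : \sum_(j < N) c j ^+ 2 =
    \sum_(j < N) \sum_(k < B) \sum_(i < B) (pickle (k : nat, i : nat) == j)%:R * d k i ^+ 2.
  apply: eq_bigr => j _; have : (b j <= B)%N by apply: (leq_bigmax j).
  rewrite /c /b; have pK := @pickleK_inv (nat * nat)%type.
  case E: (@pickle_inv (nat * nat)%type j) (pickle_invK (T := (nat * nat)%type) j) => [[k i]|] /=.
    move=> <- kiB.
    have kB : (k < B)%N by apply: leq_trans kiB; rewrite ltnS leq_maxl.
    have iB : (i < B)%N by apply: leq_trans kiB; rewrite ltnS leq_maxr.
    rewrite (bigD1 (Ordinal kB)) //= (bigD1 (Ordinal iB)) //= eqxx mul1r.
    rewrite big1 => [|i' i'i]; last first.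
      rewrite (_ : _ == _ = false) ?mul0r //; apply/negbTE; apply: contra i'i.
      by move=> /eqP/(pcan_inj pK) [ii]; apply/eqP/val_inj.
    rewrite addr0 [X in _ + X]big1 ?addr0 // => k' k'k; rewrite big1 // => i' _.
    rewrite (_ : _ == _ = false) ?mul0r //; apply/negbTE; apply: contra k'k.
    by move=> /eqP/(pcan_inj pK) [kk _]; apply/eqP/val_inj.
  move=> _ _; rewrite expr0n /=; apply/esym.
  rewrite big1 // => k _; rewrite big1 // => i _.
  rewrite (_ : _ == _ = false) ?mul0r //; apply/negbTE/negP => /eqP ej.
  by move: E; rewrite -ej pK.
rewrite exchange_big /=; apply: le_trans (mM B); apply: ler_sum => k _.
rewrite exchange_big /=; have [_ _ _ /(_ B)] := H k; apply: le_trans.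
apply: ler_sum => i _; rewrite -mulr_suml -[leRHS]mul1r ler_wpM2r ?sqr_ge0 //.
have [h|h] := ltnP (pickle (k : nat, i : nat)) N.
  rewrite (bigD1 (Ordinal h)) //= eqxx big1 ?addr0 // => j ji.
  rewrite (_ : _ == _ = false) //; apply/negbTE; apply: contra ji.
  by move=> /eqP e; apply/eqP/val_inj.
rewrite big1 ?ler01 // => j _; rewrite gtn_eqF //.
exact: leq_trans (ltn_ord j) h.
Qed.

Lemma cov_set0 delta : 0 <= delta -> cov delta 0 set0.
Proof.
move=> d0; exists (fun=> set0), (fun=> 0); split=> //.
- by move=> k; rewrite lexx.
- by move=> k x y [].
- by move=> N; rewrite big1 // => i _; rewrite expr0n.
Qed.

Lemma covU delta M M' A B : 0 <= delta ->
  cov delta M A -> cov delta M' B -> cov delta (M + M') (A `|` B).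
Proof.
move=> d0 cA cB.
pose F k := if k is 0 then A else if k is 1 then B else set0.
apply: (@cov_sub _ _ (M + M') _ (\bigcup_k F k)) => //.
  by move=> x [Ax|Bx]; [exists 0 | exists 1].
apply: (@cov_bigcup _ _ _ (fun k => if k is 0 then M else if k is 1 then M' else 0)) => //.
  by case=> [//|[//|k]]; exact: cov_set0.
case=> [|[|N]].
- by rewrite big_ord0 addr_ge0 ?(cov_ge0 cA) ?(cov_ge0 cB).
- by rewrite big_ord_recl big_ord0 addr0 lerDl (cov_ge0 cB).
- by rewrite 2!big_ord_recl /= big1 ?addr0.
Qed.

Lemma cov_finite delta (I : finType) (A : I -> set ('I_n -> R)) (m : R) : 0 <= delta ->
  (forall i, cov delta m (A i)) -> cov delta (#|I|%:R * m) (\bigcup_i A i).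
Proof.
move=> d0 cA.
suff H (s : seq I) : cov delta ((size s)%:R * m) [set x | exists2 i, i \in s & A i x].
  have := H (enum I); rewrite -cardE; apply: cov_sub => // x [i _ Ax].
  by exists i; rewrite // mem_enum.
elim: s => [|i s IH].
  by rewrite mul0r; apply: cov_sub (cov_set0 d0) => // x [].
rewrite /= -natr1 mulrDl mul1r addrC.
apply: cov_sub (lexx _) (covU d0 (cA i) IH).
move=> x [j]; rewrite inE => /orP[/eqP->|js] Ax; [by left | by right; exists j].
Qed.

Lemma finareaU A B : finarea A -> finarea B -> finarea (A `|` B).
Proof.
move=> [M HM] [M' HM']; exists (M + M') => d d0.
by apply: covU; [exact: ltW | exact: HM | exact: HM'].
Qed.

Lemma finarea_sub A B : A `<=` B -> finarea B -> finarea A.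
Proof. by move=> AB [M HM]; exists M => d d0; apply: cov_sub (HM d d0). Qed.

Lemma finarea0 : finarea set0.
Proof. by exists 0 => d d0; apply/cov_set0/ltW. Qed.

Lemma finarea_seq (I : eqType) (s : seq I) (A : I -> set ('I_n -> R)) :
  (forall i, i \in s -> finarea (A i)) -> finarea [set x | exists2 i, i \in s & A i x].
Proof.
elim: s => [|i s IH] H; first by apply: finarea_sub finarea0 => x [].
apply: finarea_sub (finareaU (H i (mem_head _ _)) (IH _)) => [x [j]|j js]; last first.
  by apply: H; rewrite inE js orbT.
by rewrite inE => /orP[/eqP->|js] Ax; [left | right; exists j].
Qed.

Lemma finarea1 x : finarea [set x].
Proof.
exists 0 => d d0; rewrite -[0](expr0n _ 2); apply: cov_diamle; rewrite ?lexx ?ltW //.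
move=> y z -> ->; rewrite /euclidean_dist big1 ?sqrtr0 // => i _.
by rewrite subrr expr0n.
Qed.

Lemma area_finite A : finarea A -> (area A < +oo)%E.
Proof.
move=> [M HM]; apply: (@le_lt_trans _ _ (pi / 4 * M)%:E); last exact: ltry.
apply: ub_ereal_sup => _ [d d0 <-].
have [U [c [AU c0 Uc cM]]] := HM d d0.
have diamU k : (diameter (U k) <= (c k)%:E)%E.
  rewrite /diameter ge_max lee_fin; have /andP[-> _] /= := c0 k.
  by apply: ub_ereal_sup => _ [[x y] /= [Ux Uy] <-]; rewrite lee_fin; exact: Uc.
have diam0 k : (0 <= diameter (U k))%E by rewrite /diameter le_max lexx.
have pi40 : (0 <= pi / 4 :> R) by rewrite divr_ge0 ?pi_ge0.
apply: (@le_trans _ _ (\sum_(0 <= k <oo) ((pi / 4)%:E * diameter (U k) ^+ 2))%E).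
  apply: ereal_inf_lbound; exists U => //; split=> // k; apply: le_trans (diamU k) _.
  by rewrite lee_fin; have /andP[] := c0 k.
apply: lime_le.
  apply: is_cvg_nneseries => k _ _; apply: mule_ge0; rewrite ?lee_fin //.
  exact: expe_ge0.
apply: nearW => N; rewrite big_mkord.
have -> : (pi / 4 * M)%:E = ((pi / 4)%:E * M%:E)%E by rewrite EFinM.
rewrite -ge0_sume_distrr; last by move=> i _; exact: expe_ge0.
apply: lee_pmul; rewrite ?lee_fin //; first by apply: sume_ge0 => i _; exact: expe_ge0.
apply: (@le_trans _ _ (\sum_(i < N) c i ^+ 2)%:E); last by rewrite lee_fin.
rewrite -sumEFin; apply: lee_sum => i _; rewrite expe2 EFinM.
by apply: lee_pmul.
Qed.

End Covers.

(** * Bisection and the complex exponential *)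

Section Bisection.
Variable R : realType.

Lemma half_small (c delta : R) : 0 < delta ->
  exists m0, forall m, (m0 <= m)%N -> c * 2^-1 ^+ m < delta.
Proof.
move=> d0; have [N HN] : exists N : nat, `|c| / delta < N%:R.
  by exists (Num.bound (`|c| / delta)); apply: archi_boundP; rewrite divr_ge0 // ltW.
exists N => m Nm; apply: le_lt_trans (ler_wpM2r _ (ler_norm c)) _.
  by rewrite exprn_ge0 // invr_ge0.
move: HN; rewrite exprVn ltr_pdivrMr ?exprn_gt0 // ltr_pdivrMr // => /lt_le_trans; apply.
rewrite mulrC (ler_wpM2l (ltW d0)) // -natrX ler_nat.
exact: leq_trans Nm (ltnW (ltn_expl m (ltnSn 1))).
Qed.

Lemma nested_point (c : R) (x : nat -> R) :
  (forall m, x m <= x m.+1 /\ x m.+1 + c * 2^-1 ^+ m.+1 <= x m + c * 2^-1 ^+ m) ->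
  0 <= c -> exists z, forall m, x m <= z <= x m + c * 2^-1 ^+ m.
Proof.
move=> H c0.
have mono m p : (m <= p)%N -> x m <= x p /\ x p + c * 2^-1 ^+ p <= x m + c * 2^-1 ^+ m.
  elim: p => [|p IH]; first by rewrite leqn0 => /eqP ->; rewrite !lexx.
  rewrite leq_eqVlt => /orP[/eqP->|]; first by rewrite !lexx.
  rewrite ltnS => /IH [h1 h2]; have [h3 h4] := H p.
  by split; [exact: le_trans h3 | exact: le_trans h2].
have e0 p : 0 <= c * 2^-1 ^+ p by rewrite mulr_ge0 // exprn_ge0 // invr_ge0.
have ub m p : x p <= x m + c * 2^-1 ^+ m.
  have [/mono [_ h]|/ltnW/mono [h _]] := leqP m p.
    by apply: le_trans h; rewrite lerDl.
  by apply: le_trans h _; rewrite lerDl.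
exists (sup (range x)) => m; apply/andP; split.
  apply: ub_le_sup; last by exists m.
  by exists (x 0 + c * 2^-1 ^+ 0) => _ [p _ <-]; exact: ub.
by apply: ge_sup; [exists (x 0), 0 | move=> _ [p _ <-]; exact: ub].
Qed.

(** Compactness of a rectangle as an induction principle. [Q m x y] speaks of the box with lower
    left corner (x, y) and sides h / 2^m, k / 2^m; what passes from four quarters to a box and holds
    for all small boxes around each point holds for the whole rectangle. *)
Lemma bisection (Q : nat -> R -> R -> Prop) (a b h k : R) : 0 <= h -> 0 <= k ->
  (forall m x y, Q m.+1 x y -> Q m.+1 (x + h * 2^-1 ^+ m.+1) y ->
     Q m.+1 x (y + k * 2^-1 ^+ m.+1) ->
     Q m.+1 (x + h * 2^-1 ^+ m.+1) (y + k * 2^-1 ^+ m.+1) -> Q m x y) ->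
  (forall z t, a <= z <= a + h -> b <= t <= b + k -> exists2 delta, 0 < delta &
     forall m x y, h * 2^-1 ^+ m < delta -> k * 2^-1 ^+ m < delta ->
       x <= z <= x + h * 2^-1 ^+ m -> y <= t <= y + k * 2^-1 ^+ m -> Q m x y) ->
  Q 0 a b.
Proof.
move=> h0 k0 Qsplit Qloc; apply: contrapT => nQ.
pose sub m (p q : R * R) := (q.1 = p.1 \/ q.1 = p.1 + h * 2^-1 ^+ m.+1) /\
  (q.2 = p.2 \/ q.2 = p.2 + k * 2^-1 ^+ m.+1).
(* A box where Q fails has a quarter where Q fails. Iterating the choice gives nested boxes
   shrinking to a point, against the local hypothesis there. *)
have step (mp : nat * (R * R)) : exists q,
    ~ Q mp.1 mp.2.1 mp.2.2 -> ~ Q mp.1.+1 q.1 q.2 /\ sub mp.1 mp.2 q.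
  case: mp => m [x y] /=; have [q|nq] := pselect (Q m x y); first by exists (x, y).
  apply: contrapT => /forallNP nn; apply: nq.
  have H q : sub m (x, y) q -> Q m.+1 q.1 q.2.
    by move=> sq; apply: contrapT => nq; apply: (nn q).
  apply: Qsplit; [apply: (H (_, _)) | apply: (H (_, _)) | apply: (H (_, _)) | apply: (H (_, _))];
    by rewrite /sub /=; tauto.
have [g Hg] := choice step.
pose f := fix f m := if m is m'.+1 then g (m', f m') else (a, b).
have Hf m : ~ Q m (f m).1 (f m).2.
  by elim: m => [|m IH] //=; have [] := Hg (m, f m) IH.
have Sf m : sub m (f m) (f m.+1) by have [] := Hg (m, f m) (Hf m).
have nest c (z : R) z' m : 0 <= c -> z' = z \/ z' = z + c * 2^-1 ^+ m.+1 ->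
    z <= z' /\ z' + c * 2^-1 ^+ m.+1 <= z + c * 2^-1 ^+ m.
  move=> c0; have : 0 <= c * 2^-1 ^+ m by rewrite mulr_ge0 // exprn_ge0 // invr_ge0.
  rewrite exprS mulrCA; set e := c * _ => e0 [] ->; split; lra.
have [z Hz] := @nested_point h (fun m => (f m).1) (fun m => nest _ _ _ _ h0 (Sf m).1) h0.
have [t Ht] := @nested_point k (fun m => (f m).2) (fun m => nest _ _ _ _ k0 (Sf m).2) k0.
have [|| delta d0 Hd] := Qloc z t.
- by have := Hz 0; rewrite expr0 mulr1.
- by have := Ht 0; rewrite expr0 mulr1.
have [m1 Hm1] := half_small h d0; have [m2 Hm2] := half_small k d0.
apply: (Hf (maxn m1 m2)); apply: Hd => //; [exact/Hm1/leq_maxl | exact/Hm2/leq_maxr].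
Qed.

End Bisection.

Section ComplexNorm.
Variable R : realType.
Local Notation C := R[i].
Implicit Types (x y z w : C).

Definition nm (z : C) : R := Normc.normc z.
Arguments nm : simpl never.

Lemma nm_ge0 z : 0 <= nm z. Proof. by rewrite /nm; case: z => a b; rewrite sqrtr_ge0. Qed.
Lemma nmM z w : nm (z * w) = nm z * nm w. Proof. exact: Normc.normcM. Qed.
Lemma nmV z : nm z^-1 = (nm z)^-1. Proof. exact: Normc.normcV. Qed.
Lemma nm0 : nm 0 = 0. Proof. exact: Normc.normc0. Qed.
Lemma nm1 : nm 1 = 1. Proof. exact: Normc.normc1. Qed.
Lemma nm_eq0 z : (nm z == 0) = (z == 0).
Proof. by apply/eqP/eqP => [/Normc.eq0_normc|->]; last exact: nm0. Qed.
Lemma nm_gt0 z : (0 < nm z) = (z != 0).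
Proof. by rewrite lt_def nm_ge0 andbT nm_eq0. Qed.
Lemma nmD z w : nm (z + w) <= nm z + nm w. Proof. exact: le_normcD. Qed.
Lemma nmN z : nm (- z) = nm z. Proof. exact: normcN. Qed.
Lemma nmB z w : nm (z - w) <= nm z + nm w. Proof. by rewrite -[nm w]nmN nmD. Qed.
Lemma nm_distC z w : nm (z - w) = nm (w - z). Proof. by rewrite -nmN opprB. Qed.
Lemma nmX z k : nm (z ^+ k) = nm z ^+ k.
Proof. by elim: k => [|k IH]; rewrite ?expr0 ?nm1 // !exprS nmM IH. Qed.
Lemma nm_sum (I : Type) (r : seq I) (P : pred I) (F : I -> C) :
  nm (\sum_(i <- r | P i) F i) <= \sum_(i <- r | P i) nm (F i).
Proof.
elim/big_ind2: _ => [|u a v b ua vb|//]; first by rewrite nm0.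
exact: le_trans (nmD _ _) (lerD ua vb).
Qed.
Lemma nm_dist z w : nm z - nm w <= nm (z - w).
Proof. by rewrite lerBlDr -{1}(subrK w z) nmD. Qed.
Lemma nm_real (a : R) : nm a%:C%C = `|a|.
Proof. by rewrite /nm /= expr0n addr0 sqrtr_sqr. Qed.
Lemma nm_sqr z : nm z ^+ 2 = complex.Re z ^+ 2 + complex.Im z ^+ 2.
Proof. by case: z => a b; rewrite /nm /= sqr_sqrtr // addr_ge0 // sqr_ge0. Qed.
Lemma nm_ge_Re z : `|complex.Re z| <= nm z.
Proof.
rewrite -(ler_pXn2r (n := 2)) ?nnegrE ?nm_ge0 // nm_sqr real_normK ?num_real //.
by rewrite lerDl sqr_ge0.
Qed.
Lemma nm_ge_Im z : `|complex.Im z| <= nm z.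
Proof.
rewrite -(ler_pXn2r (n := 2)) ?nnegrE ?nm_ge0 // nm_sqr real_normK ?num_real //.
by rewrite lerDr sqr_ge0.
Qed.
Lemma nm_le_ReIm z : nm z <= `|complex.Re z| + `|complex.Im z|.
Proof.
rewrite -(ler_pXn2r (n := 2)) ?nnegrE ?nm_ge0 ?addr_ge0 // nm_sqr sqrrD !real_normK ?num_real //.
by rewrite lerD2r lerDl mulrn_wge0 // mulr_ge0.
Qed.
Lemma ReM z w : complex.Re (z * w) =
  complex.Re z * complex.Re w - complex.Im z * complex.Im w.
Proof. by case: z w => a b [c d]. Qed.
Lemma ReD z w : complex.Re (z + w) = complex.Re z + complex.Re w.
Proof. by case: z w => a b [c d]. Qed.
Lemma ImD z w : complex.Im (z + w) = complex.Im z + complex.Im w.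
Proof. by case: z w => a b [c d]. Qed.
Lemma ReN z : complex.Re (- z) = - complex.Re z. Proof. by case: z. Qed.
Lemma ImN z : complex.Im (- z) = - complex.Im z. Proof. by case: z. Qed.

Definition cexp z : C :=
  Complex (expR (complex.Re z) * cos (complex.Im z)) (expR (complex.Re z) * sin (complex.Im z)).

Lemma cexpD z w : cexp (z + w) = cexp z * cexp w.
Proof.
case: z w => a b [c d]; rewrite /cexp /= expRD cosD sinD.
apply/eqP; rewrite eq_complex /=; apply/andP; split; apply/eqP; ring.
Qed.
Lemma cexp0 : cexp 0 = 1.
Proof. by rewrite /cexp /= expR0 cos0 sin0 mulr1 mulr0. Qed.
Lemma cexp_real (a : R) : cexp a%:C%C = (expR a)%:C%C.
Proof. by rewrite /cexp /= cos0 sin0 mulr1 mulr0. Qed.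
Lemma nm_cexp z : nm (cexp z) = expR (complex.Re z).
Proof.
apply/eqP; rewrite -(eqrXn2 (n := 2)) ?nm_ge0 ?expR_ge0 // nm_sqr /=.
by rewrite !exprMn -mulrDr cos2Dsin2 mulr1.
Qed.
Lemma cexp_neq0 z : cexp z != 0.
Proof. by rewrite -nm_gt0 nm_cexp expR_gt0. Qed.
Lemma cexpN z : cexp (- z) = (cexp z)^-1.
Proof.
apply: (mulfI (cexp_neq0 z)); rewrite -cexpD subrr cexp0 mulfV //; exact: cexp_neq0.
Qed.
Lemma cexpMn z k : cexp (z *+ k) = cexp z ^+ k.
Proof. by elim: k => [|k IH]; rewrite ?mulr0n ?cexp0 // mulrS exprS cexpD IH. Qed.

End ComplexNorm.
Arguments nm : simpl never.

(** * Strict differentiability *)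

Section StrictDifferentiability.
Variable R : realType.
Local Notation C := R[i].
Implicit Types (y z w s : C).

Lemma cexp_surj s : s != 0 ->
  exists w, [/\ cexp w = s, 0 <= complex.Im w <= 2 * pi & complex.Re w = ln (nm s)].
Proof.
case: s => a b s0; set s := Complex a b in s0 *.
have r0 : 0 < nm s by rewrite nm_gt0.
have /eqP s2 := nm_sqr s.
have ab : (a / nm s) ^+ 2 + (b / nm s) ^+ 2 = 1.
  by rewrite !expr_div_n -mulrDl -(eqP s2) divff // expf_neq0 // gt_eqF.
have a1 : -1 <= a / nm s <= 1.
  by rewrite -ler_norml -(ler_pXn2r (n := 2)) ?nnegrE // expr1n real_normK ?num_real //
    -ab lerDl sqr_ge0.
have acos_b : sin (acos (a / nm s)) = `|b / nm s|.
  by rewrite sin_acos // -ab addrAC subrr add0r sqrtr_sqr.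
have pi0 := pi_ge0 R.
have [b0|b0] := leP 0 b.
  exists (Complex (ln (nm s)) (acos (a / nm s))); split=> //=; last first.
    by rewrite acos_ge0 //= (le_trans (acos_lepi _)) //; lra.
  rewrite /cexp /= lnK ?posrE // acos_b acosK ?in_itv //= ger0_norm ?divr_ge0 ?nm_ge0 //.
  by rewrite !(mulrC (nm s)) !divfK ?gt_eqF.
(* [acos] only reaches the upper half plane; for b < 0 the angle is reflected. *)
exists (Complex (ln (nm s)) (2 * pi - acos (a / nm s))); split=> //=; last first.
  by have := acos_ge0 a1; have := acos_lepi a1; lra.
rewrite /cexp /= lnK ?posrE //.
have -> : 2 * pi - acos (a / nm s) = - acos (a / nm s) + pi *+ 2 by ring.
rewrite cosD2pi sinD2pi cosN sinN acos_b acosK ?in_itv //=.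
rewrite ltr0_norm ?pmulr_llt0 ?invr_gt0 // opprK.
by rewrite !(mulrC (nm s)) !divfK ?gt_eqF.
Qed.

Lemma is_derive_eps (f : R -> R) (x d : R) : is_derive x 1 f d ->
  forall eta, 0 < eta -> exists2 delta, 0 < delta &
    forall h, `|h| < delta -> `|f (h + x) - f x - d * h| <= eta * `|h|.
Proof.
move=> [fd dE] eta eta0.
move: fd; rewrite /derivable => /cvg_ex[l fl].
have El : l = d by rewrite -dE; apply/esym/cvg_lim.
move: fl; rewrite {}El => /cvgrPdist_lt/(_ _ eta0).
rewrite /dnbhs near_withinE => /nbhs_ballP[delta /= delta0 H].
exists delta => // h hd.
have [->|h0] := eqVneq h 0; first by rewrite add0r subrr mulr0 subrr normr0 mulr0.
have := H h; rewrite /ball /= sub0r normrN => /(_ hd h0).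
rewrite /GRing.scale /= mulr1 => /ltW H'.
rewrite -(ler_pM2l (_ : 0 < `|h|^-1)) ?invr_gt0 ?normr_gt0 //.
rewrite mulrCA mulVf ?normr_eq0 // mulr1 -normfV -normrM mulrBr distrC.
by rewrite [_^-1 * (d * h)]mulrCA mulVf // mulr1.
Qed.

Lemma cexp_deriv0 (eta : R) : 0 < eta -> exists2 delta, 0 < delta &
  forall h : C, nm h < delta -> nm (cexp h - 1 - h) <= eta * nm h.
Proof.
(* With r = |h|, the real part of the error is at most 3 e r and the imaginary part at most 4 e
   r. *)
move=> eta0; pose e := eta / 8.
have e0 : 0 < e by rewrite divr_gt0.
have [d1 d10 H1] := is_derive_eps (is_derive_expR 0) e0.
have [d2 d20 H2] := is_derive_eps (is_derive_sin 0) e0.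
have [d3 d30 H3] := is_derive_eps (is_derive_cos 0) e0.
exists (Num.min (1 / 2) (Num.min (e / 2) (Num.min d1 (Num.min d2 d3)))).
  by rewrite !lt_min d10 d20 d30 !divr_gt0.
case=> x y; rewrite !lt_min => /and5P[h1 he hd1 hd2 hd3].
have xh := nm_ge_Re (Complex x y); have yh := nm_ge_Im (Complex x y).
move: xh yh h1 he hd1 hd2 hd3 => /=; set r := nm _ => xh yh h1 he hd1 hd2 hd3.
have {H1} := H1 x (le_lt_trans xh hd1); rewrite addr0 expR0 mul1r => H1.
have {H2} := H2 y (le_lt_trans yh hd2); rewrite addr0 sin0 cos0 subr0 mul1r => H2.
have {H3} := H3 y (le_lt_trans yh hd3); rewrite addr0 cos0 sin0 oppr0 mul0r subr0 => H3.
apply: le_trans (nm_le_ReIm _) _.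
rewrite !ReD !ReN !ImD !ImN /= subr0.
have r0 : 0 <= r := nm_ge0 _.
have ex0 := expR_gt0 x.
have ex2 : expR x <= 2.
  have : expR x * (1 - x) <= 1 by rewrite -[leRHS](expRxMexpNx_1 x) ler_pM2l // expR_ge1Dx.
  have := ler_norm x; nra.
have A1 : `|expR x - 1 - x| <= e * r by apply: le_trans H1 _; rewrite ler_wpM2l // ltW.
have A2 : `|sin y - y| <= e * r by apply: le_trans H2 _; rewrite ler_wpM2l // ltW.
have A3 : `|cos y - 1| <= e * r by apply: le_trans H3 _; rewrite ler_wpM2l // ltW.
have -> : expR x * cos y - 1 - x = (expR x - 1 - x) + expR x * (cos y - 1) by ring.
have -> : expR x * sin y - y = expR x * (sin y - y) + (expR x - 1) * y by ring.
have A4 : `|expR x - 1| <= e * r + r.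
  rewrite (_ : expR x - 1 = (expR x - 1 - x) + x); last by ring.
  exact: le_trans (ler_normD _ _) (lerD A1 xh).
have B1 : `|expR x * (cos y - 1)| <= 2 * (e * r).
  by rewrite normrM gtr0_norm //; apply: ler_pM => //; exact: ltW.
have B2 : `|expR x * (sin y - y)| <= 2 * (e * r).
  by rewrite normrM gtr0_norm //; apply: ler_pM => //; exact: ltW.
have B3 : `|(expR x - 1) * y| <= (e * r + r) * r by rewrite normrM; apply: ler_pM.
have C1 := ler_normD (expR x - 1 - x) (expR x * (cos y - 1)).
have C2 := ler_normD (expR x * (sin y - y)) ((expR x - 1) * y).
have -> : eta = 8 * e by rewrite /e; field.
have : (e * r + r) * r <= e * r + e * r.
  rewrite mulrDl; apply: lerD; first by rewrite ler_piMr ?mulr_ge0 ?(ltW e0) //; lra.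
  by apply: ler_wpM2r => //; lra.
have := mulr_ge0 (ltW e0) r0; lra.
Qed.

(** Strict differentiability at (w, y) with partial derivatives a and b. Both compared points may
    move, so the estimate applies to any two points of a curve near (w, y) and yields Lipschitz
    bounds directly. *)
Definition sdiff (f : C -> C -> C) (w y a b : C) := forall eta, 0 < eta ->
  exists2 delta, 0 < delta & forall w1 y1 w2 y2,
    nm (w1 - w) < delta -> nm (y1 - y) < delta ->
    nm (w2 - w) < delta -> nm (y2 - y) < delta ->
    nm (f w2 y2 - f w1 y1 - (a * (w2 - w1) + b * (y2 - y1))) <=
      eta * (nm (w2 - w1) + nm (y2 - y1)).

Implicit Types f g : C -> C -> C.

Lemma sdiff_cont f w y a b : sdiff f w y a b -> forall eta, 0 < eta ->
  exists2 delta, 0 < delta & forall w1 y1, nm (w1 - w) < delta -> nm (y1 - y) < delta ->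
    nm (f w1 y1 - f w y) < eta.
Proof.
move=> fd eta eta0; have [d d0 H] := fd 1 ltr01.
pose A := nm a + nm b + 2.
have A0 : 0 < A by rewrite /A; have := nm_ge0 a; have := nm_ge0 b; lra.
exists (Num.min d (eta / (2 * A))).
  by rewrite lt_min d0 divr_gt0 // mulr_gt0.
move=> w1 y1; rewrite !lt_min => /andP[w1d w1A] /andP[y1d y1A].
have := H w y w1 y1; rewrite !subrr !nm0 => /(_ d0 d0 w1d y1d).
set X := f w1 y1 - f w y => HX.
have := nmD (X - (a * (w1 - w) + b * (y1 - y))) (a * (w1 - w) + b * (y1 - y)).
rewrite subrK => HX2.
have := nmD (a * (w1 - w)) (b * (y1 - y)); rewrite !nmM => HX3.
have e : eta / (2 * A) * A = eta / 2 by field; rewrite gt_eqF.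
move: w1A y1A e; set k := eta / (2 * A) => w1A y1A e.
have := nm_ge0 (w1 - w); have := nm_ge0 (y1 - y); have := nm_ge0 a; have := nm_ge0 b.
move: e; rewrite /A; nra.
Qed.

Lemma sdiff_cst c w y : sdiff (fun _ _ => c) w y 0 0.
Proof.
move=> eta eta0; exists 1 => // w1 y1 w2 y2 _ _ _ _.
by rewrite subrr !mul0r addr0 subr0 nm0 mulr_ge0 ?addr_ge0 ?nm_ge0 // ltW.
Qed.

Lemma sdiff_snd w y : sdiff (fun _ y => y) w y 0 1.
Proof.
move=> eta eta0; exists 1 => // w1 y1 w2 y2 _ _ _ _.
by rewrite mul0r add0r mul1r subrr nm0 mulr_ge0 ?addr_ge0 ?nm_ge0 // ltW.
Qed.

Lemma sdiff_ext f g w y a b a' b' : sdiff f w y a b -> (forall w y, f w y = g w y) ->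
  a = a' -> b = b' -> sdiff g w y a' b'.
Proof.
move=> fd fg <- <- eta eta0; have [d d0 H] := fd _ eta0.
by exists d => // w1 y1 w2 y2 *; rewrite -!fg; apply: H.
Qed.

Lemma sdiffD f g w y a b a' b' : sdiff f w y a b -> sdiff g w y a' b' ->
  sdiff (fun w y => f w y + g w y) w y (a + a') (b + b').
Proof.
move=> fd gd eta eta0; have e2 : 0 < eta / 2 by rewrite divr_gt0.
have [d d0 H] := fd _ e2; have [d' d'0 H'] := gd _ e2.
exists (Num.min d d'); first by rewrite lt_min d0.
move=> w1 y1 w2 y2; rewrite !lt_min => /andP[? ?] /andP[? ?] /andP[? ?] /andP[? ?].
have {}H : _ <= _ := H w1 y1 w2 y2 ltac:(done) ltac:(done) ltac:(done) ltac:(done).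
have {}H' : _ <= _ := H' w1 y1 w2 y2 ltac:(done) ltac:(done) ltac:(done) ltac:(done).
rewrite [leRHS](_ : _ = eta / 2 * (nm (w2 - w1) + nm (y2 - y1)) + eta / 2 * (nm (w2 - w1) + nm (y2 - y1))); last by field.
apply: (le_trans _ (lerD H H')).
set X := (X in _ <= nm X + _); set Y := (X in _ <= _ + nm X).
rewrite (_ : _ - _ = X + Y) ?nmD // /X /Y; ring.
Qed.

Lemma sdiffM f g w y a b a' b' : sdiff f w y a b -> sdiff g w y a' b' ->
  sdiff (fun w y => f w y * g w y) w y (a * g w y + f w y * a') (b * g w y + f w y * b').
Proof.
move=> fd gd eta eta0.
set F := f w y; set G := g w y.
pose A := nm a + nm b; pose A' := nm a' + nm b'.
have [ge0a ge0b ge0a' ge0b'] := And4 (nm_ge0 a) (nm_ge0 b) (nm_ge0 a') (nm_ge0 b').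
have [ge0F ge0G] := conj (nm_ge0 F) (nm_ge0 G).
(* The error of the product splits into four terms below. [e] makes the two terms with the
   remainders of f and g add up to eta N / 4, and [k] does the same for the two terms with f1 - F
   and g2 - G. *)
pose k := Num.min 1 (eta / (4 * (A + A' + 1))).
have A0 : 0 < 4 * (A + A' + 1) by rewrite /A /A'; lra.
have k0 : 0 < k by rewrite /k lt_min ltr01 divr_gt0.
pose e := eta / (4 * (nm F + nm G + 2)).
have F0 : 0 < 4 * (nm F + nm G + 2) by lra.
have e0 : 0 < e by rewrite divr_gt0.
have [d1 d10 H1] := fd _ e0; have [d2 d20 H2] := gd _ e0.
have [d3 d30 H3] := sdiff_cont fd k0; have [d4 d40 H4] := sdiff_cont gd k0.
exists (Num.min (Num.min d1 d2) (Num.min d3 d4)); first by rewrite !lt_min d10 d20 d30.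
move=> w1 y1 w2 y2; rewrite !lt_min => /andP[/andP[? ?] /andP[? ?]] /andP[/andP[? ?] /andP[? ?]]
  /andP[/andP[? ?] /andP[? ?]] /andP[/andP[? ?] /andP[? ?]].
have {}H1 := H1 w1 y1 w2 y2 ltac:(done) ltac:(done) ltac:(done) ltac:(done).
have {}H2 := H2 w1 y1 w2 y2 ltac:(done) ltac:(done) ltac:(done) ltac:(done).
have {}H3 := H3 w1 y1 ltac:(done) ltac:(done).
have {}H4 := H4 w2 y2 ltac:(done) ltac:(done).
move: H1 H2 H3 H4; rewrite -/F -/G.
set f1 := f w1 y1; set f2 := f w2 y2; set g1 := g w1 y1; set g2 := g w2 y2.
set W := w2 - w1; set Y := y2 - y1; set N := nm W + nm Y => H1 H2 H3 H4.
have N0 : 0 <= N by rewrite addr_ge0 ?nm_ge0.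
have -> : f2 * g2 - f1 * g1 - ((a * G + F * a') * W + (b * G + F * b') * Y) =
  (f2 - f1 - (a * W + b * Y)) * g2 + f1 * (g2 - g1 - (a' * W + b' * Y)) +
  (a * W + b * Y) * (g2 - G) + (f1 - F) * (a' * W + b' * Y) by ring.
have lin c c' : nm (c * W + c' * Y) <= (nm c + nm c') * N.
  apply: le_trans (nmD _ _) _; rewrite !nmM /N.
  have := nm_ge0 W; have := nm_ge0 Y; have := nm_ge0 c; have := nm_ge0 c'; nra.
have g2b : nm g2 <= nm G + 1.
  have := nmD (g2 - G) G; rewrite subrK.
  have : k <= 1 by rewrite /k ge_min lexx.
  lra.
have f1b : nm f1 <= nm F + 1.
  have := nmD (f1 - F) F; rewrite subrK.
  have : k <= 1 by rewrite /k ge_min lexx.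
  lra.
apply: le_trans (nmD _ _) _.
apply: le_trans (lerD (nmD _ _) (lexx _)) _.
apply: le_trans (lerD (lerD (nmD _ _) (lexx _)) (lexx _)) _; rewrite !nmM.
have T1 : nm (f2 - f1 - (a * W + b * Y)) * nm g2 <= e * N * (nm G + 1).
  by apply: ler_pM; rewrite ?nm_ge0.
have T2 : nm f1 * nm (g2 - g1 - (a' * W + b' * Y)) <= (nm F + 1) * (e * N).
  by apply: ler_pM; rewrite ?nm_ge0.
have T3 : nm (a * W + b * Y) * nm (g2 - G) <= A * N * k.
  by apply: ler_pM; rewrite ?nm_ge0 ?lin // ltW.
have T4 : nm (f1 - F) * nm (a' * W + b' * Y) <= k * (A' * N).
  by apply: ler_pM; rewrite ?nm_ge0 ?lin // ltW.
have E1 : e * (nm F + nm G + 2) = eta / 4 by rewrite /e; field; lra.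
have E2 : k * (A + A' + 1) <= eta / 4.
  have : k <= eta / (4 * (A + A' + 1)) by rewrite /k ge_min lexx orbT.
  rewrite ler_pdivlMr //; lra.
have E3 : (A + A') * k * N <= eta / 4 * N by apply: ler_wpM2r => //; lra.
have E4 : e * (nm F + nm G + 2) * N = eta / 4 * N by rewrite E1.
have E5 : 0 <= eta * N by rewrite mulr_ge0 // ltW.
lra.
Qed.

(** The functional equation factors out cexp (k w) and cexp u, which reduces the claim to the first
    order expansion at 0. *)
Lemma sdiff_cexp (k : C) w y : sdiff (fun w _ => cexp (k * w)) w y (k * cexp (k * w)) 0.
Proof.
move=> eta eta0; set E := cexp (k * w).
have E0 : 0 < nm E by rewrite nm_gt0 cexp_neq0.
pose K := 1 + nm k; have K0 : 0 < K by rewrite /K; have := nm_ge0 k; lra.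
pose e := Num.min 1 (eta / (4 * nm E * K)).
have e0 : 0 < e by rewrite lt_min ltr01 divr_gt0 // !mulr_gt0.
have [d d0 H] := cexp_deriv0 e0.
pose d' := Num.min d (Num.min 1 e) / (4 * K).
have d'0 : 0 < d' by rewrite divr_gt0 ?mulr_gt0 // lt_min d0 lt_min ltr01 e0.
exists d' => // w1 y1 w2 y2 w1d _ w2d _.
have {w1d} w1d : nm (k * (w1 - w)) < Num.min d (Num.min 1 e) / 4.
  have -> : Num.min d (Num.min 1 e) / 4 = K * d' by rewrite /d'; field; rewrite gt_eqF.
  rewrite nmM; have := nm_ge0 k; rewrite /K; have := nm_ge0 (w1 - w); nra.
have {w2d} w2d : nm (k * (w2 - w)) < Num.min d (Num.min 1 e) / 4.
  have -> : Num.min d (Num.min 1 e) / 4 = K * d' by rewrite /d'; field; rewrite gt_eqF.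
  rewrite nmM; have := nm_ge0 k; rewrite /K; have := nm_ge0 (w2 - w); nra.
set m := Num.min d _ in w1d w2d.
have md : m <= d by rewrite ge_min lexx.
have m1 : m <= 1 by rewrite ge_min ge_min lexx /= orbT.
have me : m <= e by rewrite ge_min ge_min lexx !orbT.
have m0 : 0 < m by rewrite lt_min d0 lt_min ltr01 e0.
set u := k * (w1 - w) in w1d; set h := k * (w2 - w1).
have hd : nm h < m / 2.
  have -> : h = k * (w2 - w) - u by rewrite /h /u; ring.
  by have := nmB (k * (w2 - w)) u; lra.
have -> : cexp (k * w1) = E * cexp u by rewrite -cexpD; congr cexp; rewrite /u; ring.
have -> : cexp (k * w2) = E * cexp u * cexp h by rewrite -!cexpD; congr cexp; rewrite /u /h; ring.
rewrite mul0r addr0.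
have -> : E * cexp u * cexp h - E * cexp u - k * E * (w2 - w1) =
  E * (cexp u * (cexp h - 1 - h) + (cexp u - 1) * h) by rewrite /h; ring.
rewrite nmM.
have Hh : nm (cexp h - 1 - h) <= e * nm h by apply: H; lra.
have Hu : nm (cexp u - 1 - u) <= e * nm u by apply: H; lra.
have e1 : e <= 1 by rewrite ge_min lexx.
have u0 := nm_ge0 u; have h0 := nm_ge0 h.
have Hu1 : nm (cexp u - 1) <= e.
  have := nmD (cexp u - 1 - u) u; rewrite subrK.
  have : e * nm u <= 1 * nm u by apply: ler_wpM2r.
  lra.
have Hu2 : nm (cexp u) <= 2.
  have := nmD (cexp u - 1) 1; rewrite subrK nm1; lra.
have T : nm (cexp u * (cexp h - 1 - h) + (cexp u - 1) * h) <= 3 * (e * nm h).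
  apply: le_trans (nmD _ _) _; rewrite (nmM (cexp u)) (nmM (cexp u - 1)).
  have : nm (cexp u) * nm (cexp h - 1 - h) <= 2 * (e * nm h) by apply: ler_pM; rewrite ?nm_ge0.
  have : nm (cexp u - 1) * nm h <= e * nm h by apply: ler_wpM2r.
  lra.
have Hk : nm h <= K * nm (w2 - w1).
  by rewrite nmM ler_wpM2r ?nm_ge0 // /K; lra.
have eE : 4 * nm E * K * e <= eta.
  have : e <= eta / (4 * nm E * K) by rewrite ge_min lexx orbT.
  by rewrite ler_pdivlMr ?mulr_gt0 // mulrC.
apply: (@le_trans _ _ (eta * nm (w2 - w1))); last first.
  by rewrite ler_wpM2l ?lerDl ?nm_ge0 // ltW.
apply: (@le_trans _ _ (nm E * (3 * (e * (K * nm (w2 - w1)))))).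
  apply: ler_wpM2l; rewrite ?nm_ge0 //; apply: le_trans T _.
  by rewrite ler_wpM2l // ler_wpM2l // ltW.
apply: (@le_trans _ _ (4 * nm E * K * e * nm (w2 - w1))).
  have -> : nm E * (3 * (e * (K * nm (w2 - w1)))) = 3 * (nm E * K * e * nm (w2 - w1)) by ring.
  have -> : 4 * nm E * K * e * nm (w2 - w1) = 4 * (nm E * K * e * nm (w2 - w1)) by ring.
  by rewrite ler_wpM2r ?ler_nat // !mulr_ge0 ?nm_ge0 ?(ltW e0) ?(ltW K0).
by rewrite ler_wpM2r ?nm_ge0.
Qed.

End StrictDifferentiability.
Opaque nm cexp.

(** * Roots of a polynomial depending on a parameter *)

Section PlaneCurves.
Variable R : realType.
Local Notation C := R[i].
Implicit Types (y z w s : C) (P Q : {poly {poly C}}).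

(** {poly {poly C}} is read as C[s][Y]: the coefficients are polynomials in the base variable s, and
    [sp s P] is the fibre polynomial over s. *)
Definition sp s P : {poly C} := map_poly (horner_eval s) P.
Definition ev P s y : C := (sp s P).[y].

Lemma evD P Q s y : ev (P + Q) s y = ev P s y + ev Q s y.
Proof. by rewrite /ev /sp rmorphD hornerD. Qed.
Lemma evM P Q s y : ev (P * Q) s y = ev P s y * ev Q s y.
Proof. by rewrite /ev /sp rmorphM hornerM. Qed.
Lemma evC (c : {poly C}) s y : ev c%:P s y = c.[s].
Proof. by rewrite /ev /sp map_polyC /= hornerC. Qed.
Lemma evX s y : ev 'X s y = y.
Proof. by rewrite /ev /sp map_polyX hornerX. Qed.
Lemma evE P s y : ev P s y = \sum_(i < size P) (P`_i).[s] * y ^+ i.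
Proof.
rewrite /ev (horner_coef_wide _ (size_poly _ _)); apply: eq_bigr => i _.
by rewrite coef_map.
Qed.

Definition dbase P : {poly {poly C}} := map_poly (@deriv C) P.

Lemma dbase_cons P (c : {poly C}) : dbase (P * 'X + c%:P) = dbase P * 'X + (c^`())%:P.
Proof.
apply/polyP => i; rewrite coef_map_id0 ?deriv0 // !coefD !coefMX !coefC.
by case: i => [|i] /=; rewrite ?add0r // !addr0 coef_map_id0 ?deriv0.
Qed.

Lemma sdiff_horner (c : {poly C}) w y : sdiff (fun _ y => c.[y]) w y 0 (c^`()).[y].
Proof.
elim/poly_ind: c => [|c a IH].
  by apply: sdiff_ext (sdiff_cst 0 w y) _ _ _ => // *; rewrite ?deriv0 horner0.
apply: sdiff_ext (sdiffD (sdiffM IH (sdiff_snd w y)) (sdiff_cst a w y)) _ _ _ => [*||].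
- by rewrite hornerMXaddC.
- by rewrite mul0r mulr0 !addr0.
- by rewrite derivD derivM derivX derivC !addr0 !mulr1 hornerD hornerMX.
Qed.

Lemma sdiff_horner_cexp (c : {poly C}) w y :
  sdiff (fun w _ => c.[cexp w]) w y (cexp w * (c^`()).[cexp w]) 0.
Proof.
elim/poly_ind: c => [|c a IH].
  by apply: sdiff_ext (sdiff_cst 0 w y) _ _ _ => // *; rewrite ?deriv0 horner0 ?mulr0.
apply: sdiff_ext (sdiffD (sdiffM IH (sdiff_cexp 1 w y)) (sdiff_cst a w y)) _ _ _ => [*||].
- by rewrite hornerMXaddC mul1r.
- rewrite derivD derivM derivX derivC !addr0 !mulr1 hornerD hornerMX !mul1r; ring.
- by rewrite mul0r mulr0 !addr0.
Qed.

Lemma sdiff_ev P w y : sdiff (fun w y => ev P (cexp w) y) w y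
  (cexp w * ev (dbase P) (cexp w) y) (ev P^`() (cexp w) y).
Proof.
elim/poly_ind: P => [|P c IH].
  apply: sdiff_ext (sdiff_cst 0 w y) _ _ _ => [*||].
  - by rewrite /ev /sp rmorph0 horner0.
  - by rewrite /dbase map_poly0 /ev /sp rmorph0 horner0 mulr0.
  - by rewrite deriv0 /ev /sp rmorph0 horner0.
apply: sdiff_ext (sdiffD (sdiffM IH (sdiff_snd w y)) (sdiff_horner_cexp c w y)) _ _ _ => [*||].
- by rewrite evD evM evX evC.
- by rewrite dbase_cons evD evM evX evC; ring.
- by rewrite derivD derivM derivX derivC !addr0 !mulr1 evD evM evX.
Qed.

Lemma fin_delta (I : eqType) (r : seq I) (Q : I -> R -> Prop) :
  (forall i d d', d' <= d -> Q i d -> Q i d') ->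
  (forall i, i \in r -> exists2 d, 0 < d & Q i d) ->
  exists2 d, 0 < d & forall i, i \in r -> Q i d.
Proof.
move=> mono; elim: r => [|i r IH] H; first by exists 1.
have [d d0 Hd] := H i (mem_head _ _).
have [|d' d'0 Hd'] := IH; first by move=> j jr; apply: H; rewrite inE jr orbT.
exists (Num.min d d'); first by rewrite lt_min d0.
move=> j; rewrite inE => /orP[/eqP->|/Hd' h].
  by apply: mono Hd; rewrite ge_min lexx.
by apply: mono h; rewrite ge_min lexx orbT.
Qed.

Lemma horner_cont (c : {poly C}) s (eta : R) : 0 < eta ->
  exists2 delta, 0 < delta & forall t, nm (t - s) < delta -> nm (c.[t] - c.[s]) < eta.
Proof.
move=> eta0; have [d d0 H] := sdiff_cont (sdiff_horner c 0 s) eta0.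
by exists d => // t ts; apply: (H 0) => //; rewrite subrr nm0.
Qed.

(** |p(y)| is |lead_coef p| times the product of the distances from y to the roots, and the smallest
    of these, raised to the degree, is at most their product. *)
Lemma near_root (p : {poly C}) y : (1 < size p)%N ->
  exists2 r, p.[r] = 0 & nm (lead_coef p) * nm (y - r) ^+ (size p).-1 <= nm p.[y].
Proof.
move=> p1; have [r pE] := closed_field_poly_normal p.
have lp0 : lead_coef p != 0 by rewrite lead_coef_eq0 -size_poly_gt0 ltnW.
have sr : (size p).-1 = size r.
  by rewrite {1}pE size_scale // size_prod_XsubC.
have key (t : seq C) : (0 < size t)%N ->
  exists2 z, z \in t & nm (y - z) ^+ size t <= \prod_(x <- t) nm (y - x).
  elim: t => // x [|x' t] IH _; first by exists x; rewrite ?mem_head // big_seq1 expr1.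
  have [//|z zt H] := IH; rewrite big_cons.
  have [h|h] := leP (nm (y - z)) (nm (y - x)).
    exists z; first by rewrite inE zt orbT.
    rewrite /= exprS.
    by apply: ler_pM; rewrite ?exprn_ge0 ?nm_ge0.
  exists x; first exact: mem_head.
  rewrite /= exprS.
  apply: ler_pM; rewrite ?exprn_ge0 ?nm_ge0 //; apply: le_trans H.
  by rewrite ler_pXn2r ?nnegrE ?nm_ge0 // ltW.
have [|z zr H] := key r; first by rewrite -sr; case: (size p) p1 => [|[]].
exists z.
  apply/rootP; rewrite pE rootZ // root_prod_XsubC //.
rewrite sr [in leRHS]pE hornerZ nmM horner_prod.
have -> : nm (\prod_(x <- r) ('X - x%:P).[y]) = \prod_(x <- r) nm (y - x).
  elim: r {pE sr key zr H} => [|x r IH]; first by rewrite !big_nil nm1.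
  by rewrite !big_cons nmM IH hornerXsubC.
by rewrite ler_wpM2l ?nm_ge0.
Qed.

(** Cauchy's bound: if |y| > 1, the terms below the leading one sum to at most d M |y|^(d-1). *)
Lemma root_bound (p : {poly C}) (d : nat) (M L : R) y : (size p <= d.+1)%N -> 0 < L ->
  L <= nm p`_d -> (forall i, (i < d)%N -> nm p`_i <= M) -> p.[y] = 0 ->
  nm y <= 1 + d%:R * M / L.
Proof.
move=> sp_d L0 Ld Mi; rewrite (horner_coef_wide _ sp_d) big_ord_recr /=.
have [d0|d0] := posnP d.
  rewrite d0 in Ld *; rewrite big_ord0 add0r expr0 mulr1 => p0.
  by move: Ld; rewrite p0 nm0 leNgt L0.
have M0 : 0 <= M by apply: le_trans (Mi 0 d0); exact: nm_ge0.
have D0 : 0 <= d%:R * M / L by rewrite !mulr_ge0 // invr_ge0 ltW.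
have [y1 _|y1] := leP (nm y) 1; first by apply: le_trans y1 _; rewrite lerDl.
move=> /eqP; rewrite addr_eq0 => /eqP e.
apply: (@le_trans _ _ (d%:R * M / L)); last by rewrite lerDr.
rewrite ler_pdivlMr //.
have yd : 0 < nm y ^+ d.-1 by rewrite exprn_gt0 // (lt_trans ltr01).
rewrite -(ler_pM2r yd) mulrAC -exprS prednK //.
apply: (@le_trans _ _ (nm (p`_d * y ^+ d))).
  by rewrite nmM nmX mulrC ler_wpM2r // exprn_ge0 // nm_ge0.
rewrite -nmN -e; apply: le_trans (nm_sum _ _ _) _.
have -> : d%:R * M * nm y ^+ d.-1 = \sum_(i < d) M * nm y ^+ d.-1.
  by rewrite sumr_const card_ord -mulrA mulr_natl.
apply: ler_sum => i _; rewrite nmM nmX; apply: ler_pM; rewrite ?nm_ge0 ?exprn_ge0 ?nm_ge0 ?Mi //.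
by apply: ler_weXn2l; [exact: ltW | rewrite -ltnS prednK].
Qed.

(** A root of one fibre nearly annihilates a neighbouring fibre polynomial, so [near_root] finds a
    root of the latter close by. The leading coefficient must survive at s, otherwise roots escape
    to infinity. *)
Lemma roots_cont P s (k : R) : 0 < k -> (lead_coef P).[s] != 0 ->
  exists2 delta, 0 < delta & forall t, nm (t - s) < delta ->
    (forall y, ev P t y = 0 -> exists2 z, ev P s z = 0 & nm (y - z) < k) /\
    (forall y, ev P s y = 0 -> exists2 z, ev P t z = 0 & nm (y - z) < k).
Proof.
move=> k0 lPs; pose d := (size P).-1; pose L := nm (lead_coef P).[s] / 2.
have L0 : 0 < L by rewrite divr_gt0 // nm_gt0.
have sP : size P = d.+1.
  rewrite /d prednK // size_poly_gt0; apply: contra_neq lPs => ->.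
  by rewrite lead_coef0 horner0.
pose M := \sum_(i < d) nm (P`_i).[s] + 1.
pose B := 1 + d%:R * M / L.
have M0 : 0 < M by rewrite ltr_wpDl ?ltr01 // sumr_ge0 // => i _; exact: nm_ge0.
have B0 : 0 < B by rewrite ltr_wpDr ?ltr01 // !mulr_ge0 ?invr_ge0 ?(ltW L0) ?(ltW M0).
(* Allowed variation of each coefficient. Up to 1 the bound M holds, up to L the leading coefficient
   keeps modulus at least L, and the last entry makes the value at a foreign root smaller than L
   k^d. *)
pose e := Num.min 1 (Num.min L (L * k ^+ d / (d.+1%:R * B ^+ d + 1))).
have BB0 : 0 < d.+1%:R * B ^+ d + 1.
  by rewrite ltr_wpDl ?ltr01 // mulr_ge0 // exprn_ge0 // ltW.
have e0 : 0 < e by rewrite lt_min ltr01 lt_min L0 divr_gt0 // mulr_gt0 // exprn_gt0.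
have e1 : e <= 1 by rewrite ge_min lexx.
have eL : e <= L by rewrite ge_min ge_min lexx !orbT.
have eK : e * (d.+1%:R * B ^+ d + 1) <= L * k ^+ d.
  by rewrite -ler_pdivlMr // ge_min ge_min lexx !orbT.
have [||D D0 HD] := @fin_delta nat (iota 0 d.+1) (fun i dd => forall t, nm (t - s) < dd ->
    nm ((P`_i).[t] - (P`_i).[s]) < e).
- by move=> i a a' aa H t ta; apply: H; exact: lt_le_trans aa.
- by move=> i _; exact: horner_cont.
exists D => // t tD.
have {}HD i : (i <= d)%N -> nm ((P`_i).[t] - (P`_i).[s]) < e.
  by move=> id; apply: HD => //; rewrite mem_iota.
have D00 : nm (s - s) < D by rewrite subrr nm0.
have ub u : (forall i, (i <= d)%N -> nm ((P`_i).[u] - (P`_i).[s]) < e) ->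
    L <= nm (lead_coef P).[u] /\ forall y, ev P u y = 0 -> nm y <= B.
  move=> Hu; have lu : L <= nm (lead_coef P).[u].
    have := Hu d (leqnn _); rewrite -lead_coefE => h.
    have := nm_dist (lead_coef P).[s] (lead_coef P).[u]; rewrite nm_distC.
    have : nm (lead_coef P).[s] = L + L by rewrite /L -splitr.
    lra.
  split=> // y; apply: (@root_bound _ d M L) => //; first by rewrite -sP size_poly.
    by rewrite coef_map -lead_coefE.
  move=> i id; rewrite coef_map /=; have := Hu i (ltnW id).
  have := nmD ((P`_i).[u] - (P`_i).[s]) (P`_i).[s]; rewrite subrK => h1 h2.
  rewrite /M (bigD1 (Ordinal id)) //=; set S := \sum_(_ < _ | _) _.
  have : 0 <= S by rewrite sumr_ge0 // => j _; exact: nm_ge0.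
  lra.
have Hs i : (i <= d)%N -> nm ((P`_i).[s] - (P`_i).[s]) < e by rewrite subrr nm0.
(* Symmetric in u and v, so it gives both directions of the claim. *)
have match_root u v y : (forall i, (i <= d)%N -> nm ((P`_i).[u] - (P`_i).[s]) < e) ->
    (forall i, (i <= d)%N -> nm ((P`_i).[v] - (P`_i).[s]) < e) ->
    (forall i, (i <= d)%N -> nm ((P`_i).[u] - (P`_i).[v]) < e) ->
    ev P u y = 0 -> exists2 z, ev P v z = 0 & nm (y - z) < k.
  move=> Hu Hv Huv Py; have yB := (ub u Hu).2 y Py; have lv := (ub v Hv).1.
  have lv0 : (lead_coef P).[v] != 0 by rewrite -nm_gt0; exact: lt_le_trans lv.
  have spv : size (sp v P) = d.+1 by rewrite -sP size_map_poly_id0.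
  have lcv : lead_coef (sp v P) = (lead_coef P).[v] by rewrite lead_coef_map_id0 ?horner_evalE ?horner0.
  have Pvy : nm (ev P v y) < d.+1%:R * B ^+ d * e.
    have -> : ev P v y = - (ev P u y - ev P v y) by rewrite Py sub0r opprK.
    rewrite nmN !evE -sumrB; apply: le_lt_trans (nm_sum _ _ _) _.
    rewrite sP -mulrA.
    have -> : d.+1%:R * (B ^+ d * e) = \sum_(i < d.+1) (B ^+ d * e).
      by rewrite sumr_const card_ord mulr_natl.
    apply: ltr_sum; first by apply/hasP; exists ord0; rewrite ?mem_index_enum.
    move=> i _; rewrite -mulrBl nmM nmX mulrC.
    have B1 : 1 <= B by rewrite /B lerDl !mulr_ge0 ?invr_ge0 ?(ltW L0) ?(ltW M0).
    apply: (@le_lt_trans _ _ (B ^+ d * nm ((P`_i).[u] - (P`_i).[v]))); last first.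
      by rewrite ltr_pM2l ?exprn_gt0 // Huv // -ltnS.
    apply: ler_wpM2r; rewrite ?nm_ge0 //.
    apply: (@le_trans _ _ (B ^+ i)); first by apply: lerXn2r; rewrite ?nnegrE ?nm_ge0 ?(ltW B0).
    by apply: ler_weXn2l => //; rewrite -ltnS.
  have [d0|d0] := posnP d.
    move: (Py); rewrite evE sP d0 big_ord_recl big_ord0 addr0 expr0 mulr1 => Pu0.
    have := (ub u Hu).1; rewrite lead_coefE sP d0 /= Pu0 nm0.
    by rewrite leNgt L0.
  have [|z zv Hz] := @near_root (sp v P) y; first by rewrite spv.
  exists z => //; rewrite ltNge; apply/negP => kz; move: Hz; rewrite lcv spv /= leNgt.
  apply/negP; rewrite negbK; apply: lt_le_trans Pvy _.
  apply: (@le_trans _ _ (L * k ^+ d)); first by move: eK; have := e0; lra.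
  by apply: ler_pM; rewrite ?exprn_ge0 ?(ltW L0) ?(ltW k0) // lerXn2r ?nnegrE ?nm_ge0 ?(ltW k0).
split=> y; first by apply: match_root.
by apply: match_root => // i id; rewrite nm_distC HD.
Qed.

End PlaneCurves.

(** * Implicit differentiation along a plane curve *)

Section CurveDerivatives.
Variable R : realType.
Local Notation C := R[i].
Implicit Types (y z w s : C) (P Q : {poly {poly C}}).

(** Subtracting the equations at the two points gives A W + B Y = o(|W| + |Y|) with B nonzero, hence
    Y = q W + o(|W|). So a + b q is the derivative of f along the curve, without any
    parametrization. *)
Lemma curve_sdiff P w y (f : C -> C -> C) (a b : C) :
  sdiff f w y a b -> ev P^`() (cexp w) y != 0 ->
  let q := - (cexp w * ev (dbase P) (cexp w) y) / ev P^`() (cexp w) y in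
  forall eta, 0 < eta -> exists2 delta, 0 < delta & forall w1 y1 w2 y2,
    nm (w1 - w) < delta -> nm (y1 - y) < delta ->
    nm (w2 - w) < delta -> nm (y2 - y) < delta ->
    ev P (cexp w1) y1 = 0 -> ev P (cexp w2) y2 = 0 ->
    nm (f w2 y2 - f w1 y1 - (a + b * q) * (w2 - w1)) <= eta * nm (w2 - w1).
Proof.
move=> fd; have := sdiff_ev P w y.
set A := cexp w * _; set B := ev P^`() _ _; move=> Pd B0 q eta eta0.
have nB : 0 < nm B by rewrite nm_gt0.
(* The remainder r = Y - q W satisfies |r| <= k |Y| <= k |r| + k |q| |W|; k <= 1/2 absorbs the term
   k |r|. *)
pose k := Num.min (1 / 2) (eta / (4 * (1 + nm q) * (1 + nm b))).
have [q0 b0] := (nm_ge0 q, nm_ge0 b).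
have D0 : 0 < 4 * (1 + nm q) * (1 + nm b) by rewrite !mulr_gt0 //; lra.
have k0 : 0 < k by rewrite lt_min !divr_gt0.
have k2 : k <= 1 / 2 by rewrite ge_min lexx.
have kE : 4 * k * (1 + nm q) * (1 + nm b) <= eta.
  have : k <= eta / (4 * (1 + nm q) * (1 + nm b)) by rewrite ge_min lexx orbT.
  rewrite ler_pdivlMr //; lra.
have [d1 d10 H1] := Pd (nm B * k) (mulr_gt0 nB k0).
pose e := eta / (4 * (1 + nm q)).
have e0 : 0 < e by rewrite divr_gt0 // mulr_gt0 //; lra.
have eE : 4 * e * (1 + nm q) = eta by rewrite /e; field; lra.
have [d2 d20 H2] := fd e e0.
exists (Num.min d1 d2); first by rewrite lt_min d10.
move=> w1 y1 w2 y2; rewrite !lt_min => /andP[? ?] /andP[? ?] /andP[? ?] /andP[? ?] P1 P2.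
have {}H1 := H1 w1 y1 w2 y2 ltac:(done) ltac:(done) ltac:(done) ltac:(done).
have {}H2 := H2 w1 y1 w2 y2 ltac:(done) ltac:(done) ltac:(done) ltac:(done).
move: H1; rewrite P1 P2 subrr sub0r nmN.
move: H2; set W := w2 - w1; set Y := y2 - y1; set r := Y - q * W => H2.
have -> : A * W + B * Y = B * r by rewrite /r /q; field.
rewrite (nmM B) -mulrA ler_pM2l // => H1.
have Yr : Y = r + q * W by rewrite /r subrK.
have W0 := nm_ge0 W; have r0 := nm_ge0 r.
have YW : nm Y <= nm r + nm q * nm W by rewrite Yr -nmM nmD.
have rW : nm r <= 2 * k * (1 + nm q) * nm W.
  have : k * nm Y <= k * (nm r + nm q * nm W) by rewrite ler_wpM2l // ltW.
  have : k * nm r <= 1 / 2 * nm r by rewrite ler_wpM2r.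
  lra.
have -> : f w2 y2 - f w1 y1 - (a + b * q) * W = f w2 y2 - f w1 y1 - (a * W + b * Y) + b * r.
  by rewrite Yr; ring.
apply: le_trans (nmD _ _) _; rewrite (nmM b).
have T1 : nm b * nm r <= nm b * (2 * k * (1 + nm q) * nm W) by rewrite ler_wpM2l.
have T2 : 4 * k * (1 + nm q) * (1 + nm b) * nm W <= eta * nm W by rewrite ler_wpM2r.
have T3 : 0 <= k * (1 + nm q) * nm W by rewrite !mulr_ge0 ?(ltW k0) //; lra.
have T4 : e * nm Y <= e * (nm r + nm q * nm W) by rewrite ler_wpM2l // ltW.
have T5 : e * nm r <= e * (2 * k * (1 + nm q) * nm W) by rewrite ler_wpM2l // ltW.
have T6 : k * (1 + nm q) * nm W <= 1 / 2 * ((1 + nm q) * nm W).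
  by rewrite -mulrA ler_wpM2r // mulr_ge0 //; lra.
have T7 : e * (k * (1 + nm q) * nm W) <= e * (1 / 2 * ((1 + nm q) * nm W)).
  by rewrite ler_wpM2l // ltW.
have T8 : 4 * e * (1 + nm q) * nm W = eta * nm W by rewrite eE.
lra.
Qed.

(** With y2 = y1 (1 + h) and |1 + h|^2 = 1 + v, v = 2 Re h + |h|^2, the difference of logarithms is
    ln (1 + v) / 2 = Re h + O(|h|^2); replacing y1 by y in the denominator costs another O(k
    |h|). *)
Lemma ln_nm_sdiff y : y != 0 -> forall eta, 0 < eta ->
  exists2 delta, 0 < delta & forall y1 y2, nm (y1 - y) < delta -> nm (y2 - y) < delta ->
    `|ln (nm y2) - ln (nm y1) - complex.Re ((y2 - y1) / y)| <= eta * nm (y2 - y1).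
Proof.
move=> y0 eta eta0; have ny : 0 < nm y by rewrite nm_gt0.
pose k := Num.min (1 / 8) (eta * nm y / 128).
have k0 : 0 < k by rewrite lt_min !divr_gt0 // mulr_gt0.
have k8 : k <= 1 / 8 by rewrite ge_min lexx.
have kE : 128 * k <= eta * nm y.
  have : k <= eta * nm y / 128 by rewrite ge_min lexx orbT.
  lra.
exists (k * nm y); first by rewrite mulr_gt0.
move=> y1 y2 H1 H2.
have n1 : 7 / 8 * nm y <= nm y1.
  have := nm_dist y y1; rewrite nm_distC; have : k * nm y <= 1 / 8 * nm y by rewrite ler_wpM2r // ltW.
  lra.
have n10 : 0 < nm y1 by apply: lt_le_trans n1; rewrite mulr_gt0.
have y10 : y1 != 0 by rewrite -nm_gt0.
pose h := (y2 - y1) / y1.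
have nh : nm h * nm y1 = nm (y2 - y1) by rewrite /h nmM nmV divfK // gt_eqF.
have y21 : nm (y2 - y1) <= 2 * (k * nm y).
  have -> : y2 - y1 = (y2 - y) - (y1 - y) by ring.
  apply: le_trans (nmB _ _) _; lra.
have h4 : nm h <= 4 * k.
  rewrite -(ler_pM2r n10) nh; apply: le_trans y21 _.
  have : 4 * k * (7 / 8 * nm y) <= 4 * k * nm y1 by rewrite ler_wpM2l // mulr_ge0 // ltW.
  have := mulr_gt0 k0 ny; lra.
have h0 := nm_ge0 h.
have y2E : y2 = y1 * (1 + h) by rewrite /h; field.
have n2E : nm y2 = nm y1 * nm (1 + h) by rewrite y2E nmM.
have h1b : 1 / 2 <= nm (1 + h).
  have := nm_dist 1 (- h); rewrite opprK nm1 nmN; lra.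
have h10 : 0 < nm (1 + h) by lra.
rewrite n2E lnM ?posrE // [ln (nm y1) + _]addrC addrK.
pose v := 2 * complex.Re h + nm h ^+ 2.
have vE : nm (1 + h) ^+ 2 = 1 + v.
  by rewrite /v !nm_sqr ReD ImD /= add0r; ring.
have Reh := nm_ge_Re h.
have v0 : 1 / 4 <= 1 + v by rewrite -vE; nra.
have lnE : ln (nm (1 + h)) = ln (1 + v) / 2.
  have : ln (1 + v) = 2 * ln (nm (1 + h)) by rewrite -vE lnXn // mulr_natl.
  lra.
have v3 : `|v| <= 3 * nm h.
  apply: le_trans (ler_normD _ _) _; rewrite normrM ger0_norm // (ger0_norm (sqr_ge0 _)).
  nra.
have ub : ln (1 + v) <= v.
  by have := @le_ln1Dx R v; apply; lra.
(* The inequality ln (1 + x) <= x is applied to the inverse of 1 + v; since that inverse is at most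
   4, the constant is 4. *)
have lb : v - 4 * v ^+ 2 <= ln (1 + v).
  have v10 : 0 < 1 + v by lra.
  have := @le_ln1Dx R ((1 + v)^-1 - 1).
  have -> : 1 + ((1 + v)^-1 - 1) = (1 + v)^-1 by ring.
  rewrite lnV ?posrE // => H.
  have {}H : - ln (1 + v) <= (1 + v)^-1 - 1.
    by apply: H; rewrite ltrBrDl subrr invr_gt0.
  have : (1 + v)^-1 * (1 + v) = 1 by rewrite mulVf // gt_eqF.
  have : 0 < (1 + v)^-1 by rewrite invr_gt0.
  move: H; set i := _^-1 => H i0 iv.
  have i4 : i <= 4 by nra.
  have e1 : i - 1 = - (v * i) by lra.
  have e2 : i - 1 + v = v ^+ 2 * i by rewrite expr2; nra.
  have : v ^+ 2 * i <= v ^+ 2 * 4 by rewrite ler_wpM2l // sqr_ge0.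
  lra.
have A1 : `|ln (nm (1 + h)) - complex.Re h| <= 20 * nm h ^+ 2.
  have : v ^+ 2 <= 9 * nm h ^+ 2.
    rewrite -(real_normK (num_real v)); have := normr_ge0 v; nra.
  rewrite lnE ler_norml /v in lb ub *; move=> vv; apply/andP; split; nra.
have A2 : nm (h - (y2 - y1) / y) <= 2 * k * nm h.
  have -> : h - (y2 - y1) / y = h * ((y - y1) / y).
    by rewrite /h; field; rewrite y0.
  rewrite (nmM h) mulrC ler_wpM2r // nmM nmV ler_pdivrMr //.
  rewrite nm_distC; have := mulr_gt0 k0 ny; lra.
have -> : ln (nm (1 + h)) - complex.Re ((y2 - y1) / y) =
  (ln (nm (1 + h)) - complex.Re h) + complex.Re (h - (y2 - y1) / y).
  by rewrite ReD ReN; ring.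
apply: le_trans (ler_normD _ _) _.
have A3 := nm_ge_Re (h - (y2 - y1) / y).
have A4 : nm h * (7 / 8 * nm y) <= nm (y2 - y1) by rewrite -nh ler_wpM2l.
have A5 : 128 * k * nm h <= eta * nm y * nm h by rewrite ler_wpM2r.
have A6 : eta * (nm h * (7 / 8 * nm y)) <= eta * nm (y2 - y1) by rewrite ler_wpM2l // ltW.
have A7 : nm h ^+ 2 <= 4 * k * nm h by rewrite expr2 ler_wpM2r.
have := mulr_ge0 (ltW k0) h0; lra.
Qed.

End CurveDerivatives.

(** * Newton polygons *)

Section Newton.
Variable R : realType.
Local Notation C := R[i].
Implicit Types (w x z c : C) (K u : R).

(* A single constant K serves as multiplicative constant, inverse exponent and
   threshold of all estimates; they only get weaker as K grows, and on [dom K]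
   the error [bnd K] is at most 1 / K. *)
Definition bnd K u : R := K * expR (u / K).
Definition dom K w : Prop := complex.Re w < - K ^+ 3.

Lemma bnd_ge0 K u : 1 <= K -> 0 <= bnd K u.
Proof. by move=> K1; rewrite mulr_ge0 ?expR_ge0 // (le_trans ler01). Qed.

Lemma domE K w : 1 <= K -> dom K w -> complex.Re w < - K /\ complex.Re w < 0.
Proof.
move=> K1 wK; have : K <= K ^+ 3 by rewrite ler_eXnr.
by rewrite /dom in wK; split; lra.
Qed.

Lemma dom_mono K K' w : 1 <= K -> K <= K' -> dom K' w -> dom K w.
Proof.
move=> K1 KK; rewrite /dom => /lt_le_trans; apply; rewrite lerN2.
by apply: lerXn2r; rewrite ?nnegrE //; lra.
Qed.

Lemma bnd_mono K K' u : 1 <= K -> K <= K' -> u <= 0 -> bnd K u <= bnd K' u.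
Proof.
move=> K1 KK u0; apply: ler_pM; rewrite ?expR_ge0 //; first by lra.
by rewrite ler_expR; apply: ler_wnM2l => //; rewrite lef_pV2 ?posrE //; lra.
Qed.

(** The cube in [dom] is chosen for this: exp (u / K) <= exp (- K^2) <= K^-2. *)
Lemma bnd_small K w : 1 <= K -> dom K w -> bnd K (complex.Re w) <= K^-1.
Proof.
move=> K1 wK; have K0 : 0 < K by lra.
rewrite /bnd -(ler_pdivlMl _ _ K0) -invfM.
have h : expR (complex.Re w / K) <= expR (- K ^+ 2).
  rewrite ler_expR ler_pdivrMr // mulNr -exprSr; exact: ltW.
apply: le_trans h _; rewrite expRN lef_pV2 ?posrE ?expR_gt0 ?mulr_gt0 //.
by have := expR_ge1Dx (K ^+ 2); rewrite expr2; lra.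
Qed.

Lemma expR_small (e g : R) : 0 < e -> 0 < g ->
  exists K0, forall K w, 1 <= K -> K0 <= K -> dom K w -> expR (g * complex.Re w) < e.
Proof.
move=> e0 g0; exists (e^-1 / g) => K w K1 KK wK; have [wK1 _] := domE K1 wK.
rewrite -(opprK (_ * _)) expRN -[e]invrK ltf_pV2 ?posrE ?expR_gt0 ?invr_gt0 //.
have := expR_ge1Dx (- (g * complex.Re w)).
have : e^-1 <= g * K by rewrite mulrC -ler_pdivrMr.
have : g * complex.Re w < g * - K by rewrite ltr_pM2l.
lra.
Qed.

Lemma fin_large (I : eqType) (r : seq I) (S : I -> R -> Prop) :
  (forall i K K', 1 <= K -> K <= K' -> S i K -> S i K') ->
  (forall i, i \in r -> exists K, 1 <= K /\ S i K) ->
  exists K, 1 <= K /\ forall i, i \in r -> S i K.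
Proof.
move=> mono; elim: r => [|i r IH] H; first by exists 1.
have [K [K1 HK]] := H i (mem_head _ _).
have [|K' [K'1 HK']] := IH; first by move=> j jr; apply: H; rewrite inE jr orbT.
exists (Num.max K K'); split; first by rewrite le_max K1.
move=> j; rewrite inE => /orP[/eqP->|/HK' h].
  by apply: mono HK; rewrite ?le_max ?lexx.
by apply: mono h; rewrite ?le_max ?lexx ?orbT.
Qed.

Section Exponents.
Variables (I : finType) (r : I -> C) (a b : I -> nat).
Hypothesis ab_inj : forall k l, a k = a l -> b k = b l -> k = l.

(** A polynomial in s = e^w and x, with one index per monomial. *)
Definition msum w x : C := \sum_k r k * cexp (w *+ a k) * x ^+ b k.

Let m w x k : R := expR (complex.Re w *+ a k) * nm x ^+ b k.

Let nm_term w x k : nm (r k * cexp (w *+ a k) * x ^+ b k) = nm (r k) * m w x k.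
Proof.
rewrite /m !nmM nmX nm_cexp mulrA; congr (_ * expR _ * _).
by elim: (a k) => [|n IH]; rewrite ?mulr0n // !mulrS ReD IH.
Qed.

(** In a vanishing sum the largest term is at most the sum of the others, so another term has at
    least 1 / #|I| of its size. *)
Let two_dominant w x : x != 0 -> msum w x = 0 -> (exists k, r k != 0) ->
  exists k l, [/\ k != l, r k != 0, r l != 0, nm (r l) * m w x l <= nm (r k) * m w x k
    & nm (r k) * m w x k <= #|I|%:R * (nm (r l) * m w x l)].
Proof.
move=> x0 sum0 [k1 rk1].
have m0 k : 0 < m w x k by rewrite mulr_gt0 ?expR_gt0 // exprn_gt0 // nm_gt0.
pose t k := nm (r k) * m w x k.
have t0 k : 0 <= t k by rewrite mulr_ge0 ?nm_ge0 // ltW.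
have [k _ kmax] := @arg_maxP _ _ I k1 predT t isT.
have tk0 : 0 < t k.
  by apply: lt_le_trans (kmax k1 isT); rewrite mulr_gt0 // nm_gt0.
have rk0 : r k != 0.
  by apply: contraTN tk0 => /eqP rk; rewrite /t rk nm0 mul0r ltxx.
have [l [lk tl]] : exists l, l != k /\ t k <= #|I|%:R * t l.
  apply: contrapT => /forallNP H.
  have {}H l : l != k -> #|I|%:R * t l <= t k.
    by move=> lk; rewrite leNgt; apply/negP => h; apply: (H l); split=> //; exact: ltW.
  have tk : t k <= \sum_(l | l != k) t l.
    move: sum0; rewrite /msum (bigD1 k) //= => /eqP; rewrite addr_eq0 => /eqP e.
    rewrite {1}/t -nm_term e nmN; apply: le_trans (nm_sum _ _ _) _.
    by apply: ler_sum => l _; rewrite nm_term.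
  have : #|I|%:R * t k <= \sum_(l | l != k) t k.
    apply: le_trans (ler_wpM2l (ler0n _ _) tk) _.
    by rewrite mulr_sumr; apply: ler_sum => l /H.
  rewrite sumr_const -[leRHS]mulr_natl ler_pM2r // ler_nat leqNgt => /negP; apply.
  by rewrite (@eq_card _ _ (predC1 k)) // cardC1 ltn_predL; apply/card_gt0P; exists k.
exists k, l; split=> //; first by rewrite eq_sym.
  by apply: contraTneq tk0 => rl; rewrite -leNgt (le_trans tl) // /t rl nm0 mul0r mulr0.
exact: kmax.
Qed.

(** The exponent al for which x of size e^(al u) gives the monomials k and l the same order: a_k +
    al b_k = a_l + al b_l. *)
Definition slope k l : R := ((a l)%:R - (a k)%:R) / ((b k)%:R - (b l)%:R).

(** Two dominant monomials are comparable up to Q. In z = x e^(-al w), with al their slope, the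
    exponential factors cancel and |z|^(b k - b l) lies between 1/Q and Q. *)
Lemma dominant_slope : (exists k, r k != 0) -> exists Q, 1 <= Q /\
  forall w x, complex.Re w < - Q -> x != 0 -> msum w x = 0 ->
  exists k l, [/\ (b l < b k)%N, r k != 0, r l != 0 &
    Q^-1 <= nm (x * cexp (- ((slope k l)%:C%C * w))) <= Q].
Proof.
(* A common bound for all ratios of coefficients; a zero denominator only contributes 0. *)
move=> rk1; pose rho := 1 + \sum_k \sum_l nm (r k) / nm (r l).
have r_ge k l : 0 <= nm (r k) / nm (r l) by rewrite divr_ge0 ?nm_ge0.
have rhoP k l : nm (r k) / nm (r l) <= rho.
  rewrite /rho (bigD1 k) //= (bigD1 l) //=.
  set S := \sum_(_ | _ != l) _; set S' := \sum_(_ | _ != k) _.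
  have : 0 <= S by rewrite sumr_ge0.
  have : 0 <= S' by rewrite sumr_ge0 // => i _; rewrite sumr_ge0.
  lra.
have rho1 : 1 <= rho by rewrite lerDl sumr_ge0 // => k _; rewrite sumr_ge0.
have n1 : 1 <= #|I|%:R :> R.
  by have [k _] := rk1; rewrite ler1n; apply/card_gt0P; exists k.
pose Q := #|I|%:R * rho; have Q1 : 1 <= Q by rewrite /Q; nra.
have Q0 : 0 < Q by lra.
exists Q; split=> // w x wQ x0 sum0.
have m0 k : 0 < m w x k by rewrite mulr_gt0 ?expR_gt0 // exprn_gt0 // nm_gt0.
have [k [l [kl rk rl H1 H2]]] := two_dominant x0 sum0 rk1.
have Hlk : m w x l <= Q * m w x k.
  apply: (@le_trans _ _ (nm (r k) / nm (r l) * m w x k)).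
    by rewrite mulrAC ler_pdivlMr ?nm_gt0 // mulrC.
  rewrite ler_pM2r //; apply: le_trans (rhoP k l) _; rewrite /Q; nra.
have Hkl : m w x k <= Q * m w x l.
  apply: (@le_trans _ _ (#|I|%:R * (nm (r l) / nm (r k)) * m w x l)).
    rewrite -(ler_pM2l (_ : 0 < nm (r k))) ?nm_gt0 //; apply: le_trans H2 _.
    by rewrite le_eqVlt; apply/orP; left; apply/eqP; field; rewrite nm_eq0.
  by rewrite ler_pM2r // ler_wpM2l // rhoP.
move=> {H1 H2}; wlog blk : k l kl rk rl Hlk Hkl / (b l <= b k)%N.
  move=> wl; have [h|/ltnW h] := leqP (b l) (b k); first exact: (wl k l).
  by apply: (wl l k) => //; rewrite eq_sym.
have eQ : expR (complex.Re w) < Q^-1.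
  rewrite -[complex.Re w]opprK expRN ltf_pV2 ?posrE ?expR_gt0 //.
  have := expR_ge1Dx (- complex.Re w); lra.
(* Monomials of equal degree in x differ by a positive power of e^w, which is smaller than 1/Q here,
   so they cannot be comparable. *)
have ere (i j : I) : (a i < a j)%N -> m w x i <= Q * m w x j -> b i = b j -> False.
  move=> aij; rewrite /m => H bij; move: H; rewrite bij mulrA ler_pM2r ?exprn_gt0 ?nm_gt0 //.
  have -> : expR (complex.Re w *+ a j) = expR (complex.Re w *+ a i) *
      (expR (complex.Re w) * expR (complex.Re w *+ (a j - (a i).+1))).
    by rewrite -!expRD addrA -mulrSr -mulrnDr subnKC.
  set e := expR (complex.Re w) in eQ *; set f := expR (_ *+ (_ - _)).
  have f1 : f <= 1 by rewrite -expR0 ler_expR mulrn_wle0 //; lra.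
  have Qe : Q * e < 1 by rewrite mulrC -ltr_pdivlMr // div1r.
  have Qe0 : 0 < Q * e by rewrite mulr_gt0 // expR_gt0.
  rewrite mulrCA -[X in X <= _]mulr1 ler_pM2l ?expR_gt0 // mulrA => h.
  have : Q * e * f <= Q * e * 1 by rewrite ler_wpM2l // ltW.
  lra.
move: blk; rewrite leq_eqVlt => /orP[/eqP blk|blk].
  have [h|h|h] := ltngtP (a k) (a l).
  - by case: (ere k l h Hkl).
  - by case: (ere l k h Hlk).
  - by move: kl; rewrite (ab_inj h) ?eqxx.
exists k, l; split=> //; set al := slope k l; set zeta := x * _.
have zE : nm x = nm zeta * expR (al * complex.Re w).
  rewrite /zeta nmM nm_cexp ReN ReM /= mul0r subr0 expRN mulfVK //.
  by rewrite gt_eqF ?expR_gt0.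
have nz : 0 < nm zeta by rewrite nm_gt0 mulf_neq0 // cexp_neq0.
have bb : (b k)%:R - (b l)%:R != 0 :> R by rewrite subr_eq0 eqr_nat gtn_eqF.
have mE i : m w x i = expR (((a i)%:R + al * (b i)%:R) * complex.Re w) * nm zeta ^+ b i.
  rewrite /m zE exprMn -expRM_natl [nm zeta ^+ _ * _]mulrC [LHS]mulrA -expRD; congr (expR _ * _).
  by rewrite -[complex.Re w *+ _]mulr_natl; ring.
have phiE : (a k)%:R + al * (b k)%:R = (a l)%:R + al * (b l)%:R.
  by rewrite /al /slope; field.
have pw (t : R) n : (0 < n)%N -> 0 <= t -> t ^+ n <= Q -> t <= Q.
  move=> n0 t0 tn; rewrite leNgt; apply/negP => Qt.
  have t1 : 1 <= t by lra.
  by have := ler_eXnr n0 t1; lra.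
have n0 : (0 < b k - b l)%N by rewrite subn_gt0.
have zk : nm zeta ^+ b k = nm zeta ^+ (b k - b l) * nm zeta ^+ b l.
  by rewrite -exprD subnK // ltnW.
move: Hkl Hlk; rewrite !mE phiE zk.
set E := expR _; set V := nm zeta ^+ b l; set U := nm zeta ^+ (b k - b l).
have E0 : 0 < E := expR_gt0 _.
have V0 : 0 < V by rewrite exprn_gt0.
have U0 : 0 < U by rewrite exprn_gt0.
have -> : E * (U * V) = U * (E * V) by ring.
rewrite ler_pM2r ?mulr_gt0 // => UQ; rewrite [Q * _]mulrA -[leLHS]mul1r ler_pM2r ?mulr_gt0 // => QU.
rewrite (pw (nm zeta) (b k - b l)%N) ?nm_ge0 // andbT.
rewrite -[nm zeta]invrK lef_pV2 ?posrE ?invr_gt0 //.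
apply: (pw _ (b k - b l)%N) => //; first by rewrite invr_ge0 nm_ge0.
by rewrite exprVn -/U -[U^-1]mul1r ler_pdivrMr.
Qed.

End Exponents.
End Newton.

Section NewtonClasses.
Variable R : realType.
Local Notation C := R[i].
Implicit Types (w x z c : C) (K u : R).

(** In z = x e^(-al w) the monomial k has order e^(phi_k w). Dividing by the dominant order e^(mu w)
    leaves E(z) = O(e^(g u)) on |z| <= Q, so z is close to a root of E. *)
Lemma newton_edge (I : finType) (r : I -> C) (a b : I -> nat)
    (ab_inj : forall k l, a k = a l -> b k = b l -> k = l) (al Q : R) : 1 <= Q ->
  (exists k, r k != 0) -> exists (cs : seq C) (K0 : R), [/\ 1 <= K0,
    forall c, c \in cs -> c != 0 &
    forall w x, dom K0 w -> msum r a b w x = 0 ->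
      Q^-1 <= nm (x * cexp (- (al%:C%C * w))) <= Q ->
      exists2 c, c \in cs & nm (x * cexp (- (al%:C%C * w)) - c) <= bnd K0 (complex.Re w)].
Proof.
move=> Q1 [k0 rk0]; have Q0 : 0 < Q by lra.
pose phi k := (a k)%:R + al * (b k)%:R : R.
have [k1 rk1 k1min] := @arg_minP _ _ I k0 (fun k => r k != 0) phi rk0.
set mu := phi k1 in k1min.
(* The edge polynomial. Its coefficients do not merge: equal phi and equal b force equal a. *)
pose E : {poly C} := \sum_(k | phi k == mu) r k *: 'X^(b k).
have E0 : E != 0.
  apply: contraNneq rk1 => /(congr1 (fun p : {poly C} => p`_(b k1))).
  rewrite coef0 coef_sum (bigD1 k1) //= coefZ coefXn eqxx mulr1 big1 ?addr0 => [->//|k].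
  move=> /andP[/eqP pk kk1]; rewrite coefZ coefXn; case: eqP => [bk|]; last by rewrite mulr0.
  case/negP: kk1; apply/eqP/ab_inj => //.
  move: pk; rewrite /mu /phi -bk => /addIr/eqP; rewrite eqr_nat => /eqP; exact.
(* g is the gap between the dominant order and the next one. *)
have [||g g0 Hg] := @fin_delta R I (enum I) (fun k d => r k != 0 -> phi k != mu -> mu + d <= phi k).
- by move=> k d d' dd H rk pk; apply: le_trans (H rk pk); rewrite lerD2l.
- move=> k _; have [rk|rk] := eqVneq (r k) 0; first by exists 1; rewrite // rk eqxx.
  have [pk|pk] := eqVneq (phi k) mu; first by exists 1; rewrite // pk eqxx.
  exists (phi k - mu) => [|_ _]; last by rewrite addrC subrK.
  by rewrite subr_gt0 lt_neqAle eq_sym pk k1min.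
have {}Hg k : r k != 0 -> phi k != mu -> mu + g <= phi k by apply: Hg; rewrite mem_enum.
pose A := \sum_k nm (r k) * Q ^+ b k.
have A0 : 0 <= A by rewrite sumr_ge0 // => k _; rewrite mulr_ge0 ?nm_ge0 ?exprn_ge0 // ltW.
have Esmall w x : complex.Re w < 0 -> msum r a b w x = 0 ->
    nm (x * cexp (- (al%:C%C * w))) <= Q ->
    nm E.[x * cexp (- (al%:C%C * w))] <= A * expR (g * complex.Re w).
  move=> w0; set z := x * _ => sum0 zQ.
  have xE : x = z * cexp (al%:C%C * w).
    by rewrite /z cexpN mulfVK // cexp_neq0.
  clearbody z.
  have sumE : \sum_k r k * cexp ((phi k - mu)%:C%C * w) * z ^+ b k = 0.
    transitivity (cexp (- (mu%:C%C * w)) * msum r a b w x); last by rewrite sum0 mulr0.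
    rewrite /msum mulr_sumr; apply: eq_bigr => k _.
    rewrite xE exprMn -cexpMn.
    transitivity (r k * (cexp (- (mu%:C%C * w)) * cexp (w *+ a k) *
      cexp (al%:C%C * w *+ b k)) * z ^+ b k); last first.
      move: (z ^+ b k) (cexp (- _)) (cexp (w *+ a k)) (cexp (_ *+ _)) => z' c1 c2 c3; ring.
    rewrite -!cexpD; congr (_ * cexp _ * _).
    rewrite /phi rmorphB rmorphD rmorphM !rmorph_nat.
    rewrite -[w *+ _]mulr_natl -[_ * w *+ _]mulr_natl; ring.
  have -> : E.[z] = - \sum_(k | phi k != mu) r k * cexp ((phi k - mu)%:C%C * w) * z ^+ b k.
    apply/eqP; rewrite -addr_eq0; apply/eqP; apply: (etrans _ sumE); rewrite [RHS](bigID (fun k => phi k == mu)) /=.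
    congr (_ + _); rewrite /E horner_sum; apply: eq_bigr => k /eqP ->.
    by rewrite subrr mul0r cexp0 mulr1 hornerZ hornerXn.
  rewrite nmN; apply: le_trans (nm_sum _ _ _) _; rewrite /A mulr_suml.
  rewrite [leRHS](bigID (fun k => phi k != mu)) /=; apply: ler_wpDr.
    by rewrite sumr_ge0 // => k _; rewrite !mulr_ge0 ?nm_ge0 ?exprn_ge0 ?expR_ge0 // ltW.
  apply: ler_sum => k pk; have [->|rk] := eqVneq (r k) 0; first by rewrite !mul0r nm0 !mul0r.
  rewrite !nmM nmX nm_cexp mulrAC; apply: ler_pM; rewrite ?mulr_ge0 ?exprn_ge0 ?nm_ge0 ?expR_ge0 //.
    by rewrite ler_wpM2l ?nm_ge0 // lerXn2r ?nnegrE ?nm_ge0 // ltW.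
  rewrite ler_expR ReM /= mul0r subr0; apply: ler_wnM2r; first exact: ltW.
  by rewrite lerBrDl Hg.
(* A nonzero constant E cannot be O(e^(g u)) for very negative u: there are no solutions, and the
   list is empty. *)
have [E1|E1] := leqP (size E) 1.
  have [e0 e00 EE] : exists2 e, e != 0 & E = e%:P.
    by exists E`_0; rewrite -?size1_polyC // -polyC_eq0 -size1_polyC.
  have A1 : 0 < A + 1 by lra.
  have e1 : 0 < nm e0 / (A + 1) by rewrite divr_gt0 // nm_gt0.
  have [K0 HK0] := expR_small e1 g0.
  exists [::], (Num.max 1 K0); rewrite le_max lexx; split=> // w x wK sum0 /andP[_ zQ].
  have K1 : 1 <= Num.max 1 K0 by rewrite le_max lexx.
  have KK : K0 <= Num.max 1 K0 by rewrite le_max lexx orbT.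
  have [_ w0] := domE K1 wK; have := Esmall w x w0 sum0 zQ; rewrite EE hornerC => H.
  have := HK0 _ _ K1 KK wK; rewrite ltr_pdivlMr // => H2.
  by exfalso; have := expR_ge0 (g * complex.Re w); lra.
have [rs ER] := closed_field_poly_normal E.
pose d := (size E).-1; pose L := nm (lead_coef E).
have L0 : 0 < L by rewrite nm_gt0 lead_coef_eq0.
have d0 : (0 < d)%N by rewrite /d; case: (size E) E1 => [|[]].
(* Taking the d-th root of (A / L) e^(g u) requires K0 >= d / g and K0 >= A / L; Q + 1 makes the
   error smaller than 1/Q <= |z|, which rules out the root c = 0. *)
pose K0 := Num.max (Num.max (d%:R / g) (A / L)) (Q + 1).
have KQ : Q + 1 <= K0 by rewrite le_max lexx orbT.
have KA : A / L <= K0 by rewrite !le_max lexx orbT.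
have Kd : d%:R / g <= K0 by rewrite !le_max lexx.
have K1 : 1 <= K0 by lra.
have K00 : 0 < K0 by lra.
have QK : Q < K0 by lra.
exists [seq c <- rs | c != 0], K0; split=> //.
  by move=> c; rewrite mem_filter => /andP[].
move=> w x wK sum0 /andP[Qz zQ]; have [_ w0] := domE K1 wK.
set z := x * _ in Qz zQ *; have := Esmall w x w0 sum0 zQ; rewrite -/z => Ez.
have [c cE Hc] := near_root z E1.
have zc : nm (z - c) <= bnd K0 (complex.Re w).
  rewrite -(ler_pXn2r d0) ?nnegrE ?nm_ge0 ?bnd_ge0 //.
  rewrite -(ler_pM2l L0); apply: le_trans Hc _; apply: le_trans Ez _.
  rewrite /bnd exprMn -expRM_natl [leRHS]mulrA; apply: ler_pM; rewrite ?expR_ge0 //.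
    rewrite mulrC -ler_pdivrMr //; apply: le_trans KA _.
    by rewrite ler_eXnr.
  rewrite ler_expR [leRHS]mulrCA [leLHS]mulrC; apply: ler_wnM2l; first exact: ltW.
  by rewrite ler_pdivrMr; [rewrite mulrC -ler_pdivrMr | lra].
exists c => //; rewrite mem_filter; apply/andP; split.
  apply: contraTneq Qz => c0; rewrite -ltNge; rewrite c0 subr0 in zc.
  apply: le_lt_trans zc _; apply: le_lt_trans (bnd_small K1 wK) _.
  by rewrite ltf_pV2 ?posrE.
move/eqP: cE; rewrite -/(root E c) ER rootZ ?lead_coef_eq0 //.
by rewrite root_prod_XsubC.
Qed.

Lemma newton_list (I : finType) (r : I -> C) (a b : I -> nat)
    (ab_inj : forall k l, a k = a l -> b k = b l -> k = l) :
  (exists k, r k != 0) -> exists (L : seq (R * C)) (K0 : R), [/\ 1 <= K0,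
    forall p, p \in L -> p.2 != 0 &
    forall w x, dom K0 w -> msum r a b w x = 0 -> x != 0 ->
      exists2 p, p \in L & nm (x * cexp (- (p.1%:C%C * w)) - p.2) <= bnd K0 (complex.Re w)].
Proof.
move=> rk; have [Q [Q1 HQ]] := dominant_slope ab_inj rk.
have [cs Hcs] := choice (fun kl : I * I => newton_edge ab_inj (slope R a b kl.1 kl.2) Q1 rk).
pose S (kl : I * I) K := forall w x, dom K w -> msum r a b w x = 0 ->
  let z := x * cexp (- ((slope R a b kl.1 kl.2)%:C%C * w)) in Q^-1 <= nm z <= Q ->
      exists2 c, c \in cs kl & nm (z - c) <= bnd K (complex.Re w).
have [||K0 [K1 HK0]] := @fin_large R _ (enum {: I * I}) S.
- move=> kl K K' K1 KK H w x wK sum0 z zQ; have [c cc zc] := H w x (dom_mono K1 KK wK) sum0 zQ.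
  exists c => //; apply: le_trans zc _; apply: bnd_mono => //; apply/ltW.
  by have [] := domE (le_trans K1 KK) wK.
- by move=> kl _; have [K0 [K1 _ H]] := Hcs kl; exists K0.
pose L := [seq (slope R a b kl.1 kl.2, c) | kl <- enum {: I * I}, c <- cs kl].
exists L, (Num.max K0 Q); split; first by rewrite le_max K1.
  move=> p /allpairsPdep[kl [c [_ cc ->]]] /=.
  by have [K [_ H _]] := Hcs kl; exact: H.
move=> w x wK sum0 x0; have K'1 : 1 <= Num.max K0 Q by rewrite le_max K1.
have KK : K0 <= Num.max K0 Q by rewrite le_max lexx.
have [wQ w0] := domE K'1 wK.
have [|k [l [_ _ _ zQ]]] := HQ w x _ x0 sum0.
  by apply: lt_le_trans wQ _; rewrite lerN2 le_max lexx orbT.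
have [|c cc zc] := HK0 (k, l) _ w x (dom_mono K1 KK wK) sum0 zQ; first by rewrite mem_enum.
exists (slope R a b k l, c).
  by apply/allpairsPdep; exists (k, l), c; rewrite mem_enum.
by apply: le_trans zc _; apply: bnd_mono => //; exact: ltW.
Qed.

(* Distinct classes (alpha, c) stay a fixed distance apart in the coordinate
   x e^{- alpha w}; this is what keeps a class constant along a path. *)
Lemma newton_classes (N : {poly {poly C}}) : N != 0 ->
  exists (L : seq (R * C)) (K0 tau : R), [/\ 1 <= K0, 0 < tau,
    forall p, p \in L -> p.2 != 0 &
    forall K w x, K0 <= K -> dom K w -> ev N (cexp w) x = 0 ->
      (x = 0 \/ exists2 p, p \in L & nm (x * cexp (- (p.1%:C%C * w)) - p.2) <= bnd K (complex.Re w))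
      /\ forall p, p \in L -> nm (x * cexp (- (p.1%:C%C * w)) - p.2) <= bnd K (complex.Re w) \/
           tau <= nm (x * cexp (- (p.1%:C%C * w)) - p.2)].
Proof.
move=> N0; pose D := \max_(i < size N) size (N`_i)%R.
pose r (k : 'I_(size N) * 'I_D) := (N`_k.1)`_k.2.
pose a (k : 'I_(size N) * 'I_D) : nat := k.2.
pose b (k : 'I_(size N) * 'I_D) : nat := k.1.
have ab_inj k l : a k = a l -> b k = b l -> k = l.
  by case: k l => i j [i' j']; rewrite /a /b /= => /val_inj -> /val_inj ->.
have sN : (0 < size N)%N by rewrite size_poly_gt0.
have evN w x : ev N (cexp w) x = msum r a b w x.
  rewrite evE /msum (eq_bigr (fun k => r (k.1, k.2) * cexp (w *+ k.2) * x ^+ k.1)); last first.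
    by case.
  rewrite -(pair_bigA _ (fun i j => r (i, j) * cexp (w *+ j) * x ^+ i)) /=.
  apply: eq_bigr => i _; rewrite -mulr_suml; congr (_ * _).
  rewrite (@horner_coef_wide _ D); last exact: (leq_bigmax i).
  by apply: eq_bigr => j _; rewrite cexpMn.
have rk : exists k, r k != 0.
  have li : ((size N).-1 < size N)%N by rewrite ltn_predL.
  have l0 : lead_coef N != 0 by rewrite lead_coef_eq0.
  have lj : ((size (lead_coef N)).-1 < D)%N.
    rewrite /D; apply: leq_trans (leq_bigmax (Ordinal li)).
    by rewrite -lead_coefE ltn_predL size_poly_gt0.
  by exists (Ordinal li, Ordinal lj); rewrite /r /= -!lead_coefE lead_coef_eq0.
have [L [K0 [K1 L0 HL]]] := newton_list ab_inj rk.
pose near (p : R * C) K w x := nm (x * cexp (- (p.1%:C%C * w)) - p.2) <= bnd K (complex.Re w).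
(* T is the threshold and its inverse is the gap, so that [fin_large] settles all pairs of classes
   with one constant. *)
pose S (pq : (R * C) * (R * C)) T := forall K w x, T <= K -> dom K w -> near pq.2 K w x ->
  near pq.1 K w x \/ T^-1 <= nm (x * cexp (- (pq.1.1%:C%C * w)) - pq.1.2).
have [||T [T1 HT]] := @fin_large R _ [seq (p, q) | p <- L, q <- L] S.
- move=> pq T T' T1 TT H K w x TK wK nq; have [|h] := H K w x (le_trans TT TK) wK nq; first by left.
  by right; apply: le_trans h; rewrite lef_pV2 ?posrE //; lra.
- move=> _ /allpairsP[[[al c] [al' c']] [/= pL qL ->]].
  have c0 : 0 < nm c by rewrite nm_gt0; exact: (L0 _ pL).
  have c'0 : 0 < nm c' by rewrite nm_gt0; exact: (L0 _ qL).
  rewrite /S /near /=.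
  have zE w x : x * cexp (- (al%:C%C * w)) = x * cexp (- (al'%:C%C * w)) * cexp ((al' - al)%:C%C * w).
    rewrite -mulrA -cexpD; congr (_ * cexp _); rewrite rmorphB; ring.
  have invle (t e : R) : 0 < e -> e^-1 <= t -> t^-1 <= e.
    move=> e0 et; rewrite -[e]invrK lef_pV2 ?posrE ?invr_gt0 //.
    by apply: lt_le_trans et; rewrite invr_gt0.
  have [<-|ne] := eqVneq al al'.
    have [<-|cc] := eqVneq c c'; first by exists 1; split=> // K w x _ _ ?; left.
    have e0 : 0 < nm (c - c') / 2 by rewrite divr_gt0 // nm_gt0 subr_eq0.
    exists (Num.max 1 (nm (c - c') / 2)^-1); rewrite le_max lexx; split=> // K w x TK wK.
    have K1' : 1 <= K by apply: le_trans TK; rewrite le_max lexx.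
    have eK : (nm (c - c') / 2)^-1 <= K by apply: le_trans TK; rewrite le_max lexx orbT.
    set z := x * _ => zc; right.
    apply: (@le_trans _ _ (nm (c - c') / 2)); first by apply: invle; rewrite // le_max lexx orbT.
    have := bnd_small K1' wK; have := invle _ _ e0 eK.
    have := nmD (c - z) (z - c'); rewrite addrA subrK (nm_distC c z); lra.
  (* The al-coordinate is the al'-coordinate times e^((al' - al) w). It tends to 0 here, hence stays
     away from c. *)
  have [lt|lt] := ltP al al'.
    have g0 : 0 < al' - al by rewrite subr_gt0.
    have e0 : 0 < nm c / 2 / (nm c' + 1) by rewrite !divr_gt0 //; lra.
    have [T0 HT0] := expR_small e0 g0.
    exists (Num.max (Num.max 1 T0) (nm c / 2)^-1); rewrite !le_max lexx; split=> // K w x TK wK.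
    have K1' : 1 <= K by apply: le_trans TK; rewrite !le_max lexx.
    have KT : T0 <= K by apply: le_trans TK; rewrite !le_max lexx orbT.
    have := HT0 K w K1' KT wK; rewrite (zE w x); set z := x * _; set e := expR _ => eb zc; right.
    apply: (@le_trans _ _ (nm c / 2)); first by apply: invle; rewrite ?le_max ?lexx ?orbT ?divr_gt0.
    have zb : nm z <= nm c' + 1.
      have := nmD (z - c') c'; rewrite subrK; have := bnd_small K1' wK.
      have : K^-1 <= 1 by rewrite invf_le1 //; lra.
      lra.
    have := nm_dist c (z * cexp ((al' - al)%:C%C * w)); rewrite nm_distC.
    rewrite nmM nm_cexp ReM /= mul0r subr0 -/e => h; apply: le_trans h.
    have : nm z * e <= nm c / 2.
      apply: (@le_trans _ _ ((nm c' + 1) * (nm c / 2 / (nm c' + 1)))).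
        by apply: ler_pM; rewrite ?nm_ge0 ?expR_ge0 // ltW.
      by rewrite mulrC divfK // gt_eqF //; lra.
    lra.
  (* Now the al-coordinate blows up and eventually exceeds |c| by 1. *)
  have g0 : 0 < al - al' by rewrite subr_gt0 lt_neqAle eq_sym ne.
  have e0 : 0 < nm c' / 2 / (nm c + 1) by rewrite !divr_gt0 //; lra.
  have [T0 HT0] := expR_small e0 g0.
  exists (Num.max (Num.max 1 T0) (nm c' / 2)^-1); rewrite !le_max lexx; split=> // K w x TK wK.
  have K1' : 1 <= K by apply: le_trans TK; rewrite !le_max lexx.
  have KT : T0 <= K by apply: le_trans TK; rewrite !le_max lexx orbT.
  have KT2 : (nm c' / 2)^-1 <= K by apply: le_trans TK; rewrite !le_max lexx !orbT.
  have := HT0 K w K1' KT wK; rewrite (zE w x); set z := x * _; set e := expR _ => eb zc; right.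
  apply: (@le_trans _ _ 1); first by rewrite invf_le1 ?le_max ?lexx // !lt_max ltr01.
  have zb : nm c' / 2 <= nm z.
    have := nm_dist c' z; rewrite nm_distC; have := bnd_small K1' wK.
    have := invle _ _ _ KT2; rewrite divr_gt0 // => /(_ isT); lra.
  have := nm_dist (z * cexp ((al' - al)%:C%C * w)) c.
  rewrite nmM nm_cexp ReM /= mul0r subr0.
  have -> : (al' - al) * complex.Re w = - ((al - al') * complex.Re w) by ring.
  rewrite expRN -/e => h; apply: le_trans h; rewrite lerBrDl addrC.
  rewrite ler_pdivlMr ?expR_gt0 //; apply: le_trans zb; rewrite mulrC.
  rewrite -ler_pdivlMr; last by lra.
  by rewrite addrC ltW // addrC.
have [||d d0 Hd] := @fin_delta R _ L (fun p d => d <= nm p.2).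
- by move=> p d d' dd; apply: le_trans.
- by move=> p pL; exists (nm p.2) => //; rewrite nm_gt0; exact: L0.
exists L, (Num.max K0 T), (Num.min d T^-1); split=> //.
- by rewrite le_max K1.
- by rewrite lt_min d0 invr_gt0; lra.
move=> K w x KK wK; rewrite evN => sum0.
have K0K : K0 <= K by apply: le_trans KK; rewrite le_max lexx.
have TK : T <= K by apply: le_trans KK; rewrite le_max lexx orbT.
have [x0|x0] := eqVneq x 0.
  split; first by left.
  move=> p pL; right; rewrite x0 mul0r sub0r nmN; apply: le_trans (Hd p pL).
  by rewrite ge_min lexx.
have [q qL nq] := HL w x (dom_mono K1 K0K wK) sum0 x0.
have {}nq : near q K w x.
  apply: le_trans nq _; apply: bnd_mono => //; apply/ltW.
  by have [] := domE (le_trans K1 K0K) wK.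
split; first by right; exists q.
move=> p pL; have [|//|h] := HT (p, q) _ K w x TK wK nq.
- by apply/allpairsP; exists (p, q).
- by left.
by right; apply: le_trans h; rewrite ge_min lexx orbT.
Qed.

End NewtonClasses.

(** * Elimination *)

Section Elimination.
Variable R : realType.
Local Notation C := R[i].
Implicit Types (s y z w : C) (P N : {poly {poly C}}) (c : {poly C}).

Lemma spM P N s : sp s (P * N) = sp s P * sp s N.
Proof. exact: rmorphM. Qed.

Lemma spZ c P s : sp s (c *: P) = c.[s] *: sp s P.
Proof. by rewrite -[c *: P]mul_polyC spM {1}/sp map_polyC /= mul_polyC. Qed.

Lemma ev0 s y : ev 0 s y = 0.
Proof. by rewrite /ev /sp rmorph0 horner0. Qed.

(* y^0, ..., y^(d-1) is an eigenvector of l * (multiplication by Y modulo P),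
   hence of a polynomial matrix representing l^k * N; its characteristic
   polynomial annihilates l^k * N on the curve. *)
Lemma elimination P N : (1 < size P)%N -> exists (h : {poly C}) (chi : {poly {poly C}}),
  [/\ h != 0, chi != 0 &
    forall s y, ev P s y = 0 -> ev chi s (h.[s] * ev N s y) = 0].
Proof.
move=> P1; pose d := (size P).-2; pose l := lead_coef P.
have sP : size P = d.+2 by rewrite /d; case: (size P) P1 => [|[]].
have l0 : l != 0 by rewrite lead_coef_eq0 -size_poly_gt0 ltnW.
pose v y : 'rV[C]_d.+1 := \row_i y ^+ i.
have v0 y : v y != 0.
  apply/eqP => /rowP/(_ ord0); rewrite !mxE expr0 => /eqP.
  by rewrite oner_eq0.
(* The companion matrix scaled by l; the degree of P is d.+1, and the last column rewrites l y^(d+1)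
   in lower powers. *)
pose Y : 'M[{poly C}]_d.+1 := \matrix_(i, j)
  if (j == ord_max) then - P`_i else l *+ (i == j.+1 :> nat).
have vY s y : ev P s y = 0 -> v y *m map_mx (horner_eval s) Y = (l.[s] * y) *: v y.
  move=> Py; apply/rowP => j; rewrite !mxE.
  have [->|jd] := eqVneq j ord_max.
    move: Py; rewrite evE sP big_ord_recr /= => /eqP; rewrite addr_eq0 => /eqP e.
    rewrite -mulrA -exprS /l lead_coefE sP /= -[RHS]opprK -e -sumrN; apply: eq_bigr => i _.
    by rewrite !mxE eqxx /= horner_evalE hornerN mulrN mulrC.
  have jd1 : (j.+1 < d.+1)%N.
    by rewrite ltn_neqAle ltn_ord andbT; apply: contra jd => /eqP[jd]; apply/eqP/val_inj.
  rewrite (bigD1 (Ordinal jd1)) //= !mxE (negbTE jd) eqxx mulr1n horner_evalE.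
  rewrite big1 ?addr0 => [|i ij]; first by rewrite exprS; ring.
  rewrite !mxE (negbTE jd) (_ : (_ == _ :> nat) = false) ?mulr0n ?horner_evalE ?horner0 ?mulr0 //.
  by apply: contraNF ij => /eqP ij; apply/eqP/val_inj.
(* Horner's scheme in the matrix Y; each multiplication by Y costs one more factor l. *)
have [k [M HM]] : exists (k : nat) (M : 'M[{poly C}]_d.+1), forall s y, ev P s y = 0 ->
    v y *m map_mx (horner_eval s) M = (l.[s] ^+ k * ev N s y) *: v y.
  elim/poly_ind: N => [|N c [k [M HM]]].
    exists 0%N, 0 => s y _; rewrite map_mx0 mulmx0 /ev /sp rmorph0 horner0 mulr0.
    by rewrite scale0r.
  exists k.+1, (M *m Y + (c * l ^+ k.+1)%:M) => s y Py.
  rewrite map_mxD map_mxM map_scalar_mx mulmxDr mulmxA HM // -scalemxAl vY // scalerA.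
  rewrite mul_mx_scalar -scalerDl evD evM evX evC; congr (_ *: _).
  by rewrite /= horner_evalE hornerM horner_exp exprS; ring.
exists (l ^+ k), (char_poly M); split.
- by rewrite expf_neq0.
- by rewrite monic_neq0 // char_poly_monic.
move=> s y Py; apply/eqP; rewrite /ev /sp map_char_poly -/(root _ _) -eigenvalue_root_char.
apply/eigenvalueP; exists (v y) => //.
by rewrite HM // horner_exp.
Qed.

Lemma poly_nz c : c != 0 -> exists2 rho, 0 < rho & forall s, 0 < nm s < rho -> c.[s] != 0.
Proof.
move=> c0; have [r cE] := closed_field_poly_normal c.
have [||d d0 Hd] := @fin_delta R _ r (fun z d => forall s, 0 < nm s < d -> s != z).
- move=> z d d' dd H s /andP[s0 sd]; apply: H; rewrite s0; exact: lt_le_trans dd.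
- move=> z _; have [->|z0] := eqVneq z 0.
    by exists 1 => // s /andP[]; rewrite nm_gt0.
  exists (nm z); first by rewrite nm_gt0.
  by move=> s /andP[_]; apply: contraTneq => ->; rewrite ltxx.
exists d => // s sd; rewrite -/(root c s) cE rootZ ?lead_coef_eq0 // root_prod_XsubC.
by apply/negP => /Hd/(_ s sd); rewrite eqxx.
Qed.

Definition reduced_poly P := [/\ P != 0, P`_0 != 0 &
  exists U V c, c != 0 /\ U * P + V * P^`() = c%:P].

(** d log y / dw on the curve P = 0, for s = e^w: the factor s is ds/dw. *)
Definition logder P s y : C := - (s * ev (dbase P) s y) / ev P^`() s y / y.

Lemma reduced_regular P : reduced_poly P -> exists2 rho, 0 < rho & forall s, 0 < nm s < rho ->
  (lead_coef P).[s] != 0 /\ forall y, ev P s y = 0 -> y != 0 /\ ev P^`() s y != 0.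
Proof.
move=> [P0 p0 [U [V [c [c0 UV]]]]].
have [|r r0 H] := @poly_nz (lead_coef P * P`_0 * c).
  by rewrite !mulf_neq0 // lead_coef_eq0.
exists r => // s sr; have := H s sr; rewrite !hornerM !mulf_eq0 !negb_or.
move=> /andP[/andP[-> ps0] cs0]; split=> // y Py; split.
  apply: contraNneq ps0 => y0; move: Py; rewrite y0 /ev horner_coef0 coef_map /=.
  by rewrite horner_evalE => ->.
apply: contraNneq cs0 => Py'; have := congr1 (fun Q => ev Q s y) UV.
by rewrite evD !evM Py Py' !mulr0 addr0 evC => <-.
Qed.

(** Both denominators become polynomial on the curve: V P' = c there, and P = W Y + P_0 gives W y =
    - P_0. Hence P_0 c q = s P_s W V, to which [elimination] applies. *)
Lemma logder_algebraic P : reduced_poly P -> exists (m : {poly C}) (chi : {poly {poly C}}) (rho : R),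
  [/\ m != 0, chi != 0, 0 < rho & forall s y, 0 < nm s < rho -> ev P s y = 0 ->
    ev chi s (m.[s] * logder P s y) = 0].
Proof.
move=> gP; have [r r0 reg] := reduced_regular gP; move: gP => [P0 p0 [U [V [c [c0 UV]]]]].
have [P1|P1] := leqP (size P) 1.
  exists 1, 1, r; split=> //; rewrite ?oner_neq0 //.
  move=> s y sr Py; have [_] := (reg s sr).2 y Py.
  have -> : P^`() = 0 by have := size1_polyC P1; move: (P`_0) => e ->; rewrite derivC.
  by move=> /eqP[]; exact: ev0.
have [W PW] : exists W, P = W * 'X + (P`_0)%:P.
  elim/poly_ind: P {P0 p0 UV reg P1} => [|W a _]; first by exists 0; rewrite mul0r coef0 polyC0 addr0.
  by exists W; rewrite coefD coefMX coefC /= add0r.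
have [h [chi [h0 chi0 H]]] := elimination ('X%:P * dbase P * W * V) P1.
exists (h * (P`_0 * c)), chi, r; split=> //; first by rewrite !mulf_neq0.
move=> s y sr Py; have [y0 Py'0] := (reg s sr).2 y Py.
have := H s y Py; congr (ev chi s _ = 0); rewrite !hornerM -[RHS]mulrA; congr (_ * _).
have PV : ev V s y * ev P^`() s y = c.[s].
  have := congr1 (fun Q => ev Q s y) UV.
  by rewrite evD !evM Py mulr0 add0r evC.
have WY : (P`_0).[s] = - (ev W s y * y).
  have := congr1 (fun Q => ev Q s y) PW; rewrite Py evD evM evX evC => /esym/eqP.
  by rewrite addrC addr_eq0 => /eqP.
rewrite !evM evC hornerX -PV WY /logder; field.
by rewrite y0.
Qed.

(** P' is the squarefree part of P after removal of the powers of Y. Over a small punctured disc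
    this loses no nonzero root. *)
Lemma exists_reduced P : P != 0 -> exists P' (rho : R), [/\ reduced_poly P', 0 < rho &
  forall s y, 0 < nm s < rho -> y != 0 -> ev P s y = 0 -> ev P' s y = 0].
Proof.
move=> P0; have [k [P1 + PE]] := multiplicity_XsubC P 0.
rewrite P0 /= => nr; have p10 : P1`_0 != 0.
  by move: nr; rewrite /root horner_coef0.
have P10 : P1 != 0 by apply: contraNneq p10 => ->; rewrite coef0.
pose G := gcdp P1 P1^`(); pose S := P1 %/ G.
(* Divisibility over C[s] holds only up to scalars in C[s]; the radius will avoid the zeros of these
   scalars. *)
have /Pdiv.Idomain.dvdpP[[c Q] /= c0 cG] := dvdp_gcdr P1 P1^`(); rewrite -/G in cG.
have := Pdiv.Idomain.divpK (dvdp_gcdl P1 P1^`()); rewrite -/G -/S; set a := _ ^+ _ => SG.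
have G0 : G != 0 by rewrite gcdp_eq0 negb_and P10.
have a0 : a != 0 by rewrite expf_neq0 // lead_coef_eq0.
have s0 : S`_0 != 0.
  have := congr1 (fun p : {poly {poly C}} => p`_0) SG; rewrite coefM big_ord1 coefZ => e.
  have : a * P1`_0 != 0 by rewrite mulf_neq0.
  by rewrite -e mulf_eq0 negb_or => /andP[].
have [|r r0 Hr] := @poly_nz (a * c * lead_coef P1).
  by rewrite !mulf_neq0 // lead_coef_eq0.
exists S, r; split=> //.
  split=> //; first by apply: contraNneq s0 => ->; rewrite coef0.
  have := make_separable P10; rewrite -/G -/S separable_poly.unlock.
  move=> /Bezout_coprimepP[[U V] /= /eqpP[[u v] /= /andP[u0 v0] e]].
  exists (u%:P * U), (u%:P * V), v; split=> //.
  by rewrite -!mulrA -mulrDr mul_polyC e alg_polyC.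
move=> s y sr y0 Py; have := Hr s sr; rewrite !hornerM !mulf_eq0 !negb_or.
move=> /andP[/andP[as0 cs0] ls0].
have P1y : ev P1 s y = 0.
  move: Py; rewrite PE evM => /eqP; rewrite mulf_eq0 => /orP[/eqP//|].
  have -> : ev (('X - 0%:P) ^+ k) s y = y ^+ k.
    elim: k {PE} => [|k IH]; first by rewrite !expr0 -[1]/(1%:P) evC hornerC.
    by rewrite !exprS evM IH polyC0 subr0 evX.
  by rewrite expf_eq0 (negbTE y0) andbF.
(* If y were not a root of S, its full multiplicity m in P1 would lie in G, hence in the derivative,
   which has multiplicity m - 1. *)
apply/eqP/negP => /negP Sy.
have [m [q + p1E]] := multiplicity_XsubC (sp s P1) y.
have sp0 : sp s P1 != 0.
  by apply: contraNneq ls0 => sp0; rewrite lead_coefE -[_.[s]]/(horner_eval s _) -coef_map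
    -/(sp s P1) sp0 coef0.
rewrite sp0 /= => qy.
have m0 : (0 < m)%N.
  case: m p1E => // p1E; move: P1y qy; rewrite /ev p1E expr0 mulr1 => qy.
  by rewrite /root qy eqxx.
pose X : {poly C} := 'X - y%:P.
have XG : X ^+ m %| sp s G.
  have e : sp s S * sp s G = a.[s] *: sp s P1.
    by rewrite -spM SG spZ.
  have : X ^+ m %| sp s S * sp s G by rewrite e p1E dvdpZr // dvdp_mull.
  rewrite Gauss_dvdpr // coprimep_expl // /X coprimep_sym coprimep_XsubC.
  exact: Sy.
have : X ^+ m %| (sp s P1)^`().
  rewrite -(dvdpZr _ _ cs0) deriv_map.
  have -> : c.[s] *: map_poly (horner_eval s) P1^`() = sp s Q * sp s G.
    by rewrite -/(sp s _) -spZ cG spM.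
  by rewrite dvdp_mull.
rewrite p1E derivM deriv_exp derivXsubC mul1r -/X.
have XA : X ^+ m %| q^`() * X ^+ m by rewrite dvdp_mull.
rewrite (dvdp_addr _ XA); case: m m0 {p1E XG XA} => // m _ /=.
rewrite mulrnAr -mulrnAl exprS dvdp_mul2r ?expf_neq0 ?polyXsubC_eq0 //.
rewrite -scaler_nat dvdpZr ?pnatr_eq0 // dvdp_XsubCl => qy'.
by rewrite qy' in qy.
Qed.

End Elimination.

(** * Logarithmic derivatives along rays *)

Section Rays.
Variable R : realType.
Local Notation C := R[i].
Implicit Types (w x y z c : C) (P : {poly {poly C}}) (K u : R).

Definition cts (f : C -> C -> C) w y := forall eta, 0 < eta -> exists2 delta, 0 < delta &
  forall w1 y1, nm (w1 - w) < delta -> nm (y1 - y) < delta -> nm (f w1 y1 - f w y) < eta.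

Lemma ctsM f g w y : cts f w y -> cts g w y -> cts (fun w y => f w y * g w y) w y.
Proof.
move=> fc gc eta eta0; set F := f w y; set G := g w y.
have [F0 G0] := (nm_ge0 F, nm_ge0 G).
pose e := Num.min 1 (eta / (2 * (nm F + nm G + 1))).
have D0 : 0 < 2 * (nm F + nm G + 1) by lra.
have e0 : 0 < e by rewrite lt_min ltr01 divr_gt0.
have e1 : e <= 1 by rewrite ge_min lexx.
have eE : e * (2 * (nm F + nm G + 1)) <= eta by rewrite -ler_pdivlMr // ge_min lexx orbT.
have [d d0 H] := fc _ e0; have [d' d'0 H'] := gc _ e0.
exists (Num.min d d'); first by rewrite lt_min d0.
move=> w1 y1; rewrite !lt_min => /andP[h1 h2] /andP[h3 h4].
have := H w1 y1 h1 h3; have := H' w1 y1 h2 h4; rewrite -/F -/G.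
set f1 := f w1 y1; set g1 := g w1 y1 => Hg Hf.
have -> : f1 * g1 - F * G = (f1 - F) * (g1 - G) + (f1 - F) * G + F * (g1 - G) by ring.
apply: le_lt_trans (nmD _ _) _; apply: le_lt_trans (lerD (nmD _ _) (lexx _)) _; rewrite !nmM.
have := nm_ge0 (f1 - F); have := nm_ge0 (g1 - G); nra.
Qed.

Lemma ctsV f w y : cts f w y -> f w y != 0 -> cts (fun w y => (f w y)^-1) w y.
Proof.
move=> fc F0 eta eta0; set F := f w y in F0 *.
have nF : 0 < nm F by rewrite nm_gt0.
have e0 : 0 < Num.min (nm F / 2) (eta * nm F ^+ 2 / 4).
  by rewrite lt_min !divr_gt0 ?mulr_gt0 ?exprn_gt0.
have [d d0 H] := fc _ e0; exists d => // w1 y1 h1 h2.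
have := H w1 y1 h1 h2; rewrite -/F lt_min; set f1 := f w1 y1 => /andP[Ha Hb].
have f1b : nm F / 2 <= nm f1 by have := nm_dist F f1; rewrite nm_distC; lra.
have f1n : 0 < nm f1 by lra.
have f10 : f1 != 0 by rewrite -nm_gt0.
have -> : f1^-1 - F^-1 = - ((f1 - F) / (f1 * F)) by field; rewrite ?f10 ?F0.
rewrite nmN nmM nmV ltr_pdivrMr ?nm_gt0 ?mulf_neq0 // nmM.
apply: lt_le_trans Hb _.
have : eta * (nm F / 2 * nm F) <= eta * (nm f1 * nm F).
  by apply: ler_wpM2l; [exact: ltW | apply: ler_wpM2r; [exact: ltW|]].
have : 0 < eta * (nm F * nm F) by rewrite !mulr_gt0.
rewrite expr2; lra.
Qed.

Lemma cts_sdiff f w y a b : sdiff f w y a b -> cts f w y.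
Proof. by move=> fd eta; exact: sdiff_cont fd eta. Qed.

Lemma cts_ext f g w y : cts f w y -> (forall w y, f w y = g w y) -> cts g w y.
Proof.
by move=> fc fg eta eta0; have [d d0 H] := fc _ eta0; exists d => // w1 y1 *; rewrite -!fg; apply: H.
Qed.

Lemma ctsB_cst f w y c : cts f w y -> cts (fun w y => f w y - c) w y.
Proof.
move=> fc eta eta0; have [d d0 H] := fc _ eta0; exists d => // w1 y1 h1 h2.
by rewrite (_ : _ - _ - _ = f w1 y1 - f w y); [exact: H | ring].
Qed.

Definition twist (al : R) w x : C := x * cexp (- (al%:C%C * w)).

Lemma sdiff_twist al w y : sdiff (twist al) w y (- al%:C%C * twist al w y) (cexp (- (al%:C%C * w))).
Proof.
apply: sdiff_ext (sdiffM (sdiff_snd w y) (sdiff_cexp (- al%:C%C) w y)) _ _ _ => [? ?||].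
- by rewrite mulNr.
- by rewrite /twist mulNr; ring.
- by rewrite mulNr; ring.
Qed.

Lemma cts_logder P w y : y != 0 -> ev P^`() (cexp w) y != 0 ->
  cts (fun w y => logder P (cexp w) y) w y.
Proof.
move=> y0 Py0.
have cy : cts (fun _ y => y) w y := cts_sdiff (sdiff_snd w y).
have cP := cts_sdiff (sdiff_ev P^`() w y).
have cs : cts (fun w y => - cexp w) w y.
  apply: cts_ext (ctsM (cts_sdiff (sdiff_cst (-1) w y)) (cts_sdiff (sdiff_cexp 1 w y))) _.
  by move=> *; rewrite mul1r mulN1r.
have cD := cts_sdiff (sdiff_ev (dbase P) w y).
apply: cts_ext (ctsM (ctsM (ctsM cs cD) (ctsV cP Py0)) (ctsV cy y0)) _ => w1 y1.
by rewrite /logder mulNr.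
Qed.

Lemma nm_conj z : nm z^*%C = nm z.
Proof.
apply/eqP; rewrite -(eqrXn2 (n := 2)) ?nm_ge0 // !nm_sqr.
by case: z => a b /=; rewrite sqrrN.
Qed.

Lemma Re_conjM z : complex.Re (z^*%C * z) = nm z ^+ 2.
Proof. by rewrite nm_sqr; case: z => a b /=; ring. Qed.

(** Provides a fixed direction in which the product of the two class coordinates has real part
    bounded below; this prevents cancellation along a ray. *)
Lemma near_product c k : c != 0 -> k != 0 -> exists2 d, 0 < d & forall z x,
  nm (z - c) <= d -> nm (x - k) <= d ->
  nm (c * k) ^+ 2 / 2 <= complex.Re ((c * k)^*%C * (z * x)).
Proof.
move=> c0 k0; have cn : 0 < nm c by rewrite nm_gt0.
have kn : 0 < nm k by rewrite nm_gt0.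
have D0 : 0 < 2 * (nm c + nm k + 1) by lra.
pose d := Num.min 1 (nm (c * k) / (2 * (nm c + nm k + 1))).
have n0 : 0 < nm (c * k) by rewrite nmM mulr_gt0.
have d0 : 0 < d by rewrite lt_min ltr01 divr_gt0.
have d1 : d <= 1 by rewrite ge_min lexx.
have dE : d * (2 * (nm c + nm k + 1)) <= nm (c * k) by rewrite -ler_pdivlMr // ge_min lexx orbT.
exists d => // z x zc xk.
have H : nm (z * x - c * k) <= nm (c * k) / 2.
  have -> : z * x - c * k = (z - c) * (x - k) + (z - c) * k + c * (x - k) by ring.
  apply: le_trans (nmD _ _) _; apply: le_trans (lerD (nmD _ _) (lexx _)) _.
  rewrite (nmM (z - c)) (nmM (z - c)) (nmM c (x - k)).
  have := nm_ge0 (z - c); have := nm_ge0 (x - k); nra.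
have -> : (c * k)^*%C * (z * x) = (c * k)^*%C * (c * k) + (c * k)^*%C * (z * x - c * k) by ring.
rewrite ReD Re_conjM.
have := nm_ge_Re ((c * k)^*%C * (z * x - c * k)); rewrite (nmM (_^*%C)) nm_conj ler_norml => /andP[h _].
have := ler_wpM2l (ltW n0) H; rewrite expr2; lra.
Qed.

(** The left side is the derivative along the curve that [curve_sdiff] gives for y e^(-al w). *)
Lemma logder_twist P al w y q : q = - (cexp w * ev (dbase P) (cexp w) y) / ev P^`() (cexp w) y ->
  y != 0 -> - al%:C%C * twist al w y + cexp (- (al%:C%C * w)) * q =
  twist al w y * (logder P (cexp w) y - al%:C%C).
Proof. by move=> qE y0; rewrite /twist /logder -qE; set E := cexp (- _); field. Qed.

(** * Exclusion of slopes beta <= 0 *)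

Section NoSteepClass.
Variables (P : {poly {poly C}}) (al be : R) (c k : C) (K0 tau : R).
Hypotheses (c0 : c != 0) (k0 : k != 0) (be0 : be <= 0) (tau0 : 0 < tau) (K01 : 1 <= K0).
Let on w y := ev P (cexp w) y = 0.
Let x w y := logder P (cexp w) y - al%:C%C.
Hypothesis lead_reg : forall w, dom K0 w -> (lead_coef P).[cexp w] != 0.
Hypothesis reg : forall w y, dom K0 w -> on w y -> y != 0 /\ ev P^`() (cexp w) y != 0.
Hypothesis gap_y : forall K w y, K0 <= K -> dom K w -> on w y ->
  nm (twist al w y - c) <= bnd K (complex.Re w) \/ tau <= nm (twist al w y - c).
Hypothesis gap_x : forall K w y, K0 <= K -> dom K w -> on w y ->
  nm (twist be w (x w y) - k) <= bnd K (complex.Re w) \/ tau <= nm (twist be w (x w y) - k).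

Let inclass K w y := nm (twist al w y - c) <= bnd K (complex.Re w) /\
  nm (twist be w (x w y) - k) <= bnd K (complex.Re w).

Let mu := nm (c * k) ^+ 2 / 2.

(* Along the ray w = v + i theta, with v increasing, the derivative of
   Re (g y e^{- al w}) is e^{be v} Re (conj (c k) (y e^{- al w}) (x e^{- be w})). *)
Let ray_step K (d1 : R) (th z : R) (ys : C) : K0 <= K -> K^-1 < tau / 2 -> K^-1 <= d1 ->
  (forall z x, nm (z - c) <= d1 -> nm (x - k) <= d1 ->
     mu <= complex.Re ((c * k)^*%C * (z * x))) ->
  dom K (Complex z th) -> on (Complex z th) ys ->
  let g := (c * k)^*%C * cexp (- (be%:C%C * Complex 0 th)) in
  exists2 d, 0 < d & forall v1 v2 y1 y2, `|v1 - z| < d -> `|v2 - z| < d ->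
    nm (y1 - ys) < d -> nm (y2 - ys) < d -> v1 <= v2 ->
    dom K (Complex v1 th) -> dom K (Complex v2 th) ->
    on (Complex v1 th) y1 -> on (Complex v2 th) y2 -> inclass K (Complex v2 th) y2 ->
    inclass K (Complex v1 th) y1 /\
    mu / 2 * (v2 - v1) <= complex.Re (g * twist al (Complex v2 th) y2) -
      complex.Re (g * twist al (Complex v1 th) y1).
Proof.
move=> KK bt Kd1 Hd1; set w := Complex z th => wK Ps g.
have K1 : 1 <= K := le_trans K01 KK.
have [ys0 Pys0] := reg (dom_mono K01 KK wK) Ps.
have n0 : 0 < nm (c * k) by rewrite nm_gt0 mulf_neq0.
have mu0 : 0 < mu by rewrite divr_gt0 // exprn_gt0.
have ng : nm g = nm (c * k).
  by rewrite /g (nmM (_^*%C)) nm_conj nm_cexp ReN ReM /= mulr0 mul0r subr0 oppr0 expR0 mulr1.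
have t4 : 0 < tau / 4 by rewrite divr_gt0.
have [dy dy0 Hy] := cts_sdiff (sdiff_twist al w ys) t4.
have cx : cts (fun w y => twist be w (x w y)) w ys.
  have cl := ctsB_cst (al%:C%C) (cts_logder ys0 Pys0).
  have ce : cts (fun w _ => cexp (- (be%:C%C * w))) w ys.
    apply: cts_ext (cts_sdiff (sdiff_cexp (- be%:C%C) w ys)) _.
    by move=> *; rewrite mulNr.
  exact: cts_ext (ctsM cl ce) _.
have [dx dx0 Hx] := cx _ t4.
have e0 : 0 < mu / 2 / nm (c * k) by apply: divr_gt0 => //; apply: divr_gt0.
have [ds ds0 Hs] := curve_sdiff (sdiff_twist al w ys) Pys0 e0.
exists (Num.min dy (Num.min dx ds)); first by rewrite !lt_min dy0 dx0.
move=> v1 v2 y1 y2; rewrite !lt_min => /and3P[v1y v1x v1s] /and3P[v2y v2x v2s].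
move=> /and3P[y1y y1x y1s] /and3P[y2y y2x y2s] v12 w1K w2K P1 P2 [A2 B2].
have wE v : nm (Complex v th - w) = `|v - z|.
  by rewrite -nm_real; congr nm; apply/eqP; rewrite eq_complex /= ?subrr !eqxx.
have b1 := bnd_small K1 w1K; have b2 := bnd_small K1 w2K; have bs := bnd_small K1 wK.
have {}Hy v y : `|v - z| < dy -> nm (y - ys) < dy ->
    nm (twist al (Complex v th) y - twist al w ys) < tau / 4 by rewrite -wE; exact: Hy.
have {}Hx v y : `|v - z| < dx -> nm (y - ys) < dx ->
    nm (twist be (Complex v th) (x (Complex v th) y) - twist be w (x w ys)) < tau / 4.
  by rewrite -wE; exact: Hx.
have Hy1 := Hy _ _ v1y y1y; have Hy2 := Hy _ _ v2y y2y.
have Hx1 := Hx _ _ v1x y1x; have Hx2 := Hx _ _ v2x y2x.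
(* Only (v2, y2) is known to be in the class. This puts ys and y1 within tau of the class value, and
   the gap hypothesis then puts them in the class. *)
have near3 (a1 a2 as_ b : C) : nm (a1 - as_) < tau / 4 -> nm (a2 - as_) < tau / 4 ->
    nm (a2 - b) <= K^-1 -> nm (as_ - b) < tau /\ nm (a1 - b) < tau.
  move=> h1 h2 h3; rewrite nm_distC in h2.
  have := nmD (as_ - a2) (a2 - b); rewrite addrA subrK => h4.
  have := nmD (a1 - as_) (as_ - b); rewrite addrA subrK => h5.
  by split; lra.
have [ysc y1c] := near3 _ _ _ _ Hy1 Hy2 (le_trans A2 b2).
have [xsc x1c] := near3 _ _ _ _ Hx1 Hx2 (le_trans B2 b2).
have As : nm (twist al w ys - c) <= d1.
  have [h|] := gap_y KK wK Ps; last by rewrite leNgt ysc.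
  by apply: le_trans h (le_trans bs Kd1).
have Bs : nm (twist be w (x w ys) - k) <= d1.
  have [h|] := gap_x KK wK Ps; last by rewrite leNgt xsc.
  by apply: le_trans h (le_trans bs Kd1).
split.
  split; first by have [h|] := gap_y KK w1K P1; rewrite // leNgt y1c.
  by have [h|] := gap_x KK w1K P1; rewrite // leNgt x1c.
have := Hs (Complex v1 th) y1 (Complex v2 th) y2; rewrite !wE => /(_ v1s y1s v2s y2s P1 P2).
have -> : Complex v2 th - Complex v1 th = (v2 - v1)%:C%C.
  by apply/eqP; rewrite eq_complex /= subrr !eqxx.
rewrite (logder_twist al (erefl _) ys0) -/(x w ys) nm_real ger0_norm ?subr_ge0 //.
set T2 := twist al _ y2; set T1 := twist al _ y1; set Z := twist al w ys.
set r := T2 - T1 - _ => Hr.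
(* The rotation built into g cancels the phase of e^(be w), which is constant along the ray; a
   positive factor e^(be z) remains. *)
have gE : g * (Z * x w ys) = (c * k)^*%C * (Z * twist be w (x w ys)) * (expR (be * z))%:C%C.
  have -> : (expR (be * z))%:C%C = cexp (be%:C%C * w) * cexp (- (be%:C%C * Complex 0 th)).
    rewrite -cexpD -mulrBr.
    have -> : w - Complex 0 th = z%:C%C by apply/eqP; rewrite eq_complex /= subr0 subrr !eqxx.
    by rewrite -rmorphM cexp_real.
  rewrite /twist /g; set E1 := cexp (- _).
  have e2 := cexpN (be%:C%C * w); rewrite e2.
  have := cexp_neq0 (be%:C%C * w); set E2 := cexp _ => E20.
  by field.
have -> : complex.Re (g * T2) - complex.Re (g * T1) =
    complex.Re (g * (Z * x w ys)) * (v2 - v1) + complex.Re (g * r).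
  have -> : complex.Re (g * (Z * x w ys)) * (v2 - v1) =
    complex.Re (g * (Z * x w ys) * (v2 - v1)%:C%C) by rewrite [in RHS]ReM /= mulr0 subr0.
  by rewrite -ReN -!ReD; congr complex.Re; rewrite /r; ring.
rewrite gE ReM /= mulr0 subr0.
have H1 := Hd1 _ _ As Bs; set D := complex.Re _ in H1 *.
(* The one place where be <= 0 matters: z is negative, so the factor does not decay. *)
have ez : 1 <= expR (be * z).
  rewrite -expR0 ler_expR -mulrNN; have [_ /=] := domE K1 wK.
  by move=> z0; rewrite mulr_ge0 // oppr_ge0 // ltW.
have Hgr : `|complex.Re (g * r)| <= mu / 2 * (v2 - v1).
  apply: le_trans (nm_ge_Re _) _; rewrite (nmM g) ng.
  apply: le_trans (ler_wpM2l (ltW n0) Hr) _.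
  by rewrite mulrA [nm _ * _]mulrC divfK // gt_eqF.
move: Hgr; rewrite ler_norml => /andP[Hgr _].
have v0 : 0 <= v2 - v1 by rewrite subr_ge0.
have : mu * (v2 - v1) <= D * expR (be * z) * (v2 - v1).
  apply: ler_wpM2r => //; have : mu * 1 <= D * expR (be * z); last by rewrite mulr1.
  by apply: ler_pM => //; exact: ltW.
lra.
Qed.

(** Along a unit segment Re (g y e^(-al w)) gains at least mu / 2 = |c k|^2 / 4. Both ends are
    within 1/K of c, so the gain is at most 2 |c k| / K, which is smaller once K > 8 / |c k|. *)
Lemma no_steep_class : exists2 K1, 1 <= K1 & forall K w y, K1 <= K -> dom K w -> on w y ->
  ~ inclass K w y.
Proof.
have n0 : 0 < nm (c * k) by rewrite nm_gt0 mulf_neq0.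
have mu0 : 0 < mu by rewrite divr_gt0 // exprn_gt0.
have [d1 d10 Hd1] := near_product c0 k0.
pose K1 := Num.max (Num.max K0 (d1^-1)) (Num.max (2 / tau + 1) (8 / nm (c * k) + 1)).
exists K1; first by rewrite !le_max K01.
move=> K w y KK wK Pwy incl.
have KK0 : K0 <= K by apply: le_trans KK; rewrite !le_max lexx.
have Kd1 : d1^-1 <= K by apply: le_trans KK; rewrite !le_max lexx orbT.
have Kt : 2 / tau + 1 <= K by apply: le_trans KK; rewrite !le_max lexx !orbT.
have Kn : 8 / nm (c * k) + 1 <= K by apply: le_trans KK; rewrite !le_max lexx !orbT.
have K1' : 1 <= K := le_trans K01 KK0.
have Kpos : 0 < K by lra.
have invK (e : R) : 0 < e -> e^-1 < K -> K^-1 < e.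
  by move=> e0 eK; rewrite -[e]invrK ltf_pV2 ?posrE ?invr_gt0.
have Kt' : K^-1 < tau / 2 by apply: invK; rewrite ?divr_gt0 // invf_div; lra.
have Kn' : K^-1 < nm (c * k) / 8 by apply: invK; rewrite ?divr_gt0 // invf_div; lra.
have Kd1' : K^-1 <= d1 by rewrite -[d1]invrK lef_pV2 ?posrE ?invr_gt0.
case: w wK Pwy incl => u th wK Pwy incl.
pose g := (c * k)^*%C * cexp (- (be%:C%C * Complex 0 th)).
have ng : nm g = nm (c * k).
  by rewrite /g (nmM (_^*%C)) nm_conj nm_cexp ReN ReM /= mulr0 mul0r subr0 oppr0 expR0 mulr1.
have domK v : v <= u -> dom K (Complex v th) by move=> vu; exact: le_lt_trans wK.
(* A point of the class over v2 continues to one over v1. Continuation goes towards -oo, so it stays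
   in [dom], and T composes on adjacent segments. *)
pose T v1 v2 := v2 <= u -> forall y2, on (Complex v2 th) y2 -> inclass K (Complex v2 th) y2 ->
  exists y1, [/\ on (Complex v1 th) y1, inclass K (Complex v1 th) y1 &
    mu / 2 * (v2 - v1) <= complex.Re (g * twist al (Complex v2 th) y2) -
      complex.Re (g * twist al (Complex v1 th) y1)].
have : T (u - 1) ((u - 1) + 1 * 2^-1 ^+ 0).
  (* The rectangle has height 0: this is bisection of the interval [u - 1, u]. *)
  apply: (@bisection R (fun m v _ => T v (v + 1 * 2^-1 ^+ m)) (u - 1) 0 1 0) => //.
    move=> m v _; set v' := v + 1 * 2^-1 ^+ m.+1 => T1 T2 _ _; move: T2.
    have -> : v' + 1 * 2^-1 ^+ m.+1 = v + 1 * 2^-1 ^+ m.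
      by rewrite /v' exprS; field.
    set v2 := v + _ => T2 v2u y2 P2 in2.
    have v'2 : v' <= v2.
      rewrite lerD2l !mul1r exprS ler_piMl ?exprn_ge0 ?invr_ge0 //.
      by rewrite invf_le1 // ler1n.
    have [y' [P' in' h']] := T2 v2u y2 P2 in2.
    have [y1 [P1 in1 h1]] := T1 (le_trans v'2 v2u) y' P' in'.
    exists y1; split=> //; lra.
  move=> z t /andP[_ zu] _; rewrite subrK in zu.
  have zK := domK z zu.
  set ws := Complex z th in zK.
  have [d2 d20 Hd2] : exists2 d, 0 < d & forall r, r \in
      sval (closed_field_poly_normal (sp (cexp ws) P)) -> on ws r ->
      forall v1 v2 y1 y2, `|v1 - z| < d -> `|v2 - z| < d ->
        nm (y1 - r) < d -> nm (y2 - r) < d -> v1 <= v2 ->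
        dom K (Complex v1 th) -> dom K (Complex v2 th) ->
        on (Complex v1 th) y1 -> on (Complex v2 th) y2 -> inclass K (Complex v2 th) y2 ->
        inclass K (Complex v1 th) y1 /\
        mu / 2 * (v2 - v1) <= complex.Re (g * twist al (Complex v2 th) y2) -
          complex.Re (g * twist al (Complex v1 th) y1).
    apply: fin_delta => [r d d' dd H ro v1 v2 y1 y2 *|r _].
      by apply: (H ro) => //; apply: lt_le_trans dd.
    have [ro|nro] := pselect (on ws r); last by exists 1.
    have [d d0 H] := ray_step KK0 Kt' Kd1' Hd1 zK ro.
    by exists d.
  have lc0 := lead_reg (dom_mono K01 KK0 zK).
  have [dl dl0 Hdl] := roots_cont d20 lc0.
  have [d3 d30 Hd3] := cts_sdiff (sdiff_cexp 1 ws 0) dl0.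
  exists (Num.min d2 d3); first by rewrite lt_min d20.
  move=> m v t'; set e := 1 * 2^-1 ^+ m; rewrite lt_min => /andP[ed2 ed3] _ /andP[vz zv] _.
  move=> v2u y2 P2 in2.
  have n1 : `|v - z| <= e by rewrite ler_norml; apply/andP; split; lra.
  have n2 : `|v + e - z| <= e by rewrite ler_norml; apply/andP; split; lra.
  have near_s v' : `|v' - z| <= e -> nm (cexp (Complex v' th) - cexp ws) < dl.
    move=> v'e; have := Hd3 (Complex v' th) 0; rewrite !mul1r subrr nm0; apply=> //.
    have -> : Complex v' th - ws = (v' - z)%:C%C.
      by apply/eqP; rewrite eq_complex /= ?subrr !eqxx.
    by rewrite nm_real; exact: le_lt_trans ed3.
  (* y2 is close to a root r over z, and r is close to a root y1 over the left end: this replaces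
     continuation of a branch. *)
  have [r Pr y2r] := (Hdl _ (near_s _ n2)).1 y2 P2.
  have [y1 P1 ry1] := (Hdl _ (near_s _ n1)).2 r Pr.
  have rroot : r \in sval (closed_field_poly_normal (sp (cexp ws) P)).
    case: closed_field_poly_normal => rs /= spE.
    have sp0 : sp (cexp ws) P != 0.
      by apply: contraNneq lc0 => sp0; rewrite lead_coefE -[_.[_]]/(horner_eval _ _) -coef_map
        -/(sp _ P) sp0 coef0.
    have : root (sp (cexp ws) P) r by apply/rootP.
    by rewrite spE rootZ ?lead_coef_eq0 // root_prod_XsubC.
  have ve : v <= v + e by rewrite lerDl /e mul1r exprn_ge0 // invr_ge0.
  have [||||||in1 h] := Hd2 r rroot Pr v (v + e) y1 y2 _ _ _ _ ve _ _ P1 P2 in2.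
  - exact: le_lt_trans ed2.
  - exact: le_lt_trans ed2.
  - by rewrite nm_distC.
  - by [].
  - exact: domK (le_trans ve v2u).
  - exact: domK.
  by exists y1.
rewrite mul1r expr0 subrK => /(_ (lexx _) y Pwy incl)[y1 [P1 [A1 B1] h]].
have [A0 B0] := incl.
have w1K := domK (u - 1) (ltac:(lra)).
have b0 := bnd_small K1' wK; have b1 := bnd_small K1' w1K.
have : complex.Re (g * twist al (Complex u th) y) - complex.Re (g * twist al (Complex (u - 1) th) y1)
    <= nm (c * k) * (2 * K^-1).
  rewrite -ReN -ReD -mulrBr; apply: le_trans (ler_norm _) _; apply: le_trans (nm_ge_Re _) _.
  rewrite (nmM g) ng; apply: ler_wpM2l; first exact: ltW.
  set T2 := twist _ _ y; set T1 := twist _ _ y1.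
  have -> : T2 - T1 = (T2 - c) - (T1 - c) by ring.
  apply: le_trans (nmB _ _) _; move: (le_trans A0 b0) (le_trans A1 b1); rewrite -/T1 -/T2; lra.
have : nm (c * k) * K^-1 < nm (c * k) * (nm (c * k) / 8) by rewrite ltr_pM2l.
move: h; rewrite /mu expr2; lra.
Qed.

End NoSteepClass.
End Rays.

(** * Bounds on the logarithmic derivative *)

Section Tameness.
Variable R : realType.
Local Notation C := R[i].
Implicit Types (w x y z c : C) (P : {poly {poly C}}) (K u : R).

Lemma ev_comp P Q s (y : C) : ev (P \Po Q) s y = ev P s (ev Q s y).
Proof. by rewrite /ev /sp map_comp_poly horner_comp. Qed.

Lemma dom_cexp (rho : R) : 0 < rho -> exists2 K0, 1 <= K0 &
  forall K w, K0 <= K -> dom K w -> 0 < nm (cexp w) < rho.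
Proof.
move=> rho0; have [K0 H] := expR_small rho0 ltr01.
exists (Num.max 1 K0); first by rewrite le_max lexx.
move=> K w KK wK; rewrite nm_gt0 cexp_neq0 nm_cexp /=.
have := H K w _ _ wK; rewrite mul1r; apply; apply: le_trans KK; by rewrite le_max lexx ?orbT.
Qed.

(** Once slopes be <= 0 are excluded, q - alpha is 0 or at most (|k| + 1) e^(be u) with be > 0. As
    alpha is real, this bounds Im q as well as q. *)
Lemma logder_tame P : reduced_poly P -> exists2 K0, 1 <= K0 & forall w, dom K0 w ->
  (lead_coef P).[cexp w] != 0 /\
  forall y, ev P (cexp w) y = 0 -> [/\ y != 0, ev P^`() (cexp w) y != 0,
    nm (logder P (cexp w) y) <= K0 &
    `|complex.Im (logder P (cexp w) y)| <= bnd K0 (complex.Re w)].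
Proof.
move=> gP; have [r r0 reg] := reduced_regular gP.
have [m [chi [r' [m0 chi0 r'0 alg]]]] := logder_algebraic gP.
have [Ks Ks1 HKs] := dom_cexp r0; have [Ks' Ks'1 HKs'] := dom_cexp r'0.
have P0 : P != 0 by case: gP.
have [Ly [Ky [ty [Ky1 ty0 Ly0 HLy]]]] := newton_classes P0.
(* An equation for q - al, since chi annihilates m q; it is nonzero because the substituted
   polynomial has degree 1. *)
pose shift (al : R) := chi \Po (m%:P * 'X + (m * (al%:C%C)%:P)%:P).
have shift0 al : shift al != 0.
  by rewrite comp_poly2_eq0 // size_MXaddC polyC_eq0 (negbTE m0) size_polyC m0.
have ev_shift al s x : ev (shift al) s x = ev chi s (m.[s] * (x + al%:C%C)).
  by rewrite ev_comp; congr (ev chi s _); rewrite evD evM !evC evX hornerM hornerC mulrDr.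
have /choice[/= Lx HLx] := fun al => newton_classes (shift0 al).
have /choice[/= Kx {}HLx] := HLx; have /choice[/= tx {}HLx] := HLx.
have [||K1 [K11 HK1]] := @fin_large R _ Ly (fun p T => `|p.1| <= T /\ Kx p.1 <= T).
- by move=> p K K' _ KK [h1 h2]; split; exact: le_trans KK.
- move=> p _; exists (Num.max (Num.max 1 `|p.1|) (Kx p.1)).
  by rewrite !le_max !lexx !orbT.
pose K2 := Num.max (Num.max Ks Ks') (Num.max Ky K1).
have [K2s K2s'] : Ks <= K2 /\ Ks' <= K2 by rewrite !le_max !lexx !orbT.
have [K2y K21] : Ky <= K2 /\ K1 <= K2 by rewrite !le_max !lexx !orbT.
have K2_1 : 1 <= K2 by apply: le_trans K21.
have on_x K w y al : K2 <= K -> dom K w -> ev P (cexp w) y = 0 ->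
    ev (shift al) (cexp w) (logder P (cexp w) y - al%:C%C) = 0.
  by move=> KK wK Py; rewrite ev_shift subrK; apply: alg => //; exact: HKs' (le_trans K2s' KK) wK.
pose pairs := [seq (p, q) | p <- Ly, q <- Lx p.1].
(* For be <= 0 the pair of classes is empty beyond T; for be > 0, T dominates the constants and the
   inverse exponent of the resulting estimates. *)
pose S (pq : (R * C) * (R * C)) T :=
  (pq.2.1 <= 0 -> forall K w y, T <= K -> dom K w -> ev P (cexp w) y = 0 ->
    nm (twist pq.1.1 w y - pq.1.2) <= bnd K (complex.Re w) ->
    nm (twist pq.2.1 w (logder P (cexp w) y - pq.1.1%:C%C) - pq.2.2) <= bnd K (complex.Re w) -> False)
  /\ (0 < pq.2.1 -> `|pq.1.1| + nm pq.2.2 + 1 <= T /\ pq.2.1^-1 <= T).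
have [||K3 [K31 HK3]] := @fin_large R _ pairs S.
- move=> pq K K' _ KK [h1 h2]; split.
    by move=> b0 L w y KL; apply: h1 => //; exact: le_trans KK KL.
  by move=> b0; have [h3 h4] := h2 b0; split; exact: le_trans KK.
- move=> _ /allpairsPdep[[al c] [[be k] [pL qL ->]]]; rewrite /S /=.
  have [b0|b0] := leP be 0; last first.
    exists (Num.max (`|al| + nm k + 1) be^-1); rewrite !le_max !lexx !orbT /=; split=> //.
    by apply/orP; left; have := nm_ge0 k; have := normr_ge0 al; lra.
  have [_ tx0 Lx0 Hx] := HLx al.
  have t0 : 0 < Num.min ty (tx al) by rewrite lt_min ty0.
  have [||||K4 K41 H] := no_steep_class (Ly0 _ pL) (Lx0 _ qL) b0 t0 K2_1 (P := P) (al := al).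
  - by move=> w wK; have [] := reg _ (HKs _ _ K2s wK).
  - by move=> w y wK; have [_] := reg _ (HKs _ _ K2s wK); apply.
  - move=> K w y KK wK Py; have [_ h] := HLy K w y (le_trans K2y KK) wK Py.
    have [h1|h1] := h _ pL; [by left | right; apply: le_trans h1].
    by rewrite ge_min lexx.
  - move=> K w y KK wK Py; have [_ Kx1] := HK1 _ pL.
    have [_ h] := Hx K w _ (le_trans Kx1 (le_trans K21 KK)) wK (on_x K w y al KK wK Py).
    have [h1|h1] := h _ qL; [by left | right; apply: le_trans h1].
    by rewrite ge_min lexx orbT.
  exists K4; split=> //; split=> // _ K w y KK wK Py h1 h2.
  exact: (H K w y KK wK Py).
pose K0 := Num.max K2 K3; have K20 : K2 <= K0 by rewrite le_max lexx.
have K30 : K3 <= K0 by rewrite le_max lexx orbT.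
exists K0; first exact: le_trans K20.
have K01 : 1 <= K0 := le_trans K2_1 K20.
move=> w wK; have [lc reg_w] := reg _ (HKs _ _ (le_trans K2s K20) wK); split=> // y Py.
have [y0 Py0] := reg_w y Py.
have [[y00|[p pL py]] _] := HLy K0 w y (le_trans K2y K20) wK Py; first by rewrite y00 eqxx in y0.
have [p1K Kx1] := HK1 _ pL; have [_ tx0 Lx0 Hx] := HLx p.1.
have [xP _] := Hx K0 w _ (le_trans Kx1 (le_trans K21 K20)) wK (on_x K0 w y p.1 K20 wK Py).
move: xP; set q := logder _ _ _ => xP.
have [wK0 w0] := domE K01 wK.
suff [h1 h2] : nm q <= K0 /\ `|complex.Im q| <= bnd K0 (complex.Re w) by split.
have qI : complex.Im q = complex.Im (q - p.1%:C%C) by rewrite ImD ImN /= subr0.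
case: xP => [x0|[[be k] qL xq]].
  rewrite qI x0 normr0 bnd_ge0 //; split=> //.
  have -> : q = p.1%:C%C by apply/eqP; rewrite -subr_eq0 x0.
  by rewrite nm_real; apply: le_trans p1K (le_trans K21 K20).
have pq : (p, (be, k)) \in pairs by apply/allpairsPdep; exists p, (be, k).
have [bad ok] := HK3 _ pq.
have [b0|b0] := leP be 0.
  by case: (bad b0 K0 w y K30 wK Py py xq).
have [/= T1 T2] := ok b0; set x := q - _ in qI xq.
have zb : nm (twist be w x) <= nm k + 1.
  have := nmD (twist be w x - k) k; rewrite subrK => h.
  have := le_trans xq (bnd_small K01 wK).
  have : K0^-1 <= 1 by rewrite invf_le1 //; lra.
  lra.
have xE : nm x = nm (twist be w x) * expR (be * complex.Re w).
  rewrite /twist nmM nm_cexp ReN ReM /= mul0r subr0 expRN divfK //.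
  by rewrite gt_eqF ?expR_gt0.
have xb : nm x <= (nm k + 1) * expR (be * complex.Re w) by rewrite xE ler_wpM2r ?expR_ge0.
have e1 : expR (be * complex.Re w) <= 1.
  by rewrite -expR0 ler_expR nmulr_lle0 // ltW.
have k0 := nm_ge0 k.
split.
  have -> : q = x + p.1%:C%C by rewrite subrK.
  apply: le_trans (nmD _ _) _; rewrite nm_real.
  have : nm x <= (nm k + 1) * 1 by apply: le_trans xb _; rewrite ler_wpM2l //; lra.
  lra.
rewrite qI; apply: le_trans (nm_ge_Im _) _; apply: le_trans xb _.
apply: ler_pM; rewrite ?expR_ge0 //; try lra.
  by have := normr_ge0 p.1; lra.
rewrite ler_expR mulrC; apply: ler_wnM2l; first exact: ltW.
by rewrite -[be]invrK lef_pV2 ?posrE ?invr_gt0 //; lra.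
Qed.

End Tameness.

(** * Area near a puncture *)

Section LipschitzBoxes.
Variables (R : realType) (n : nat).
Implicit Types (F : R -> R -> set ('I_n -> R)).

(** F is multivalued, but near each parameter it splits into #|I| Lipschitz pieces. A box of scale
    2^-m costs #|I| (G 2^-m)^2, and four quarters cost exactly as much as their union. *)
Lemma cov_box F (I : finType) (a b h k L1 L2 : R) :
  0 <= h -> 0 <= k -> 0 <= L1 -> 0 <= L2 ->
  (forall u t, a <= u <= a + h -> b <= t <= b + k -> exists2 d, 0 < d &
     exists V : I -> R -> R -> set ('I_n -> R),
       (forall u1 t1 x, `|u1 - u| < d -> `|t1 - t| < d -> F u1 t1 x -> exists i, V i u1 t1 x) /\
       (forall i u1 t1 x1 u2 t2 x2, V i u1 t1 x1 -> V i u2 t2 x2 ->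
          euclidean_dist x1 x2 <= L1 * `|u1 - u2| + L2 * `|t1 - t2|)) ->
  forall delta, 0 < delta -> cov delta (#|I|%:R * (L1 * h + L2 * k) ^+ 2)
    [set x | exists u t, [/\ a <= u <= a + h, b <= t <= b + k & F u t x]].
Proof.
move=> h0 k0 L10 L20 loc delta delta0.
pose G := L1 * h + L2 * k.
pose box m x y := [set z | exists u t, [/\ x <= u <= x + h * 2^-1 ^+ m,
  y <= t <= y + k * 2^-1 ^+ m & F u t z]].
pose Q m x y := cov delta (#|I|%:R * (G * 2^-1 ^+ m) ^+ 2) (box m x y).
have p0 m : 0 <= 2^-1 ^+ m :> R by rewrite exprn_ge0 // invr_ge0.
have : Q 0 a b.
  apply: (@bisection R Q a b h k h0 k0).
    move=> m x y Q1 Q2 Q3 Q4.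
    apply: cov_sub (covU (ltW delta0) (covU (ltW delta0) Q1 Q2) (covU (ltW delta0) Q3 Q4)).
      move=> z [u [t [/andP[u1 u2] /andP[t1 t2] Fz]]].
      have half (c x' : R) : x' + c * 2^-1 ^+ m.+1 + c * 2^-1 ^+ m.+1 = x' + c * 2^-1 ^+ m.
        by rewrite exprS; field.
      have [ul|ul] := leP u (x + h * 2^-1 ^+ m.+1);
      have [tl|tl] := leP t (y + k * 2^-1 ^+ m.+1).
      - by left; left; exists u, t; rewrite u1 ul t1 tl.
      - by right; left; exists u, t; rewrite u1 ul (ltW tl) half t2.
      - by left; right; exists u, t; rewrite (ltW ul) half u2 t1 tl.
      - by right; right; exists u, t; rewrite (ltW ul) half u2 (ltW tl) half t2.
    by rewrite [2^-1 ^+ m.+1]exprS; set e := 2^-1 ^+ m; rewrite le_eqVlt; apply/orP; left; apply/eqP; field.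
  move=> u t uP tP; have [d d0 [V [VF VL]]] := loc u t uP tP.
  have D0 : 0 < L1 + L2 + 1 by lra.
  exists (Num.min d (delta / (L1 + L2 + 1))); first by rewrite lt_min d0 divr_gt0.
  move=> m x y; rewrite !lt_min => /andP[hd hD] /andP[kd kD] /andP[x1 x2] /andP[y1 y2].
  have e0 := p0 m; set e := 2^-1 ^+ m in e0 hd hD kd kD x2 y2 *.
  have Ge : G * e = L1 * (h * e) + L2 * (k * e) by rewrite /G; ring.
  have he0 : 0 <= h * e by rewrite mulr_ge0.
  have ke0 : 0 <= k * e by rewrite mulr_ge0.
  apply: (@cov_sub _ _ _ _ (#|I|%:R * (G * e) ^+ 2) _ (\bigcup_i
    [set z | exists u1 t1, [/\ x <= u1 <= x + h * e, y <= t1 <= y + k * e & V i u1 t1 z]])) => //.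
    move=> z [u1 [t1 [/andP[u11 u12] /andP[t11 t12] Fz]]].
    rewrite -/e in u12 t12; have [||i Vz] := VF u1 t1 z _ _ Fz.
    - by apply: le_lt_trans hd; rewrite ler_norml; apply/andP; split; lra.
    - by apply: le_lt_trans kd; rewrite ler_norml; apply/andP; split; lra.
    by exists i => //; exists u1, t1; rewrite u11 u12 t11 t12.
  apply: cov_finite => [|i]; first exact: ltW.
  apply: cov_diamle.
    rewrite Ge addr_ge0 ?mulr_ge0 //=.
    have : L1 * (h * e) <= L1 * (delta / (L1 + L2 + 1)) by rewrite ler_wpM2l // ltW.
    have : L2 * (k * e) <= L2 * (delta / (L1 + L2 + 1)) by rewrite ler_wpM2l // ltW.
    have : (L1 + L2 + 1) * (delta / (L1 + L2 + 1)) = delta by field; rewrite gt_eqF.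
    have : 0 < delta / (L1 + L2 + 1) by rewrite divr_gt0.
    lra.
  move=> z1 z2 [u1 [t1 [/andP[? ?] /andP[? ?] V1]]] [u2 [t2 [/andP[? ?] /andP[? ?] V2]]].
  apply: le_trans (VL _ _ _ _ _ _ _ V1 V2) _; rewrite Ge.
  by apply: lerD; apply: ler_wpM2l => //; rewrite ler_norml; apply/andP; split; lra.
rewrite /Q expr0 mulr1; apply: cov_sub => // z [u [t [uP tP Fz]]].
by exists u, t; rewrite !expr0 !mulr1.
Qed.

Lemma euclidean_dist_le (x y : 'I_n -> R) (e : R) :
  (forall i, `|x i - y i| <= e) -> euclidean_dist x y <= n%:R * e.
Proof.
move=> H; have [n0|n0] := posnP n.
  rewrite /euclidean_dist big1 ?sqrtr0 ?n0 ?mul0r // => i _.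
  by case: i => j jn; exfalso; move: jn; rewrite n0.
have e0 : 0 <= e by apply: le_trans (H (Ordinal n0)).
rewrite -(ger0_norm (_ : 0 <= n%:R * e)) ?mulr_ge0 // -sqrtr_sqr ler_sqrt ?sqr_ge0 //.
apply: (@le_trans _ _ (\sum_(i < n) e ^+ 2)).
  apply: ler_sum => i _; rewrite -(real_normK (num_real _)).
  by apply: lerXn2r; rewrite ?nnegrE.
rewrite sumr_const card_ord exprMn -[e ^+ 2 *+ n]mulr_natl ler_wpM2r ?sqr_ge0 //.
by rewrite -natrX ler_nat -{1}(expn1 n) leq_pexp2l.
Qed.

End LipschitzBoxes.

Section LocalArea.
Variable R : realType.
Local Notation C := R[i].
Implicit Types (w x y z c : C).

(** log |y| has differential Re (q dw) = Re q du - Im q d theta. The two directions keep separate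
    constants because only Im q decays. *)
Lemma curve_ln (P : {poly {poly C}}) w y : y != 0 -> ev P^`() (cexp w) y != 0 ->
  forall eta, 0 < eta -> exists2 delta, 0 < delta & forall w1 y1 w2 y2,
    nm (w1 - w) < delta -> nm (y1 - y) < delta ->
    nm (w2 - w) < delta -> nm (y2 - y) < delta ->
    ev P (cexp w1) y1 = 0 -> ev P (cexp w2) y2 = 0 ->
    `|ln (nm y2) - ln (nm y1)| <=
       (nm (logder P (cexp w) y) + eta) * `|complex.Re w2 - complex.Re w1| +
       (`|complex.Im (logder P (cexp w) y)| + eta) * `|complex.Im w2 - complex.Im w1|.
Proof.
move=> y0 Py0 eta eta0; have ny : 0 < nm y by rewrite nm_gt0.
pose q' := - (cexp w * ev (dbase P) (cexp w) y) / ev P^`() (cexp w) y.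
pose q := logder P (cexp w) y; have qE : q = q' / y by [].
pose e1 := Num.min 1 (eta * nm y / 2).
have e10 : 0 < e1 by rewrite lt_min ltr01 divr_gt0 // mulr_gt0.
have e11 : e1 <= 1 by rewrite ge_min lexx.
have e1E : e1 / nm y <= eta / 2.
  rewrite ler_pdivrMr //; have : e1 <= eta * nm y / 2 by rewrite ge_min lexx orbT.
  lra.
have q'0 := nm_ge0 q'.
pose e2 := eta / (2 * (nm q' + 1)).
have D0 : 0 < 2 * (nm q' + 1) by lra.
have e20 : 0 < e2 by rewrite divr_gt0.
have e2E : e2 * (nm q' + 1) = eta / 2 by rewrite /e2; field; lra.
have [d1 d10 H1] := curve_sdiff (sdiff_snd w y) Py0 e10.
have [d2 d20 H2] := ln_nm_sdiff y0 e20.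
exists (Num.min d1 d2); first by rewrite lt_min d10.
move=> w1 y1 w2 y2; rewrite !lt_min => /andP[w1d _] /andP[y1d1 y1d2] /andP[w2d _] /andP[y2d1 y2d2] P1 P2.
have := H1 w1 y1 w2 y2 w1d y1d1 w2d y2d1 P1 P2; rewrite -/q' add0r mul1r.
have := H2 y1 y2 y1d2 y2d2; rewrite -/q.
set W := w2 - w1; set Y := y2 - y1; set D := ln _ - ln _ => A2 A1.
have WE : nm W <= `|complex.Re w2 - complex.Re w1| + `|complex.Im w2 - complex.Im w1|.
  by apply: le_trans (nm_le_ReIm _) _; rewrite ReD ImD ReN ImN.
have W0 := nm_ge0 W.
have YW : nm Y <= (nm q' + 1) * nm W.
  have := nmD (Y - q' * W) (q' * W); rewrite subrK (nmM q') => h.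
  have : e1 * nm W <= 1 * nm W by rewrite ler_wpM2r.
  lra.
have A3 : nm (Y / y - q * W) <= eta / 2 * nm W.
  have -> : Y / y - q * W = (Y - q' * W) / y by rewrite qE; field.
  rewrite nmM nmV; apply: (@le_trans _ _ (e1 * nm W / nm y)).
    by rewrite ler_wpM2r // invr_ge0 nm_ge0.
  by rewrite mulrAC ler_wpM2r.
have A4 := nm_ge_Re (Y / y - q * W).
have A5 : e2 * nm Y <= eta / 2 * nm W.
  by rewrite -e2E -mulrA ler_wpM2l // ltW.
have A6 : `|complex.Re (q * W)| <= nm q * `|complex.Re w2 - complex.Re w1| +
    `|complex.Im q| * `|complex.Im w2 - complex.Im w1|.
  rewrite ReM ReD ImD ReN ImN; apply: le_trans (ler_normB _ _) _; rewrite !normrM.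
  by rewrite lerD2r ler_wpM2r // nm_ge_Re.
have -> : D = (D - complex.Re (Y / y)) + (complex.Re (Y / y - q * W) + complex.Re (q * W)).
  by rewrite [complex.Re (Y / y - _)]ReD ReN; ring.
apply: le_trans (ler_normD _ _) _; apply: le_trans (lerD (lexx _) (ler_normD _ _)) _.
have : eta * nm W <= eta * (`|complex.Re w2 - complex.Re w1| + `|complex.Im w2 - complex.Im w1|).
  by rewrite ler_wpM2l // ltW.
lra.
Qed.

Section Tuples.
Variables (n : nat) (P : 'I_n -> {poly {poly C}}).

(** The coordinates range independently over the roots of their fibres, so a sheet may contain more
    points than the curve has over the same s. *)
Definition sheet (u t : R) : set ('I_n -> R) :=
  [set Log z | z in [set z | forall i, ev (P i) (cexp (Complex u t)) (z i) = 0]].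

Let D := (\max_(i < n) size (P i)).+1.

(** A Lipschitz piece is given by one root over w per coordinate, encoded by its index below [D].
    Taking eta = r in [curve_ln] yields the constants K + r and r + r. *)
Lemma sheet_cover (a h K r : R) : 0 <= h -> 0 < r -> 1 <= K ->
  (forall u t, a <= u <= a + h -> forall i,
     (lead_coef (P i)).[cexp (Complex u t)] != 0 /\
     forall y, ev (P i) (cexp (Complex u t)) y = 0 ->
       [/\ y != 0, ev (P i)^`() (cexp (Complex u t)) y != 0,
         nm (logder (P i) (cexp (Complex u t)) y) <= K &
         `|complex.Im (logder (P i) (cexp (Complex u t)) y)| <= r]) ->
  forall delta, 0 < delta ->
  cov delta (#|{: {ffun 'I_n -> 'I_D}}|%:R * (n%:R * (K + r) * h + n%:R * (r + r) * (2 * pi)) ^+ 2)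
    [set x | exists u t, [/\ a <= u <= a + h, 0 <= t <= 0 + 2 * pi & sheet u t x]].
Proof.
move=> h0 r0 K1 reg; have pi0 := pi_ge0 R.
apply: cov_box => //; rewrite ?mulr_ge0 //; [lra | lra |].
move=> u t uP _; set w := Complex u t.
have regw i := reg u t uP i.
pose rs i : seq C := sval (closed_field_poly_normal (sp (cexp w) (P i))).
have rsP i y : ev (P i) (cexp w) y = 0 -> exists j : 'I_D, nth 0 (rs i) j = y /\ y \in rs i.
  move=> Py; have lc := (regw i).1; rewrite /rs; case: closed_field_poly_normal => s /= spE.
  have sp0 : sp (cexp w) (P i) != 0.
    by apply: contraNneq lc => sp0; rewrite lead_coefE -[_.[_]]/(horner_eval _ _) -coef_map
        -/(sp _ _) sp0 coef0.
  have ys : y \in s.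
    have : root (sp (cexp w) (P i)) y by apply/rootP.
    by rewrite spE rootZ ?lead_coef_eq0 // root_prod_XsubC.
  have sD : (size s < D)%N.
    have : size (sp (cexp w) (P i)) = (size s).+1.
      by rewrite spE size_scale ?lead_coef_eq0 // size_prod_XsubC.
    rewrite ltnS => e; apply: leq_trans (leq_bigmax i); rewrite ltnW // -e; exact: size_poly.
  have yD : (index y s < D)%N by apply: leq_trans sD; rewrite ltnS ltnW // index_mem.
  by exists (Ordinal yD); rewrite /= nth_index.
have [d1 d10 H1] : exists2 d, 0 < d & forall i, i \in enum 'I_n ->
    forall y, y \in rs i -> ev (P i) (cexp w) y = 0 -> forall w1 y1 w2 y2,
    nm (w1 - w) < d -> nm (y1 - y) < d -> nm (w2 - w) < d -> nm (y2 - y) < d ->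
    ev (P i) (cexp w1) y1 = 0 -> ev (P i) (cexp w2) y2 = 0 ->
    `|ln (nm y2) - ln (nm y1)| <= (K + r) * `|complex.Re w2 - complex.Re w1| +
       (r + r) * `|complex.Im w2 - complex.Im w1|.
  apply: fin_delta => [i d d' dd H y ys Py w1 y1 w2 y2 *|i _].
    by apply: (H y) => //; apply: lt_le_trans dd.
  apply: fin_delta => [y d d' dd H Py w1 y1 w2 y2 *|y _].
    by apply: H => //; apply: lt_le_trans dd.
  have [Py|nPy] := pselect (ev (P i) (cexp w) y = 0); last by exists 1.
  have [y0 Py0 qK qr] := (regw i).2 y Py.
  have [d d0 H] := curve_ln y0 Py0 r0; exists d => // _ w1 y1 w2 y2 h1 h2 h3 h4 P1 P2.
  apply: le_trans (H w1 y1 w2 y2 h1 h2 h3 h4 P1 P2) _.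
  by apply: lerD; rewrite ler_wpM2r // lerD2r.
have [dl dl0 Hdl] : exists2 d, 0 < d & forall i, i \in enum 'I_n ->
    forall s, nm (s - cexp w) < d -> forall y, ev (P i) s y = 0 ->
    exists2 z, ev (P i) (cexp w) z = 0 & nm (y - z) < d1.
  apply: fin_delta => [i d d' dd H s sd|i _]; first by apply: H; exact: lt_le_trans dd.
  have [d d0 H] := roots_cont d10 (regw i).1.
  by exists d => // s sd; exact: (H s sd).1.
have [d3 d30 H3] := cts_sdiff (sdiff_cexp 1 w 0) dl0.
(* Halved because the modulus is bounded by the sum of the deviations in u and in t. *)
pose d := Num.min d1 d3 / 2.
have d0 : 0 < d by rewrite divr_gt0 // lt_min d10.
have near_w u1 t1 : `|u1 - u| < d -> `|t1 - t| < d ->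
    nm (Complex u1 t1 - w) < d1 /\ nm (Complex u1 t1 - w) < d3.
  move=> hu ht; apply/andP; rewrite -lt_min.
  apply: le_lt_trans (nm_le_ReIm _) _; rewrite /=.
  have : Num.min d1 d3 = d + d by rewrite /d -splitr.
  lra.
exists d => //.
exists (fun (f : {ffun 'I_n -> 'I_D}) u1 t1 (x : 'I_n -> R) => [/\ `|u1 - u| < d, `|t1 - t| < d &
  exists2 z : 'I_n -> C, x = Log z & forall i, [/\ ev (P i) (cexp (Complex u1 t1)) (z i) = 0,
    nm (z i - nth 0 (rs i) (f i)) < d1, nth 0 (rs i) (f i) \in rs i &
    ev (P i) (cexp w) (nth 0 (rs i) (f i)) = 0]]); split.
  move=> u1 t1 x hu ht [z Hz <-]; have [_ nw3] := near_w _ _ hu ht.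
  have sd : nm (cexp (Complex u1 t1) - cexp w) < dl.
    have := H3 (Complex u1 t1) 0; rewrite !mul1r subrr nm0; exact.
  have /choice[f Hf] : forall i, exists j : 'I_D, [/\ nm (z i - nth 0 (rs i) j) < d1,
      nth 0 (rs i) j \in rs i & ev (P i) (cexp w) (nth 0 (rs i) j) = 0].
    move=> i; have [y Py zy] := Hdl i (mem_enum _ i) _ sd (z i) (Hz i).
    by have [j [jy yr]] := rsP i y Py; exists j; rewrite jy.
  exists [ffun i => f i]; split=> //; exists z => // i; rewrite ffunE.
  by have [] := Hf i; split.
move=> f u1 t1 x1 u2 t2 x2 [hu1 ht1 [z1 -> Hz1]] [hu2 ht2 [z2 -> Hz2]].
have [nw1 _] := near_w _ _ hu1 ht1; have [nw2 _] := near_w _ _ hu2 ht2.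
rewrite -!mulrA -mulrDr; apply: euclidean_dist_le => i.
have [P1 n1 rin Pr] := Hz1 i; have [P2 n2 _ _] := Hz2 i.
by have /= := H1 i (mem_enum _ i) _ rin Pr _ _ _ _ nw2 n2 nw1 n1 P2 P1.
Qed.

End Tuples.
End LocalArea.

Section LocalFiniteness.
Variable R : realType.
Local Notation C := R[i].
Implicit Types (w y c s : C).

Lemma sum_half N : \sum_(j < N) 2^-1 ^+ j <= 2 :> R.
Proof.
suff -> : \sum_(j < N) 2^-1 ^+ j = 2 - 2 * 2^-1 ^+ N :> R.
  by rewrite gerBl mulr_ge0 // exprn_ge0 // invr_ge0.
elim: N => [|N IH]; first by rewrite big_ord0 expr0; ring.
by rewrite big_ord_recr /= IH exprS; field.
Qed.

(* Cut the half strip Re w <= v, 0 <= Im w <= 2 pi into rows on which the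
   angular Lipschitz constant is 2^-j, and row j into 2^j boxes. *)
Lemma local_area_reduced n (P : 'I_n -> {poly {poly C}}) : (forall i, reduced_poly (P i)) ->
  exists2 rho, 0 < rho & finarea
    [set Log z | z in [set z | exists2 s, 0 < nm s < rho & forall i, ev (P i) s (z i) = 0]].
Proof.
move=> gP.
pose S (i : 'I_n) K := forall w, dom K w -> (lead_coef (P i)).[cexp w] != 0 /\
  forall y, ev (P i) (cexp w) y = 0 -> [/\ y != 0, ev (P i)^`() (cexp w) y != 0,
    nm (logder (P i) (cexp w) y) <= K &
    `|complex.Im (logder (P i) (cexp w) y)| <= bnd K (complex.Re w)].
have [||K [K1 HK]] := @fin_large R _ (enum 'I_n) S.
- move=> i K K' K1 KK H w wK; have [lc h] := H w (dom_mono K1 KK wK); split=> // y Py.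
  have [y0 Py0 h1 h2] := h y Py; split=> //; first exact: le_trans KK.
  apply: le_trans h2 _; apply: bnd_mono => //; apply/ltW.
  by have [] := domE (le_trans K1 KK) wK.
- by move=> i _; have [K0 K01 H] := logder_tame (gP i); exists K0.
have {}HK i : S i K by apply: HK; rewrite mem_enum.
have K0 : 0 < K by lra.
have K10 : 0 <= K + 1 by lra.
(* Moving down by H halves e^(u / K), and the angular bound at v is at most 1; so it is at most 2^-j
   on row j. *)
pose v := - K ^+ 3 - 1; pose H := K * ln 2.
have H0 : 0 < H by rewrite mulr_gt0 // ln_gt0 // ltr1n.
have vK t : dom K (Complex v t) by rewrite /dom /= /v; lra.
pose D := (\max_(i < n) size (P i)).+1.
pose N := #|{: {ffun 'I_n -> 'I_D}}|%:R : R.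
(* On row j a box has width H 2^-j and angular constant 2 * 2^-j over an angle 2 pi, so its
   Lipschitz extent is at most G 2^-j. *)
pose G := n%:R * (K + 1) * H + 4 * n%:R * pi.
pose h j := H * 2^-1 ^+ j.
have p0 j : 0 < 2^-1 ^+ j :> R by rewrite exprn_gt0 // invr_gt0.
have p1 j : 2^-1 ^+ j <= 1 :> R by rewrite exprn_ile1 // ?invr_ge0 // invf_le1 // ler1n.
(* Boxes are counted downwards from the top of the row, and this is the lower end; hence i.+1. *)
pose a j i : R := v - j%:R * H - i.+1%:R * h j.
pose B j (i : 'I_(2 ^ j)) := [set x | exists u t,
  [/\ a j i <= u <= a j i + h j, 0 <= t <= 0 + 2 * pi & sheet P u t x]].
have h0 j : 0 < h j by rewrite mulr_gt0.
exists (expR v); first exact: expR_gt0.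
exists (2 * (N * G ^+ 2)) => delta delta0.
have G0 : 0 <= G.
  by apply: addr_ge0; apply: mulr_ge0; rewrite ?pi_ge0 ?(ltW H0) // mulr_ge0.
have covB j (i : 'I_(2 ^ j)) : cov delta (N * (G * 2^-1 ^+ j) ^+ 2) (B j i).
  have ubox u t : a j i <= u <= a j i + h j -> u <= v - j%:R * H /\ dom K (Complex u t).
    move=> /andP[_]; rewrite /a -natr1 mulrDl mul1r => hu.
    have uv : u <= v - j%:R * H.
      have : 0 <= i%:R * h j by rewrite mulr_ge0 // ltW.
      lra.
    split=> //; apply: le_lt_trans (vK 0); apply: le_trans uv _.
    by rewrite /= gerBl mulr_ge0 // ltW.
  apply: cov_sub (@sheet_cover R n P (a j i) (h j) K (2^-1 ^+ j) (ltW (h0 j)) (p0 j) K1 _ delta delta0) => //.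
    rewrite ler_wpM2l //; apply: lerXn2r; rewrite ?nnegrE ?mulr_ge0 ?(ltW (p0 j)) //.
      apply: addr_ge0; apply: mulr_ge0; rewrite ?(ltW (h0 j)) //; apply: mulr_ge0;
        by rewrite ?pi_ge0 ?addr_ge0 ?(ltW (p0 j)) ?(ltW K0).
    have : n%:R * (K + 2^-1 ^+ j) * h j <= n%:R * (K + 1) * h j.
      by rewrite ler_wpM2r ?(ltW (h0 j)) // ler_wpM2l // lerD2l.
    rewrite /G /h; lra.
  move=> u t uP i0; have [uv uK] := ubox u t uP; have [lc hy] := HK i0 _ uK.
  split=> // y Py; have [y0 Py0 q1 q2] := hy y Py; split=> //.
  apply: le_trans q2 _; rewrite /bnd /=.
  have uE : expR (u / K) <= expR (v / K) * 2^-1 ^+ j.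
    have -> : 2^-1 ^+ j = expR (- (j%:R * ln 2)) :> R.
      by rewrite expRN expRM_natl lnK ?posrE // exprVn.
    rewrite -expRD ler_expR ler_pdivrMr // mulrDl divfK ?gt_eqF //.
    by apply: le_trans uv _; rewrite /H; lra.
  have bv := bnd_small K1 (vK 0); rewrite /bnd /= in bv.
  have Kinv : K^-1 <= 1 by rewrite invf_le1.
  apply: le_trans (ler_wpM2l (ltW K0) uE) _; rewrite mulrA ler_piMl ?(ltW (p0 j)) //.
  exact: le_trans bv Kinv.
(* 2^j boxes of cost N G^2 4^-j each: the costs of the rows form a geometric series. *)
have covrow j : cov delta (N * G ^+ 2 * 2^-1 ^+ j) (\bigcup_i B j i).
  have := cov_finite (ltW delta0) (covB j); rewrite card_ord; apply: cov_sub => //.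
  rewrite natrX.
  have : 2 ^+ j * 2^-1 ^+ j = 1 :> R by rewrite -exprMn divff // expr1n.
  set e := 2^-1 ^+ j; set f := 2 ^+ j => fe.
  have -> : f * (N * (G * e) ^+ 2) = (f * e) * (N * G ^+ 2 * e) by ring.
  by rewrite fe mul1r.
apply: cov_sub (cov_bigcup (ltW delta0) covrow _) => //; last first.
  move=> M; rewrite -mulr_sumr mulrC ler_wpM2r ?sum_half //.
  by rewrite mulr_ge0 ?sqr_ge0.
move=> _ [z [s /andP[s0 sr] Hz] <-].
have s00 : s != 0 by rewrite -nm_gt0.
have [[u t] /= [ws tP uE]] := cexp_surj s00.
have uv : u < v by rewrite uE -[v]expRK ltr_ln ?posrE ?expR_gt0.
(* The integer part of X is the row of u; the fractional part, scaled by 2^j, gives the box. *)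
pose X := (v - u) / H; have X0 : 0 <= X by rewrite divr_ge0 ?subr_ge0 ?ltW.
have /andP[j1 j2] := truncn_itv X0; set j := Num.truncn X in j1 j2.
have XE : v - u = X * H by rewrite /X divfK // gt_eqF.
pose Y := (X - j%:R) * 2 ^+ j.
have Y0 : 0 <= Y by rewrite mulr_ge0 ?subr_ge0 // exprn_ge0.
have /andP[i1 i2] := truncn_itv Y0; set i := Num.truncn Y in i1 i2.
have Yb : Y < 2 ^+ j.
  by rewrite -[ltRHS]mul1r ltr_pM2r ?exprn_gt0 //; move: j2; rewrite -natr1; lra.
have ij : (i < 2 ^ j)%N.
  by rewrite -(ltr_nat R) natrX; exact: le_lt_trans Yb.
exists j => //; exists (Ordinal ij) => //; exists u, t; split; last first.
- by exists z; rewrite ?ws.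
- by rewrite add0r.
have YE : (X - j%:R) * H = Y * h j.
  by rewrite /Y /h mulrACA -exprMn divff // expr1n mulr1.
have ih1 : i%:R * h j <= Y * h j by rewrite ler_wpM2r // ltW.
have ih2 : Y * h j <= i.+1%:R * h j by rewrite ler_wpM2r // ltW.
rewrite /a /=; move: ih1 ih2; rewrite -natr1 mulrDl mul1r -YE mulrBl => ih1 ih2.
move: XE ih1 ih2; move: (X * H) (j%:R * H) (i%:R * h j) (h j) => e1 e2 e3 e4; clear.
by move=> *; apply/andP; split; lra.
Qed.

Lemma local_area n (P : 'I_n -> {poly {poly C}}) : (forall i, P i != 0) ->
  exists2 rho, 0 < rho & finarea [set Log z | z in
    [set z | torus z /\ exists2 s, 0 < nm s < rho & forall i, ev (P i) s (z i) = 0]].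
Proof.
move=> P0.
have /choice[Q /= HQ] := fun i => exists_reduced (P0 i).
have /choice[r /= {}HQ] := HQ.
have [|rho rho0 fin] := @local_area_reduced n Q; first by move=> i; have [] := HQ i.
have [||d d0 Hd] := @fin_delta R _ (enum 'I_n) (fun i d => d <= r i).
- by move=> i d d' dd; exact: le_trans.
- by move=> i _; exists (r i) => //; have [] := HQ i.
exists (Num.min d rho); first by rewrite lt_min d0.
apply: finarea_sub fin => _ [z [tz [s /andP[s0 sm] Hz]] <-].
move: sm; rewrite lt_min => /andP[sd sr].
exists z => //; exists s; first by rewrite s0.
move=> i; have [_ _ H] := HQ i; apply: H => //.
by rewrite s0 (lt_le_trans sd) // Hd // mem_enum.
Qed.

End LocalFiniteness.

(** * From local to global *)

Section GlobalFiniteness.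
Variable R : realType.
Local Notation C := R[i].
Implicit Types (w y s b t : C) (c : {poly C}) (P : {poly {poly C}}).

Lemma finarea_roots n (rs : 'I_n -> seq C) :
  finarea [set Log z | z in [set z : 'I_n -> C | forall i, z i \in rs i]].
Proof.
pose D := (\max_(i < n) size (rs i)).+1.
have H : forall f, f \in enum {: {ffun 'I_n -> 'I_D}} ->
    finarea [set @Log R n (fun i => nth 0 (rs i) (f i))] by move=> f _; exact: finarea1.
apply: finarea_sub (finarea_seq H) => _ [z zr <-].
have /choice[f Hf] : forall i, exists j : 'I_D, nth 0 (rs i) j = z i.
  move=> i; have iD : (index (z i) (rs i) < D)%N.
    by rewrite ltnS (leq_trans (index_size _ _)) // leq_bigmax.
  by exists (Ordinal iD); rewrite /= nth_index // zr.
exists [ffun i => f i]; first by rewrite mem_enum.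
by congr Log; apply/funext => i; rewrite ffunE Hf.
Qed.

Lemma nonvanishing c : c != 0 -> exists2 t, t != 0 & c.[t] != 0.
Proof.
move=> c0; have [r r0 H] := poly_nz c0.
have tE : nm (r / 2)%:C%C = r / 2 by rewrite nm_real ger0_norm // divr_ge0 // ltW.
exists (r / 2)%:C%C; first by rewrite -nm_gt0 tE divr_gt0.
by apply: H; rewrite tE divr_gt0 //=; lra.
Qed.

Lemma nonvanishing_sp P : P != 0 -> exists2 t, t != 0 & sp t P != 0.
Proof.
rewrite -lead_coef_eq0 => /nonvanishing[t t0 Pt]; exists t => //.
apply: contraNneq Pt => sp0.
by rewrite lead_coefE -[_.[_]]/(horner_eval _ _) -coef_map -/(sp _ _) sp0 coef0.
Qed.

Lemma translate_base P b : P != 0 -> exists2 Q : {poly {poly C}}, Q != 0 &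
  forall s, sp s Q = sp (s + b) P.
Proof.
move=> P0; pose Q := map_poly (comp_poly ('X + b%:P)) P.
have QE s : sp s Q = sp (s + b) P.
  rewrite /sp /Q -map_poly_comp; apply: eq_map_poly => c /=.
  by rewrite !horner_evalE horner_comp hornerD hornerX hornerC.
exists Q => //; have [t _ Pt] := nonvanishing_sp P0.
apply: contraNneq Pt => Q0; have := QE (t - b); rewrite subrK => <-.
by rewrite Q0 /sp rmorph0.
Qed.

(** Q(s, y) = s^N P(1/s, y), obtained by reversing each coefficient; N bounds all their sizes. *)
Lemma invert_base P : P != 0 -> exists2 Q : {poly {poly C}}, Q != 0 &
  forall s y, s != 0 -> ev P s^-1 y = 0 -> ev Q s y = 0.
Proof.
move=> P0; pose N := \max_(i < size P) size (P`_i)%R.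
pose rev (c : {poly C}) : {poly C} := \poly_(k < N.+1) c`_(N - k).
have revE c s : s != 0 -> (size c <= N)%N -> (rev c).[s] = s ^+ N * c.[s^-1].
  move=> s0 cN; rewrite horner_poly (horner_coef_wide _ (leqW cN)) mulr_sumr.
  rewrite (reindex_inj rev_ord_inj) /=; apply: eq_bigr => k _.
  have kN : (k <= N)%N by rewrite -ltnS.
  rewrite subSS subKn // mulrCA; congr (_ * _).
  apply: (mulIf (expf_neq0 k s0)); rewrite -exprD subnK //.
  by rewrite -mulrA -exprMn mulVf // expr1n mulr1.
pose Q := \poly_(j < size P) rev P`_j.
have QE s : s != 0 -> sp s Q = s ^+ N *: sp s^-1 P.
  move=> s0; apply/polyP => j; rewrite coefZ !coef_map /= !horner_evalE coef_poly.
  have [jP|jP] := ltnP j (size P); first by rewrite revE // (leq_bigmax (Ordinal jP)).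
  by rewrite nth_default // !horner0 mulr0.
exists Q.
  have [t t0 Pt] := nonvanishing_sp P0.
  apply: contraNneq Pt => Q0; have t'0 : t^-1 != 0 by rewrite invr_eq0.
  have := QE _ t'0; rewrite Q0 /sp rmorph0 invrK => /esym/eqP.
  by rewrite scaler_eq0 expf_eq0 (negbTE t'0) andbF.
move=> s y s0; rewrite /ev QE // hornerZ => ->.
by rewrite mulr0.
Qed.

Section Branches.
Variables (n : nat) (i0 : 'I_n) (P : 'I_n -> {poly {poly C}}).
Hypothesis P0 : forall i, P i != 0.

(** The condition on [sp] removes the fibres where P i vanishes identically, over which z i would be
    unconstrained. *)
Definition multigraph : set ('I_n -> C) := [set z | torus z /\
  forall i, i != i0 -> sp (z i0) (P i) != 0 /\ ev (P i) (z i0) (z i) = 0].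

Lemma multigraph_near b : exists2 rho, 0 < rho &
  finarea [set Log z | z in [set z | multigraph z /\ nm (z i0 - b) < rho]].
Proof.
have /choice[Q0 HQ0] : forall i, exists Q : {poly {poly C}}, Q != 0 /\
    forall s, sp s Q = sp (s + b) (P i).
  by move=> i; have [Q Q0 HQ] := translate_base b (P0 i); exists Q.
(* The base coordinate gets the equation Y = s + b, so that every coordinate is algebraic over the
   disc. The fibre s = 0 is outside the punctured disc and is the finite set given by [rs]. *)
pose Q i : {poly {poly C}} := if i == i0 then 'X - ('X + b%:P)%:P else Q0 i.
have [|rho rho0 fin] := @local_area R n Q.
  by move=> i; rewrite /Q; case: (i =P i0) => _; [rewrite polyXsubC_eq0 | have [] := HQ0 i].
exists rho => //.
pose rs i : seq C := if i == i0 then [:: b] else sval (closed_field_poly_normal (sp b (P i))).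
apply: finarea_sub (finareaU fin (finarea_roots rs)).
move=> _ [z [[tz gz] zb] <-]; have [zb0|zb0] := eqVneq (z i0) b.
  right; exists z => // i; rewrite /rs; case: eqP => [->|/eqP ii0]; first by rewrite zb0 mem_head.
  have [] := gz i ii0; rewrite zb0; case: closed_field_poly_normal => s /= spE sp0 Pz.
  have : root (sp b (P i)) (z i) by apply/rootP.
  by rewrite spE rootZ ?lead_coef_eq0 // root_prod_XsubC.
left; exists z => //; split=> //; exists (z i0 - b); first by rewrite zb nm_gt0 subr_eq0 zb0.
move=> i; rewrite /Q; case: eqP => [->|/eqP ii0].
  by rewrite -[- _%:P]mulN1r evD evM evX -polyCN !evC hornerD hornerN !hornerE subrK mulN1r subrr.
by have [_ HQ] := HQ0 i; rewrite /ev HQ subrK; have [] := gz i ii0.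
Qed.

Lemma multigraph_infinity : exists2 M, 0 < M &
  finarea [set Log z | z in [set z | multigraph z /\ M < nm (z i0)]].
Proof.
have /choice[Q0 HQ0] : forall i, exists Q : {poly {poly C}}, Q != 0 /\
    forall s y, s != 0 -> ev (P i) s^-1 y = 0 -> ev Q s y = 0.
  by move=> i; have [Q Q0 HQ] := invert_base (P0 i); exists Q.
(* At infinity the base parameter is s = 1 / z_i0, that is s Y = 1. *)
pose Q i : {poly {poly C}} := if i == i0 then 'X%:P * 'X - 1%:P else Q0 i.
have [|rho rho0 fin] := @local_area R n Q.
  move=> i; rewrite /Q; case: (i =P i0) => _; last by have [] := HQ0 i.
  have : (('X%:P * 'X - 1%:P : {poly {poly C}})`_1 != 0).
    by rewrite coefB coefMX coefC /= coefC subr0 polyX_eq0.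
  by apply: contraNneq => ->; rewrite coef0.
exists rho^-1; first by rewrite invr_gt0.
apply: finarea_sub fin => _ [z [[tz gz] zb] <-].
have z0 : z i0 != 0 := tz i0.
exists z => //; split=> //; exists (z i0)^-1.
  by rewrite nm_gt0 invr_eq0 z0 /= nmV -[rho]invrK ltf_pV2 ?posrE ?invr_gt0 // nm_gt0.
move=> i; rewrite /Q; case: eqP => [->|/eqP ii0].
  by rewrite -[- _%:P]mulN1r evD !evM evX -polyCN !evC hornerX hornerN !hornerE mulVf // subrr.
by have [_ HQ] := HQ0 i; apply: HQ; rewrite ?invr_eq0 // invrK; have [] := gz i ii0.
Qed.

Lemma multigraph_area : finarea [set Log z | z in multigraph].
Proof.
have [M M0 finM] := multigraph_infinity.
pose box m (x y : R) : set ('I_n -> C) := [set z | [/\ multigraph z,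
  x <= complex.Re (z i0) <= x + 2 * M * 2^-1 ^+ m &
  y <= complex.Im (z i0) <= y + 2 * M * 2^-1 ^+ m]].
pose Q m (x y : R) := finarea [set Log z | z in box m x y].
have MM : 0 <= 2 * M by lra.
have QM : Q 0 (- M) (- M).
  apply: (@bisection R Q (- M) (- M) (2 * M) (2 * M) MM MM).
    move=> m x y Q1 Q2 Q3 Q4.
    apply: finarea_sub (finareaU (finareaU Q1 Q2) (finareaU Q3 Q4)).
    move=> _ [z [gz /andP[u1 u2] /andP[t1 t2]] <-].
    have half x' : x' + 2 * M * 2^-1 ^+ m.+1 + 2 * M * 2^-1 ^+ m.+1 = x' + 2 * M * 2^-1 ^+ m.
      by rewrite exprS; field.
    have [ul|ul] := leP (complex.Re (z i0)) (x + 2 * M * 2^-1 ^+ m.+1);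
    have [tl|tl] := leP (complex.Im (z i0)) (y + 2 * M * 2^-1 ^+ m.+1).
    - by left; left; exists z => //; split=> //; apply/andP.
    - by right; left; exists z => //; split=> //; rewrite ?half ?u1 ?(ltW tl).
    - by left; right; exists z => //; split=> //; rewrite ?half ?t1 ?(ltW ul).
    - by right; right; exists z => //; split=> //; rewrite ?half ?(ltW ul) ?(ltW tl).
  move=> u t _ _; have [rho rho0 fin] := multigraph_near (Complex u t).
  exists (rho / 2); first by rewrite divr_gt0.
  move=> m x y; set e := 2 * M * _ => em _ xu yt.
  apply: finarea_sub fin => _ [z [gz zx zy] <-]; exists z => //; split=> //.
  rewrite -/e in zx zy.
  apply: le_lt_trans (nm_le_ReIm _) _; rewrite ReD ImD ReN ImN /=.
  have : `|complex.Re (z i0) - u| <= e.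
    by move/andP: xu; move/andP: zx; rewrite ler_norml => -[? ?] [? ?]; apply/andP; split; lra.
  have : `|complex.Im (z i0) - t| <= e.
    by move/andP: yt; move/andP: zy; rewrite ler_norml => -[? ?] [? ?]; apply/andP; split; lra.
  lra.
apply: finarea_sub (finareaU QM finM) => _ [z gz <-].
have [zM|zM] := leP (nm (z i0)) M; last by right; exists z.
have := le_trans (nm_ge_Re (z i0)) zM; have := le_trans (nm_ge_Im (z i0)) zM.
rewrite !ler_norml => /andP[? ?] /andP[? ?].
by left; exists z => //; split=> //; rewrite expr0 mulr1; apply/andP; split; lra.
Qed.

End Branches.

(** A coordinate may be constant on part of X, so no single base coordinate works. Outside the
    finite set [F] no fibre polynomial vanishes identically: points with all coordinates in F are
    finitely many, and any other point lies in the multigraph over one of its coordinates outside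
    F. *)
Lemma pairwise_dependent_area n (X : set ('I_n -> C)) : X `<=` @torus R n ->
  (forall i j, i != j -> exists2 P : {poly {poly C}}, P != 0 &
     forall z, X z -> ev P (z i) (z j) = 0) ->
  finarea [set Log z | z in X].
Proof.
move=> Xt dep.
have /choice[P /= HP] : forall ij : 'I_n * 'I_n, exists P : {poly {poly C}}, P != 0 /\
    (ij.1 != ij.2 -> forall z, X z -> ev P (z ij.1) (z ij.2) = 0).
  move=> [i j] /=; have [->|ij] := eqVneq i j; first by exists 1; rewrite oner_neq0.
  by have [P P0 HP] := dep i j ij; exists P.
pose F : seq C := flatten [seq sval (closed_field_poly_normal (lead_coef (P ij))) |
  ij <- enum {: 'I_n * 'I_n}].
have HF ij (c : C) : c \notin F -> sp c (P ij) != 0.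
  apply: contraNneq => sp0; apply/flatten_mapP; exists ij; first by rewrite mem_enum.
  have l0 : lead_coef (P ij) != 0 by rewrite lead_coef_eq0; have [] := HP ij.
  have : root (lead_coef (P ij)) c.
    by rewrite /root lead_coefE -[_.[_]]/(horner_eval _ _) -coef_map -/(sp _ _) sp0 coef0.
  case: closed_field_poly_normal => s /= lE; rewrite lE rootZ ?root_prod_XsubC //.
  by rewrite lead_coef_eq0.
have fin i : i \in enum 'I_n -> finarea [set Log z | z in multigraph i (fun j => P (i, j))].
  by move=> _; apply: multigraph_area => j; have [] := HP (i, j).
apply: finarea_sub (finareaU (finarea_roots (fun=> F)) (finarea_seq fin)).
move=> _ [z Xz <-]; have [zF|/existsNP[i zF]] := pselect (forall i, z i \in F).
  by left; exists z.
right; exists i; first by rewrite mem_enum.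
exists z => //; split; first exact: Xt.
move=> j ji; split; first by apply: HF; apply/negP.
by have [_ H] := HP (i, j); apply: H; rewrite // eq_sym.
Qed.

Lemma bivariate_of_mpoly (p : mpoly 2 C) : p != 0 -> exists2 P : {poly {poly C}}, P != 0 &
  forall v : 'I_2 -> C, ev P (v ord0) (v ord_max) = meval v p.
Proof.
move=> p0.
pose P : {poly {poly C}} := \sum_(m <- msupp p) (mcoeff m p *: 'X^(m ord0)) *: 'X^(m ord_max).
exists P.
  have [m0 m0p] : exists m, m \in msupp p by exists (mlead p); exact: mlead_supp.
  have PE : (P`_(m0 ord_max))`_(m0 ord0) = mcoeff m0 p.
    rewrite coef_sum coef_sum (bigD1_seq m0) ?msupp_uniq //= big1 => [|m mm].
      by rewrite coefZ coefXn eqxx mulr1 coefZ coefXn eqxx mulr1 addr0.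
    rewrite coefZ coefXn; case: eqP => [e1|_]; last by rewrite mulr0 coef0.
    rewrite mulr1 coefZ coefXn; case: eqP => [e0|_]; last by rewrite mulr0.
    case/negP: mm; apply/eqP/mnmP => i; have [->|i0] := eqVneq i ord0; first by rewrite e0.
    have -> : i = ord_max by apply/val_inj; case: i i0 => [[|[|]]].
    by rewrite e1.
  have : mcoeff m0 p != 0 by rewrite -mcoeff_msupp.
  by apply: contraNneq => P0; rewrite -PE P0 !coef0.
move=> v; rewrite mevalE /P.
elim/big_rec2: _ => [|m a Q _ <-]; first by rewrite /ev /sp rmorph0 horner0.
rewrite evD; congr (_ + _); rewrite -mul_polyC evM evC.
have -> : ev 'X^(m ord_max) (v ord0) (v ord_max) = v ord_max ^+ m ord_max.
  by rewrite /ev /sp map_polyXn hornerXn.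
rewrite hornerZ hornerXn big_ord_recl big_ord1 -mulrA.
by have -> : lift ord0 ord0 = ord_max :> 'I_2 by exact/val_inj.
Qed.

End GlobalFiniteness.

Lemma laurent_coordinate (R : realType) n (i : 'I_n) : @laurent R n (fun z => z i).
Proof.
by exists (mpolyX _ (mnm1 i)), 0%N => z _; rewrite mevalXU expr0 divr1.
Qed.

Theorem theorem3p1 (R : realType) (n : nat) (hn : (2 <= n)%N)
    (C : set ('I_n -> R[i]))
    (hC : algebraic_curve C)
    (hsub : forall Z : set ('I_n -> R[i]), irreducible_component C Z ->
      forall (d : nat) (T : set ('I_n -> R[i])), (d < 2)%N ->
        algebraic_subtorus d T -> ~ (Z `<=` T)%classic) :
  (area (amoeba C) < +oo)%E.
Proof.
have [[S _ CE] [_ dimC] _] := hC.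
apply: area_finite; apply: pairwise_dependent_area; first by rewrite CE => z [].
move=> i j _; pose f (k : 'I_2) : ('I_n -> R[i]) -> R[i] :=
  fun z => if k == ord0 then z i else z j.
have [p [p0 pC]] : exists p : mpoly 2 R[i], p != 0 /\
    forall z, C z -> meval (fun k => f k z) p = 0.
  (* Independent coordinates z_i, z_j would be two algebraically independent regular functions on a
     set of dimension 1. *)
  apply: contrapT => H; suff : (2 <= 1)%N by [].
  apply: (dimC 2 f) => [k|p pC].
    by rewrite /f; case: (k == ord0); exact: laurent_coordinate.
  by apply: contrapT => /eqP p0; apply: H; exists p.
have [P P0 HP] := bivariate_of_mpoly p0; exists P => // z Cz.
by have := HP (fun k => f k z); rewrite pC.
Qed.
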